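(* Fix $n\in\mathbb{N}$ and let $\Omega$, $A$, $d$, $r$, $H$, $f$, $b$, $\xi^n$ and $F_n$ be as in the context. Assume that (i) $b:\mathbb{R}\to\mathbb{R}$ is locally Lipschitz and bounded, i.e. there exists a constant $C_b$ such that $|b(w)|\le C_b$ for all $w\in\mathbb{R}$; (ii) $f:\Omega-\Omega\to\mathbb{R}$ is bounded; (iii) $\xi^n:[-r,0]\times L^2(\Omega)\times L^2(-r,0;L^2(\Omega))\to\mathbb{R}$ satisfies: (a) for any $M>0$ there exists $L_{\xi,M,n}$ such that for all $(v^i,\psi^i)\in H$ with $\|v^i\|^2+\int_{-r}^0\|\psi^i(s)\|^2ds\le M^2$, $i=1,2$, one has $$\int_{-r}^0|\xi^n(\theta,v^1,\psi^1)-\xi^n(\theta,v^2,\psi^2)|\,d\theta\le L_{\xi,M,n}\Big(\|v^1-v^2\|^2+\int_{-r}^0\|\psi^1(s)-\psi^2(s)\|^2ds\Big)^{1/2};$$ (b) there exists $C_{\xi,1}>0$ such that $\|\xi^n(\cdot,v,\psi)\|_{L^1(-r,0)}\le C_{\xi,1}$ for all $(v,\psi)\in H$. Then for any $(u^0,\varphi)\in H$ and every $T>0$, the problem $$\frac{\partial}{\partial t}u(t,x)+Au(t,x)+du(t,x)=\big(F_n(u_t)\big)(x),\quad x\in\Omega,\qquad u(0+)=u^0,\quad u|_{(-r,0)}=\varphi,$$ has a weak solution $u$ on $[0,T]$ which satisfies $u\in C([0,T];L^2(\Omega))$.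
   Context: Setting. $\Omega\subset\mathbb{R}^{n_0}$ is a smooth bounded domain, $\Omega-\Omega=\{x-y:x,y\in\Omega\}$; $\|\cdot\|$ and $\langle\cdot,\cdot\rangle$ are the norm and inner product of $L^2(\Omega)$ (also used for the corresponding duality pairing). $A$ is a densely defined self-adjoint positive linear operator with domain $D(A)\subset L^2(\Omega)$ and compact resolvent (so it has an orthonormal eigenbasis with positive eigenvalues tending to $+\infty$); $D(A^\alpha)$ denotes the domain of the power $A^\alpha$ (for $\alpha<0$ the completion of $L^2(\Omega)$ in the norm $\|A^\alpha\cdot\|$). $d>0$ and $r>0$ are constants. $H=L^2(\Omega)\times L^2(-r,0;L^2(\Omega))$. For a function $u$ defined on $(-r,T)$ and $t\in[0,T)$, $u_t$ denotes the function $u_t(\theta)=u(t+\theta)$, $\theta\in(-r,0)$. Distributed state-dependent delay term: $$\big(F_n(u_t)\big)(x)=\int_{-r}^0\Big\{\int_\Omega b(u(t+\theta,y))f(x-y)\,dy\Big\}\,\xi^n(\theta,u(t),u_t)\,d\theta .$$ Weak solution. A function $u$ is a weak solution of the problem with initial data $(u^0,\varphi)\in H$ on $[0,T]$ if $u\in L^\infty(0,T;L^2(\Omega))\cap L^2(-r,T;L^2(\Omega))\cap L^2(0,T;D(A^{1/2}))$, $u(\theta)=\varphi(\theta)$ for $\theta\in(-r,0)$, and $$-\int_0^T\langle u,\dot v\rangle dt+\int_0^T\langle A^{1/2}u,A^{1/2}v\rangle dt+\int_0^T\langle du-F_n(u_t),v\rangle dt=\langle u^0,v(0)\rangle$$ for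 every $v\in L^2(0,T;D(A^{1/2}))$ with $\dot v\in L^2(0,T;D(A^{-1/2}))$ and $v(T)=0$. *)

(* Defs.v *)
From HB Require Import structures.
From mathcomp Require Import all_boot all_order all_algebra.
From mathcomp Require Import all_classical all_reals all_analysis.
From mathcomp Require Import measurable_realfun ess_sup_inf ring_quotient.
From mathcomp Require Import ring lra.

Set Implicit Arguments.
Unset Strict Implicit.
Unset Printing Implicit Defensive.

Import Order.TTheory GRing.Theory Num.Theory.
Import numFieldNormedType.Exports.

Local Open Scope classical_set_scope.
Local Open Scope ring_scope.
Local Open Scope quotient_scope.

Section borel_rV.
Context (R : realType) (n : nat).
Let opens : set_system 'rV[R]_n := open.

HB.instance Definition _ := @isMeasurable.Build (sigma_display opens)
  'rV[R]_n <<s opens >> (@sigma_algebra0 _ setT opens)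
  (@sigma_algebraC _ opens) (@sigma_algebra_bigcup _ setT opens).

Lemma measurable_open_rV (U : set 'rV[R]_n) : open U -> measurable U.
Proof. exact: sub_sigma_algebra. Qed.

End borel_rV.

Section cons_rV.
Context (R : realType) (n : nat).

Definition cons_rV (p : R * 'rV[R]_n) : 'rV[R]_n.+1 :=
  \row_i oapp (p.2 ord0) p.1 (unlift ord0 i).

Definition uncons_rV (v : 'rV[R]_n.+1) : R * 'rV[R]_n :=
  (v ord0 ord0, \row_j v ord0 (lift ord0 j)).

Lemma cons_rVK : cancel cons_rV uncons_rV.
Proof.
move=> [x v]; rewrite /uncons_rV /cons_rV mxE unlift_none; congr (_, _).
by apply/rowP => j; rewrite !mxE liftK.
Qed.

Lemma uncons_rVK : cancel uncons_rV cons_rV.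
Proof.
move=> v; apply/rowP => i; rewrite mxE /=.
by case: unliftP => [j|] -> //=; rewrite mxE.
Qed.

Lemma ball_rVE (v w : 'rV[R]_n) e : 0 < e ->
  ball v e w <-> forall i, ball (v ord0 i) e (w ord0 i).
Proof.
move=> e0; split=> [[_ vw] i//|vw]; split=> // i j.
by rewrite (ord1 i).
Qed.

End cons_rV.

Section cons_rV_measurable.
Context (R : realType) (n : nat).

Let ratv m (q : 'rV[rat]_m) : 'rV[R]_m := map_mx ratr q.

Let open_rV_bigcup (m : nat) (U : set 'rV[R]_m) : open U ->
  U = \bigcup_(p : 'rV[rat]_m * nat)
        (if `[< ball (ratv p.1) (p.2.+1%:R^-1) `<=` U >]
         then ball (ratv p.1) (p.2.+1%:R^-1) else set0).
Proof.
move=> oU; apply/seteqP; split => [x Ux|x [p _]]; last first.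
  by case: ifPn => // /asboolP; exact.
have /nbhs_ballP[e /= e0 xeU] : nbhs x U by exact: open_nbhs_nbhs.
have /ltr_add_invr[k] : 0 < e / 2 by lra.
rewrite add0r => ke; pose d : R := k.+1%:R^-1.
have d0 : 0 < d by rewrite invr_gt0.
have de : d + d <= e by rewrite -/d in ke; lra.
have /choice[q xq] : forall i, exists q : rat, ball (x ord0 i) d (ratr q).
  move=> i; have [q] := @rat_in_itvoo R (x ord0 i - d) (x ord0 i + d) ltac:(lra).
  rewrite in_itv/= => /andP[h1 h2]; exists q.
  by rewrite /ball/= ltr_distlC h1 h2.
pose Q : 'rV[rat]_m := \row_i q i.
have Qx : ball (ratv Q) d x.
  by apply/ball_rVE => // i; rewrite !mxE; exact: ball_sym.
exists (Q, k) => //=; case: ifPn => //= /asboolP; case.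
move=> y Qy; apply: xeU; apply: le_ball de _ _.
by apply: ball_triangle Qy; exact: ball_sym.
Qed.

Lemma measurable_cons_rV : measurable_fun [set: R * 'rV[R]_n] (@cons_rV R n).
Proof.
apply: (@measurability _ _ _ _ _ _ (open : set_system 'rV[R]_n.+1)) => //.
move=> _ [U oU <-]; rewrite setTI (open_rV_bigcup oU) preimage_bigcup.
apply: countable_bigcupT_measurable => [|[q k]]; first exact: countableP.
rewrite /=.
case: ifPn => _; last by rewrite preimage_set0.
set d := (X in ball _ X); have d0 : 0 < d by rewrite invr_gt0.
move: (ratv q) d d0 => {k}w d d0.
rewrite (_ : _ @^-1` _ = ball (w ord0 ord0) d `*` ball (uncons_rV w).2 d).
  apply: measurableX; first by apply: open_measurable; exact: ball_open.
  apply: measurable_open_rV; exact: ball_open.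
apply/seteqP; split => -[x v] /=.
  move=> /ball_rVE -/(_ d0) h; split.
    by have := h ord0; rewrite mxE unlift_none.
  by apply/ball_rVE => // j; have := h (lift ord0 j); rewrite !mxE liftK.
move=> [h1 /ball_rVE -/(_ d0) h2]; apply/ball_rVE => // i; rewrite mxE.
by case: unliftP => [j|] -> //=; have := h2 j; rewrite mxE.
Qed.

End cons_rV_measurable.

Section uncons_rV_measurable.
Context (R : realType) (n : nat).

Let uncons_continuous : continuous (fun v => (@uncons_rV R n v).2).
Proof.
move=> v U /= /nbhs_ballP[e /= e0 vU].
apply/nbhs_ballP; exists e => //= w /ball_rVE -/(_ e0) vw.
by apply: vU; apply/ball_rVE => // j; rewrite !mxE; exact: vw.
Qed.

Lemma measurable_uncons_rV : measurable_fun [set: 'rV[R]_n.+1] (@uncons_rV R n).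
Proof.
apply/measurable_fun_pairP; split => /=.
  apply: (measurability _ (RGenOpens.measurableE R)).
  move=> _ [_ [a [b ->] <-]]; rewrite setTI; apply: measurable_open_rV.
  by apply: open_comp => [v _|]; [exact: coord_continuous|exact: interval_open].
apply: (@measurability _ _ _ _ _ _ (open : set_system 'rV[R]_n)) => //.
move=> _ [U oU <-]; rewrite setTI; apply: measurable_open_rV.
by apply: open_comp => // v _; exact: uncons_continuous.
Qed.

End uncons_rV_measurable.

Section lebesgue_rVS.
Context (R : realType) (n : nat).
Variable m : {sigma_finite_measure set 'rV[R]_n -> \bar R}.
Local Open Scope ereal_scope.

(* product of the Lebesgue measure on R with m, carried to R^n.+1 *)
Definition lebesgue_rVS (A : set 'rV[R]_n.+1) : \bar R :=
  (@lebesgue_measure R \x m) (@cons_rV R n @^-1` A).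

Let lebesgue_rVS0 : lebesgue_rVS set0 = 0.
Proof. by rewrite /lebesgue_rVS preimage_set0 measure0. Qed.

Let lebesgue_rVS_ge0 A : 0 <= lebesgue_rVS A.
Proof. exact: measure_ge0. Qed.

Let lebesgue_rVS_sigma_additive : semi_sigma_additive lebesgue_rVS.
Proof.
move=> F mF tF mUF; rewrite /lebesgue_rVS preimage_bigcup.
apply: measure_semi_sigma_additive.
- by move=> k; rewrite -[X in measurable X]setTI; exact: measurable_cons_rV.
- apply/trivIsetP => /= i j _ _ ij; rewrite -preimage_setI.
  by move/trivIsetP : tF => /(_ _ _ _ _ ij) ->//; rewrite preimage_set0.
- by rewrite -preimage_bigcup -[X in measurable X]setTI; exact: measurable_cons_rV.
Qed.

HB.instance Definition _ := isMeasure.Build _ _ _ lebesgue_rVS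
  lebesgue_rVS0 lebesgue_rVS_ge0 lebesgue_rVS_sigma_additive.

Let lebesgue_rVS_sigma_finite : sigma_finite [set: 'rV[R]_n.+1] lebesgue_rVS.
Proof.
have /sigma_finiteP[F [TF ndF Foo]] := sigma_finiteT (@lebesgue_measure R).
have /sigma_finiteP[G [TG ndG Goo]] := sigma_finiteT m.
exists (fun k => @uncons_rV R n @^-1` (F k `*` G k)).
  rewrite -preimage_bigcup (_ : \bigcup_k _ = setT)// -setXTT TF TG.
  rewrite predeqE => -[x y]; split => [[k _ []]|[/= [k _ Fkx] [l _ Gly]]].
    by move=> ? ?; split; exists k.
  exists (maxn k l) => //; split.
  - by move: x Fkx; exact/subsetPset/ndF/leq_maxl.
  - by move: y Gly; exact/subsetPset/ndG/leq_maxr.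
move=> k; have [? ?] := Foo k; have [? ?] := Goo k.
have mFG : measurable (F k `*` G k) by exact: measurableX.
split; first by rewrite -[X in measurable X]setTI; exact: measurable_uncons_rV.
rewrite /lebesgue_rVS -comp_preimage (_ : _ \o _ = id); last first.
  by apply/funext => p; exact: cons_rVK.
by rewrite preimage_id product_measure1E// lte_mul_pinfty// ge0_fin_numE.
Qed.

HB.instance Definition _ := Measure_isSigmaFinite.Build _ _ _ lebesgue_rVS
  lebesgue_rVS_sigma_finite.

End lebesgue_rVS.

Fixpoint lebesgue_rV (R : realType) (n : nat) :
    {sigma_finite_measure set 'rV[R]_n -> \bar R} :=
  match n with
  | 0%N => dirac (0 : 'rV[R]_0)
  | n'.+1 => lebesgue_rVS (lebesgue_rV R n')
  end.

Section L2_def.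
Context d (T : measurableType d) (R : realType).
Variable mu : {measure set T -> \bar R}.

Definition L2fun := LfunType mu (lee1n 2).

Definition ae_zero : {pred L2fun} := [pred f : L2fun | `[< (f : T -> R) = cst 0 %[ae mu] >]].

Lemma ae_zeroP (f : L2fun) : f \in ae_zero <-> \forall x \ae mu, f x = 0.
Proof.
rewrite -topredE /=; split=> [/asboolP|] h; last apply/asboolP.
  by apply: filterS h => x; exact.
by apply: filterS h => x ->.
Qed.

Lemma ae_zero_zmod_closed : zmod_closed ae_zero.
Proof.
split=> [|f g]; first by apply/ae_zeroP; exact: aeW.
move=> /ae_zeroP f0 /ae_zeroP g0; apply/ae_zeroP.
by apply: filterS2 f0 g0 => x f0 g0; rewrite [LHS]/= [LHS](_ : _ = f x - g x)// f0 g0 subr0.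
Qed.

HB.instance Definition _ :=
  GRing.isZmodClosed.Build L2fun ae_zero ae_zero_zmod_closed.

Definition L2 : Type := Quotient.quot ae_zero.

HB.instance Definition _ := Choice.on L2.
HB.instance Definition _ := EqQuotient.on L2.
HB.instance Definition _ := GRing.Zmodule.on L2.

Definition L2class (f : L2fun) : L2 := \pi_L2 f.

Lemma L2class_eq (f g : L2fun) :
  L2class f = L2class g <-> \forall x \ae mu, f x = g x.
Proof.
have -> : (L2class f = L2class g) <-> (f - g \in ae_zero).
  by rewrite Quotient.idealrBE; split => /eqP.
rewrite ae_zeroP; split; apply: filterS => x /=.
  by move=> /eqP; rewrite subr_eq0 => /eqP.
by move=> fg; rewrite [LHS](_ : _ = f x - g x)// fg subrr.
Qed.

Lemma L2classK (u : L2) : L2class (repr u) = u.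
Proof. exact: reprK. Qed.

Lemma repr_L2class (f : L2fun) :
  \forall x \ae mu, (repr (L2class f) : L2fun) x = f x.
Proof. by apply/L2class_eq; rewrite L2classK. Qed.

Lemma L2classD : {morph L2class : f g / f + g}.
Proof. by move=> f g; rewrite /L2class Quotient.pi_add. Qed.

Definition L2scale (a : R) (u : L2) : L2 := L2class (a *: (repr u : L2fun)).

Lemma L2scale_class a f : L2scale a (L2class f) = L2class (a *: f).
Proof.
apply/L2class_eq; apply: filterS (repr_L2class f) => x fx.
by rewrite [LHS](_ : _ = a * (repr (L2class f) : L2fun) x)// fx.
Qed.

Let L2scaleA a b u : L2scale a (L2scale b u) = L2scale (a * b) u.
Proof. by rewrite -(L2classK u) !L2scale_class scalerA. Qed.

Let L2scale1 : left_id 1 L2scale.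
Proof. by move=> u; rewrite -(L2classK u) L2scale_class scale1r. Qed.

Let L2scaleDr : right_distributive L2scale +%R.
Proof.
move=> a u v; rewrite -(L2classK u) -(L2classK v) -L2classD !L2scale_class.
by rewrite scalerDr L2classD.
Qed.

Let L2scaleDl u : {morph L2scale^~ u : a b / a + b}.
Proof.
move=> a b /=; rewrite -(L2classK u) !L2scale_class -L2classD.
by rewrite scalerDl.
Qed.

HB.instance Definition _ := GRing.Zmodule_isLmodule.Build R L2
  L2scaleA L2scale1 L2scaleDr L2scaleDl.

Definition L2norm (u : L2) : R := fine ('N[mu]_2%:E[EFin \o (repr u : L2fun)]).

Lemma L2norm_class (f : L2fun) :
  L2norm (L2class f) = fine ('N[mu]_2%:E[EFin \o f]).
Proof.
rewrite /L2norm unlock; congr (fine (_ `^ _)%E).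
have mL (g : L2fun) :
    measurable_fun setT (fun x => (`|(EFin \o g) x| `^ 2)%E).
  apply: (@measurableT_comp _ _ _ _ _ _ (fun x : \bar R => x `^ 2)%E) => //.
    exact: measurable_poweR.
  by apply: measurableT_comp => //; apply/measurable_EFinP.
apply: ae_eq_integral => //.
by apply: filterS (repr_L2class f) => x /= ->.
Qed.

Let L2normD (u v : L2) : L2norm (u + v) <= L2norm u + L2norm v.
Proof.
rewrite -(L2classK u) -(L2classK v) -L2classD !L2norm_class.
exact: ler_LnormD.
Qed.

Let L2normZ a (u : L2) : L2norm (a *: u) = `|a| * L2norm u.
Proof.
rewrite -(L2classK u) [a *: _]L2scale_class !L2norm_class.
apply: EFin_inj; rewrite EFinM !finite_norm_fine; exact: LnormZ.
Qed.

Let L2norm_eq0 (u : L2) : L2norm u = 0 -> u = 0.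
Proof.
move=> /fine_Lnormr_eq0 u0; rewrite -(L2classK u).
have <- : L2class 0 = 0 by apply: (addrI (L2class 0)); rewrite -L2classD !addr0.
by apply/L2class_eq; apply: filterS u0 => x; exact.
Qed.

HB.instance Definition _ := Lmodule_isNormed.Build R L2
  L2normD L2normZ L2norm_eq0.

Definition L2rep (u : L2) : T -> R := (repr u : L2fun).

Definition L2dot (u v : L2) : R :=
  \int[mu]_x (L2rep u x * L2rep v x).

Lemma L2dotE u : L2dot u u = `|u| ^+ 2.
Proof.
rewrite -[`|u|]/(L2norm u); apply: EFin_inj.
have i2 := Lfun2_integrable_sqr (LfunP (repr u : L2fun)).
rewrite /L2dot /Rintegral fineK; last first.
  by apply: (integrable_fin_num measurableT).
have n0 : 0 <= L2norm u by rewrite fine_ge0 ?Lnorm_ge0.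
rewrite -(powR_mulrn 2 n0) -poweR_EFin finite_norm_fine poweR_Lnorm//.
apply: eq_integral => x _.
by rewrite /= powR_mulrn// real_normK ?num_real// expr2.
Qed.

(* junk value 0 when f is not square-integrable *)
Definition toL2 (f : T -> R) : L2 :=
  if pselect (f \in Lfun mu 2%:E) is left Pf then L2class (Lfun_Sub (lee1n 2) Pf)
  else 0.

End L2_def.


Section smooth_domains.
Context (R : realType) (n : nat).

Fixpoint C_k (k : nat) (g : 'rV[R]_n -> R) : Prop :=
  if k is k'.+1 then
    continuous g /\ forall i : 'I_n,
      (forall x, derivable g x (delta_mx 0 i)) /\
      C_k k' (fun x => 'D_(delta_mx 0 i) g x)
  else continuous g.

Definition C_infty (g : 'rV[R]_n -> R) : Prop := forall k, C_k k g.

(* Near each boundary point, D is a sublevel set of a smooth local defining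
   function with nonvanishing gradient. *)
Definition smooth_boundary (D : set 'rV[R]_n) : Prop :=
  forall x, (closure D `\` D°) x ->
  exists (U : set 'rV[R]_n) (g : 'rV[R]_n -> R),
    [/\ open_nbhs x U, C_infty g,
        exists i : 'I_n, 'D_(delta_mx 0 i) g x != 0 &
        D `&` U = [set y | g y < 0] `&` U].

Record smooth_bounded_domain := SmoothBoundedDomain {
  dom_set :> set 'rV[R]_n ;
  dom_open : open dom_set ;
  dom_connected : connected dom_set ;
  dom_nonempty : dom_set !=set0 ;
  dom_bounded : bounded_set dom_set ;
  dom_smooth : smooth_boundary dom_set }.

Definition lebesgue_on (Omega : smooth_bounded_domain) :
    {measure set 'rV[R]_n -> \bar R} :=
  mrestr (lebesgue_rV R n) (measurable_open_rV (@dom_open Omega)).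

(* Functions on R^n, identified when they agree a.e. on Omega. *)
Definition L2dom (Omega : smooth_bounded_domain) : normedModType R :=
  L2 (lebesgue_on Omega).

Definition difference_set (D : set 'rV[R]_n) : set 'rV[R]_n :=
  [set x - y | x in D & y in D].

End smooth_domains.

Record unbounded_operator (V : Type) := UnboundedOperator {
  op_dom : set V ;
  op_fun :> V -> V }.

Section operators.
Context d (T : measurableType d) (R : realType).
Variable mu : {measure set T -> \bar R}.
Notation H := (L2 mu).
Notation "<< u , v >>" := (L2dot u v).
Implicit Types A : unbounded_operator H.

Definition linear_op A : Prop :=
  op_dom A 0 /\
  forall (a : R) (u v : H), op_dom A u -> op_dom A v ->
    op_dom A (a *: u + v) /\ A (a *: u + v) = a *: A u + A v.

(* (v, w) lies in the graph of the adjoint of A *)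
Definition adjoint_graph A (v w : H) : Prop :=
  forall u, op_dom A u -> << A u, v >> = << u, w >>.

Definition selfadjoint_op A : Prop :=
  forall v w, adjoint_graph A v w <-> op_dom A v /\ A v = w.

Definition positive_op A : Prop :=
  forall u, op_dom A u -> u != 0 -> 0 < << A u, u >>.

Definition compact_map (K : H -> H) : Prop :=
  forall B : set H, bounded_set B -> compact (closure (K @` B)).

Definition compact_resolvent A : Prop :=
  exists (l : R) (K : H -> H),
    [/\ forall h, op_dom A (K h) /\ A (K h) - l *: K h = h,
        forall u, op_dom A u -> K (A u - l *: u) = u &
        compact_map K].

Definition eigenbasis A (e : nat -> H) (lam : nat -> R) : Prop :=
  [/\ forall i j, << e i, e j >> = (i == j)%:R,
      forall u, series (fun k => << u, e k >> *: e k) @ \oo --> u,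
      forall k, op_dom A (e k) /\ A (e k) = lam k *: e k,
      forall k, 0 < lam k &
      lam @ \oo --> +oo].

Definition pow_graph A (a : R) (u w : H) : Prop :=
  exists e lam, eigenbasis A e lam /\
    series (fun k => (lam k `^ a * << u, e k >>) *: e k) @ \oo --> w.

(* A^a for a self-adjoint positive A with compact resolvent.  For a <= 0 its
   domain is the whole of H. *)
Definition op_pow A (a : R) : unbounded_operator H :=
  UnboundedOperator [set u | exists w, pow_graph A a u w]
                    (fun u => get [set w | pow_graph A a u w]).

End operators.

Section time_dependent.
Context d (T : measurableType d) (R : realType).
Variable mu : {measure set T -> \bar R}.
Notation H := (L2 mu).
Notation leb := (@lebesgue_measure R).
Implicit Types (I : set R) (g h u v : R -> H).

(* Classes of L^2(I; H) are handled through their Borel representatives.  H is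
   separable in the intended use, so that Borel and strong (Bochner)
   measurability agree. *)
Definition L2time I g : Prop :=
  measurable_fun I (g : R -> g_sigma_algebraType (@open H)) /\
  (\int[leb]_(t in I) (`|g t| ^+ 2)%:E < +oo)%E.

Definition Linfty_time I g : Prop :=
  measurable_fun I (g : R -> g_sigma_algebraType (@open H)) /\
  exists M : R, \forall t \ae leb, I t -> `|g t| <= M.

(* g in L^2(I; D(A^a)), a >= 0, D(A^a) being normed by |A^a .| *)
Definition L2time_pow (A : unbounded_operator H) (a : R) I g : Prop :=
  (\forall t \ae leb, I t -> op_dom (op_pow A a) (g t)) /\
  L2time I (fun t => op_pow A a (g t)).

(* A^(-1/2) extends to an isometry of D(A^(-1/2)), the completion of H in the
   norm |A^(-1/2) .|, onto H: the embedding A^(-1/2) : H -> H is isometric for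
   that norm and has dense range, so it is a model of the completion.  An
   element z of D(A^(-1/2)) is therefore represented by h = A^(-1/2) z in H,
   an element w of H being represented by A^(-1/2) w, and the duality pairing
   of u in D(A^(1/2)) with z is <A^(1/2) u, h>. *)
Definition dual_pairing (A : unbounded_operator H) (u h : H) : R :=
  L2dot (op_pow A 2^-1 u) h.

(* v' = z on [0, T], for z in L^1(0, T; D(A^(-1/2))) represented by h: v is
   the primitive of z.  In particular v is the continuous representative of its
   class, which is the one that v 0 and v T refer to.  The H-valued Bochner
   integral of h is tested against the elements of H. *)
Definition has_time_derivative (A : unbounded_operator H) (Tmax : R) v h :=
  forall t, t \in `[0, Tmax] -> forall w : H,
    L2dot (op_pow A (- 2^-1) (v t)) w =
    L2dot (op_pow A (- 2^-1) (v 0)) w +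
    \int[leb]_(s in `[0, t]) L2dot (h s) w.

Definition history u (t : R) : R -> H := fun theta => u (t + theta).

Definition history_sqnorm (r : R) (w : H) (psi : R -> H) : R :=
  `|w| ^+ 2 + \int[leb]_(s in `]- r, 0[) `|psi s| ^+ 2.

(* xi is a function of the class of its last argument *)
Definition history_extensional (r : R) (xi : R -> H -> (R -> H) -> R) : Prop :=
  forall theta w psi1 psi2, theta \in `[- r, 0] ->
    L2time `]- r, 0[ psi1 -> L2time `]- r, 0[ psi2 ->
    (\forall s \ae leb, s \in `]- r, 0[ -> psi1 s = psi2 s) ->
    xi theta w psi1 = xi theta w psi2.

End time_dependent.

Section delay_problem.
Context (R : realType) (n : nat) (Omega : smooth_bounded_domain R n).
Notation H := (L2dom Omega).
Notation leb := (@lebesgue_measure R).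
Variables (A : unbounded_operator H) (d r : R).
Variables (b : R -> R) (f : 'rV[R]_n -> R) (xi : R -> H -> (R -> H) -> R).

(* F(psi) when w is the value at time 0 of the history psi *)
Definition delay_term (w : H) (psi : R -> H) : H :=
  toL2 (lebesgue_on Omega)
   ((fun x => \int[leb]_(theta in `]- r, 0[)
      ((\int[lebesgue_rV R n]_(y in Omega) (b (L2rep (psi theta) y) * f (x - y)))
       * xi theta w psi)) \_ Omega).

Definition delay_at (u : R -> H) (t : R) : H := delay_term (u t) (history u t).

Definition weak_solution (u0 : H) (phi : R -> H) (Tmax : R) (u : R -> H) :=
  [/\ Linfty_time `]0, Tmax[ u,
      L2time `]- r, Tmax[ u,
      L2time_pow A 2^-1 `]0, Tmax[ u,
      forall theta, theta \in `]- r, 0[ -> u theta = phi theta &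
      forall v dv : R -> H,
        L2time_pow A 2^-1 `]0, Tmax[ v -> L2time `]0, Tmax[ dv ->
        has_time_derivative A Tmax v dv -> v Tmax = 0 ->
        - (\int[leb]_(t in `]0, Tmax[) dual_pairing A (u t) (dv t))
        + \int[leb]_(t in `]0, Tmax[)
            L2dot (op_pow A 2^-1 (u t)) (op_pow A 2^-1 (v t))
        + \int[leb]_(t in `]0, Tmax[) L2dot (d *: u t - delay_at u t) (v t)
        = L2dot u0 (v 0)].

End delay_problem.

(* Main.v *)
(** Expand in an orthonormal eigenbasis e_k of A, with eigenvalues lam_k, obtained
    by maximizing |K v| for a compact resolvent K of A.  For a bounded measurable
    forcing g, the mild solution has the coordinates
      exp (- (lam_k + d) t) <u0, e_k> + \int_0^t exp (- (lam_k + d) (t - s)) <g s, e_k> ds,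
    and Cauchy-Schwarz bounds \sum_k lam_k <w t, e_k>^2 uniformly for its Duhamel
    part w.  Since lam_k tends to infinity, the Duhamel parts of all forcings
    bounded by M form a set of functions that is relatively compact for uniform
    convergence on [0, T].

    The delay term F is bounded and continuous on H, so the Euler scheme, in which
    the feedback F (u_t) is frozen on intervals of length h, produces such forcings.
    A uniform limit of its solutions as h tends to 0 solves the equation with
    g t = F (u_t); the delayed arguments are controlled by the continuity of
    translations in L2.  The weak identity holds mode by mode, by an integration
    by parts, and the modes are summed with Parseval's identity. *)

From HB Require Import structures.
Require Import Defs.
From mathcomp Require Import all_boot all_order all_algebra.
From mathcomp Require Import all_classical all_reals all_analysis.
From mathcomp Require Import measurable_realfun.
From mathcomp Require Import ring lra.

Set Implicit Arguments.
Unset Strict Implicit.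
Unset Printing Implicit Defensive.

Import Order.TTheory GRing.Theory Num.Theory.
Import numFieldNormedType.Exports.

Local Open Scope classical_set_scope.
Local Open Scope ring_scope.

(** * Inner product spaces and orthonormal bases *)

(** With [b] only locally Lipschitz, the map [u |-> b(u)] need not be Lipschitz on bounded sets of
    L2, so existence rests on compactness and not on a contraction. The obstacle to compactness is
    [u0], which is merely in L2: the energy of its semigroup part is only bounded by a multiple of
    [1 / t]. That part and the past [phi] are common to all approximations, so [glue] isolates the
    Duhamel part as the only thing that varies. The semigroup part is treated separately when [u]
    must lie in L2(0, T; D(A^(1/2))), by integrating its exponentials exactly. Integrals of
    vector-valued functions are avoided: vectors are assembled from scalar coordinates by
    Riesz-Fischer, and Borel measurability in H is reduced to coordinates by Pettis' theorem.
    Solutions are extended by 0 to the whole line, so that histories and translates come from one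
    function on R. Two points shape the delay term. Representatives of [psi t] are chosen separately
    for each [t], so joint measurability has to be recovered through finite sums over the basis. And
    [xi] is controlled only in L1 with respect to theta, so it is cut at a finite height before the
    convolution is varied. *)

Record inner_product (R : realType) (V : normedModType R) (dot : V -> V -> R) :
    Prop := InnerProduct {
  ipC : forall u v, dot u v = dot v u ;
  ipPl : forall a u v w, dot (a *: u + v) w = a * dot u w + dot v w ;
  ipE : forall u, dot u u = `|u| ^+ 2 }.

Section inner_product.
Context (R : realType) (V : normedModType R) (dot : V -> V -> R).
Hypothesis ip : inner_product dot.
Implicit Types (u v w : V) (a : R).

Lemma ip0l u : dot 0 u = 0.
Proof. by have := ipPl ip 1 0 0 u; rewrite scaler0 addr0; lra. Qed.

Lemma ipDl u v w : dot (u + v) w = dot u w + dot v w.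
Proof. by have := ipPl ip 1 u v w; rewrite scale1r mul1r. Qed.

Lemma ipZl a u w : dot (a *: u) w = a * dot u w.
Proof. by have := ipPl ip a u 0 w; rewrite addr0 ip0l addr0. Qed.

Lemma ipNl u w : dot (- u) w = - dot u w.
Proof. by rewrite -scaleN1r ipZl mulN1r. Qed.

Lemma ipBl u v w : dot (u - v) w = dot u w - dot v w.
Proof. by rewrite ipDl ipNl. Qed.

Lemma ip0r u : dot u 0 = 0.
Proof. by rewrite (ipC ip) ip0l. Qed.

Lemma ipDr u v w : dot w (u + v) = dot w u + dot w v.
Proof. by rewrite !(ipC ip w) ipDl. Qed.

Lemma ipZr a u w : dot w (a *: u) = a * dot w u.
Proof. by rewrite !(ipC ip w) ipZl. Qed.

Lemma ipNr u w : dot w (- u) = - dot w u.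
Proof. by rewrite !(ipC ip w) ipNl. Qed.

Lemma ipBr u v w : dot w (u - v) = dot w u - dot w v.
Proof. by rewrite !(ipC ip w) ipBl. Qed.

Lemma ip_suml (I : Type) (s : seq I) (P : pred I) (F : I -> V) w :
  dot (\sum_(i <- s | P i) F i) w = \sum_(i <- s | P i) dot (F i) w.
Proof.
elim/big_rec2 : _ => [|i x y _ <-]; [exact: ip0l|exact: ipDl].
Qed.

Lemma ip_sumr (I : Type) (s : seq I) (P : pred I) (F : I -> V) w :
  dot w (\sum_(i <- s | P i) F i) = \sum_(i <- s | P i) dot w (F i).
Proof. by rewrite (ipC ip) ip_suml; under eq_bigr do rewrite (ipC ip). Qed.

Lemma ip_sqrD u v : `|u + v| ^+ 2 = `|u| ^+ 2 + 2 * dot u v + `|v| ^+ 2.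
Proof. by rewrite -!(ipE ip) !(ipDl, ipDr) (ipC ip v u); ring. Qed.

Lemma ip_sqrB u v : `|u - v| ^+ 2 = `|u| ^+ 2 - 2 * dot u v + `|v| ^+ 2.
Proof. by rewrite ip_sqrD normrN ipNr; ring. Qed.

(** Expand the squared norm of [|v|^2 u - <u, v> v], which equals
    [|v|^2 (|u|^2 |v|^2 - <u, v>^2)]. *)
Lemma ip_CS u v : `|dot u v| <= `|u| * `|v|.
Proof.
have [->|v0] := eqVneq v 0; first by rewrite ip0r !normr0 mulr0.
have nv : 0 < `|v| by rewrite normr_gt0.
rewrite -(@ler_pXn2r _ 2)// ?nnegrE ?mulr_ge0// exprMn real_normK ?num_real//.
have := sqr_ge0 (`| (`|v| ^+ 2) *: u - dot u v *: v|).
rewrite ip_sqrB !normrZ ipZl ipZr !exprMn !real_normK ?num_real//.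
rewrite (_ : _ + _ = `|v| ^+ 2 * (`|u| ^+ 2 * `|v| ^+ 2 - dot u v ^+ 2)).
  by rewrite pmulr_rge0 ?subr_ge0// exprn_gt0.
by rewrite exprS expr1; ring.
Qed.

Lemma ip_sqr_le2 u v : `|u + v| ^+ 2 <= 2 * `|u| ^+ 2 + 2 * `|v| ^+ 2.
Proof. by have := sqr_ge0 `|u - v|; rewrite ip_sqrD ip_sqrB; lra. Qed.

Lemma ip_cvg (x : V ^nat) u w : x @ \oo --> u -> dot (x k) w @[k --> \oo] --> dot u w.
Proof.
move=> xu; apply/cvgrPdist_lt => e e0.
(* The added 1 keeps the divisor positive when [w = 0]; the same device recurs below. *)
have e1 : 0 < e / (`|w| + 1) by rewrite divr_gt0// ltr_wpDl.
move/cvgrPdist_lt : xu => /(_ _ e1); apply: filterS => k xk.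
rewrite -ipBl (le_lt_trans (ip_CS _ _))//.
rewrite (@le_lt_trans _ _ (`|u - x k| * (`|w| + 1)))//.
  by rewrite ler_wpM2l// lerDl.
by rewrite -ltr_pdivlMr// ltr_wpDl.
Qed.

Lemma continuous_ipl w : continuous (dot^~ w).
Proof.
move=> u; apply/cvgrPdist_lt => eps eps0.
have e1 : 0 < eps / (`|w| + 1) by rewrite divr_gt0// ltr_wpDl.
near=> v; rewrite -ipBl (le_lt_trans (ip_CS _ _))//.
rewrite (@le_lt_trans _ _ (`|u - v| * (`|w| + 1)))//.
  by rewrite ler_wpM2l// lerDl.
rewrite -ltr_pdivlMr ?ltr_wpDl//; near: v; exact: cvgr_dist_lt.
Unshelve. all: by end_near. Qed.

Definition orthonormal (e : V ^nat) := forall i j, dot (e i) (e j) = (i == j)%:R.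

Definition orth_proj (e : V ^nat) u n : V :=
  \sum_(0 <= k < n) dot u (e k) *: e k.

Section orthonormal_family.
Variable e : V ^nat.
Hypothesis one : orthonormal e.

Lemma norm_orthonormal k : `|e k| = 1.
Proof.
have := ipE ip (e k); rewrite one eqxx => /esym/eqP.
by rewrite sqrf_eq1 => /orP[/eqP//|/eqP]; have := normr_ge0 (e k); lra.
Qed.

Lemma ip_comb (c : R ^nat) n j :
  dot (\sum_(0 <= k < n) c k *: e k) (e j) = if (j < n)%N then c j else 0.
Proof.
rewrite ip_suml big_mkord; case: ltnP => [jn|nj].
  rewrite (bigD1 (Ordinal jn))//= ipZl one eqxx mulr1 big1 ?addr0// => i ij.
  rewrite ipZl one; case: eqP => [E|]; last by rewrite mulr0.
  by move/eqP : ij; case; exact: val_inj.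
rewrite big1// => i _; rewrite ipZl one; case: eqP => [E|]; last by rewrite mulr0.
by have := ltn_ord i; rewrite E ltnNge nj.
Qed.

Lemma sqr_norm_comb (c : R ^nat) m n : `|\sum_(m <= k < n) c k *: e k| ^+ 2 =
  \sum_(m <= k < n) c k ^+ 2.
Proof.
rewrite -(ipE ip) ip_suml; apply: eq_big_nat => i imn.
rewrite ip_sumr (bigD1_seq i) ?mem_index_iota ?iota_uniq//= big1.
  by rewrite addr0 ipZl ipZr one eqxx mulr1 expr2.
by move=> k ki; rewrite ipZl ipZr one eq_sym (negbTE ki) !mulr0.
Qed.

(** Pythagoras; dropping one or the other term on the right gives [bessel] and [orth_proj_le]. *)
Lemma orth_proj_sqr u n : `|u| ^+ 2 =
  \sum_(0 <= k < n) dot u (e k) ^+ 2 + `|u - orth_proj e u n| ^+ 2.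
Proof.
rewrite ip_sqrB /orth_proj sqr_norm_comb ip_sumr.
under [X in _ - 2 * X]eq_bigr do rewrite ipZr -expr2.
by ring.
Qed.

Lemma bessel u n : \sum_(0 <= k < n) dot u (e k) ^+ 2 <= `|u| ^+ 2.
Proof. by rewrite (orth_proj_sqr u n) lerDl sqr_ge0. Qed.

Lemma orth_proj_le u n : `|u - orth_proj e u n| <= `|u|.
Proof.
rewrite -(@ler_pXn2r _ 2)// ?nnegrE// (orth_proj_sqr u n) lerDr.
by apply: sumr_ge0 => *; exact: sqr_ge0.
Qed.

End orthonormal_family.

Definition orthonormal_basis (e : V ^nat) :=
  orthonormal e /\ forall u, orth_proj e u @ \oo --> u.

Section basis.
Variable e : V ^nat.
Hypothesis onb : orthonormal_basis e.
Let one := proj1 onb.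

Lemma parseval u v :
  \sum_(0 <= k < n) dot u (e k) * dot v (e k) @[n --> \oo] --> dot u v.
Proof.
have := ip_cvg (w := v) (proj2 onb u).
apply: cvg_trans; apply: near_eq_cvg; apply: nearW => n.
rewrite /orth_proj ip_suml; apply: eq_bigr => k _.
by rewrite ipZl (ipC ip v).
Qed.

Lemma parseval_sqr u :
  \sum_(0 <= k < n) dot u (e k) ^+ 2 @[n --> \oo] --> `|u| ^+ 2.
Proof. by rewrite -(ipE ip); under eq_fun do under eq_bigr do rewrite expr2; exact: parseval. Qed.

(** The extended real series is the form that can be exchanged with an integral. *)
Lemma parseval_ereal u :
  (\sum_(0 <= k <oo) (dot u (e k) ^+ 2)%:E = (`|u| ^+ 2)%:E)%E.
Proof.
apply/cvg_lim => //.
under eq_fun do rewrite sumEFin.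
by apply/fine_cvgP; split; [exact: nearW|exact: parseval_sqr].
Qed.

Lemma sqr_norm_le u C :
  (forall n, \sum_(0 <= k < n) dot u (e k) ^+ 2 <= C) -> `|u| ^+ 2 <= C.
Proof.
move=> uC; have us := @parseval_sqr u.
rewrite -(cvg_lim (@norm_hausdorff _ _) us).
apply: limr_le; last exact: nearW.
by apply/cvg_ex; eexists; exact: us.
Qed.

Lemma coord_inj u v : (forall k, dot u (e k) = dot v (e k)) -> u = v.
Proof.
move=> uv; apply/eqP; rewrite -subr_eq0 -normr_eq0 -sqrf_eq0 eq_le sqr_ge0 andbT.
apply: sqr_norm_le => n; rewrite big1// => k _.
by rewrite ipBl uv subrr expr0n.
Qed.

(** Modes below [N] are kept as they are; the others satisfy [1 <= lam k / C], so their energy pays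
    for them. Applied to a vector without its first [N] coordinates, this gives the compactness of
    the energy balls. *)
Lemma sqr_norm_head_tail (lam : R ^nat) u N C kappa :
  (forall k, 0 <= lam k) -> 0 < C -> (forall k, (N <= k)%N -> C <= lam k) ->
  (forall n, \sum_(0 <= k < n) lam k * dot u (e k) ^+ 2 <= kappa) ->
  `|u| ^+ 2 <= \sum_(0 <= k < N) dot u (e k) ^+ 2 + kappa / C.
Proof.
move=> lam0 C0 NC uk; apply: sqr_norm_le => n.
have h k : dot u (e k) ^+ 2 <= (if (k < N)%N then dot u (e k) ^+ 2 else 0) +
    C^-1 * (lam k * dot u (e k) ^+ 2).
  have s0 := sqr_ge0 (dot u (e k)); case: ltnP => kN.
    by rewrite lerDl; apply: mulr_ge0; [rewrite invr_ge0 ltW|exact: mulr_ge0].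
  by rewrite add0r mulrA ler_peMl// ler_pdivlMl// mulr1 NC.
rewrite (le_trans (ler_sum _ (fun k _ => h k)))// big_split/= lerD//; last first.
  by rewrite -mulr_sumr mulrC ler_wpM2r// invr_ge0 ltW.
rewrite -big_mkcond/=.
have [nN|/ltnW Nn] := leqP n N.
  rewrite [leRHS](big_cat_nat _ nN)//= [leLHS]big_mkcond/=.
  rewrite -[leLHS]addr0 lerD//; last by apply: sumr_ge0 => *; exact: sqr_ge0.
  by apply: ler_sum => k _; case: ifPn => // _; exact: sqr_ge0.
rewrite (big_cat_nat _ Nn)//= [X in _ + X]big_nat_cond [X in _ + X]big_pred0 ?addr0.
  by rewrite [leLHS]big_mkcond/=; apply: ler_sum => k _; case: ifPn => // _; exact: sqr_ge0.
by move=> k; apply/negbTE/negP => /andP[/andP[Nk _]]; rewrite ltnNge Nk.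
Qed.

Hypothesis complete : forall x : V ^nat,
  (forall eps, 0 < eps -> exists N, forall m n, (N <= m <= n)%N -> `|x n - x m| < eps) ->
  exists l : V, x k @[k --> \oo] --> l.

(** The squared distance of two partial sums is a difference of terms of the convergent sequence
    [S]. All vectors given by their coordinates, in particular powers of A and solutions, come from
    here. *)
Lemma riesz_fischer (c : R ^nat) C :
  (forall n, \sum_(0 <= k < n) c k ^+ 2 <= C) ->
  exists u, forall k, dot u (e k) = c k.
Proof.
move=> cC; pose S n := \sum_(0 <= k < n) c k ^+ 2.
have ndS : nondecreasing_seq S.
  by apply/nondecreasing_seqP => n; rewrite /S big_nat_recr//= lerDl sqr_ge0.
have cvS : cvgn S.
  by apply: nondecreasing_is_cvgn => //; exists C => _ [n _ <-]; exact: cC.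
pose x n := \sum_(0 <= k < n) c k *: e k.
have [|u xu] := @complete x.
  move=> eps eps0.
  have e2 : 0 < eps ^+ 2 by rewrite exprn_gt0.
  have /cvgrPdist_lt /(_ _ e2) [N _ SN] := cvS; exists N => m n /andP[Nm mn].
  have -> : x n - x m = \sum_(m <= k < n) c k *: e k.
    by rewrite /x (big_cat_nat _ mn)//= addrAC subrr add0r.
  rewrite -(@ltr_pXn2r _ 2)// ?nnegrE ?(ltW eps0)// sqr_norm_comb//.
  have -> : \sum_(m <= k < n) c k ^+ 2 = S n - S m.
    by rewrite /S [X in _ = X - _](big_cat_nat _ mn)//= addrAC subrr add0r.
  have Sl k : S k <= limn S by exact: nondecreasing_cvgn_le.
  have := SN m Nm; rewrite ger0_norm ?subr_ge0//.
  by have := Sl n; lra.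
exists u => j; have h := ip_cvg (w := e j) xu.
apply: (cvg_unique (@norm_hausdorff _ _) h); apply: cvg_near_cst.
by exists j.+1 => // n jn; rewrite /x ip_comb ?jn.
Qed.

End basis.
End inner_product.

(** * The spectral theorem for compact symmetric operators *)

Section spectral.
Context (R : realType) (V : normedModType R) (dot : V -> V -> R).
Hypothesis ip : inner_product dot.
Variable K : V -> V.
Hypothesis Klin : forall a u v, K (a *: u + v) = a *: K u + K v.
Hypothesis Ksym : forall u v, dot (K u) v = dot u (K v).
Hypothesis Kinj : forall u, K u = 0 -> u = 0.
(** Compactness as a cluster point instead of a convergent subsequence: each use below needs only
    one or two indices at which [K (x n)] is close to [y]. *)
Hypothesis Kcompact : forall x : V ^nat, (forall n, `|x n| <= 1) ->
  exists y : V, forall eps, 0 < eps ->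
    forall N, exists2 n, (N <= n)%N & `|K (x n) - y| < eps.

Let K0 : K 0 = 0.
Proof. by have := Klin (-1) 0 0; rewrite scaler0 addr0 scaleN1r addNr. Qed.

Let KD u v : K (u + v) = K u + K v.
Proof. by have := Klin 1 u v; rewrite !scale1r. Qed.

Let KZ a u : K (a *: u) = a *: K u.
Proof. by have := Klin a u 0; rewrite !addr0 K0 addr0. Qed.

Let KB u v : K (u - v) = K u - K v.
Proof. by rewrite KD -scaleN1r KZ scaleN1r. Qed.

Let K_sum (F : V ^nat) n : K (\sum_(0 <= k < n) F k) = \sum_(0 <= k < n) K (F k).
Proof. by apply: (big_ind2 (fun a b => K a = b)) => // a _ b _ <- <-. Qed.

(** Otherwise vectors [x n] of the unit ball with [|K (x n)| > n + 1] exist, and their images have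
    no cluster point. *)
Let Kbounded : exists2 C, 0 < C & forall u, `|K u| <= C * `|u|.
Proof.
apply: contrapT => nC.
have /choice[x xP] : forall n, exists x : V, `|x| <= 1 /\ n.+1%:R < `|K x|.
  move=> n; apply: contrapT => nx; apply: nC; exists n.+1%:R => // u.
  have [->|u0] := eqVneq u 0; first by rewrite K0 !normr0 mulr0.
  rewrite leNgt; apply/negP => Ku; apply: nx; exists (`|u|^-1 *: u).
  rewrite KZ !normrZ normfV normr_id mulVf ?normr_eq0//; split=> //.
  by rewrite ltr_pdivlMl ?normr_gt0// mulrC.
have [n|y yP] := @Kcompact x; first by case: (xP n).
have [n] := yP 1 ltr01 (Num.bound (`|y| + 1)).
rewrite ltNge => yn /negP; apply.
have [_ /ltW xn] := xP n.
have : `|y| + 1 <= n.+1%:R.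
  apply: (le_trans (ltW (archi_boundP _))); first by rewrite addr_ge0.
  by rewrite ler_nat ltnW.
have := ler_normD (K (x n) - y) y; rewrite subrK; lra.
Qed.

Let orth (s : seq V) v := forall x, x \in s -> dot v x = 0.
Let eigen x := exists mu : R, K x = mu *: x.

Let orthZD (s : seq V) a u v : orth s u -> orth s v -> orth s (a *: u + v).
Proof. by move=> su sv x xs; rewrite (ipPl ip) su// sv// mulr0 addr0. Qed.

Let orthZ (s : seq V) a u : orth s u -> orth s (a *: u).
Proof. by move=> su x xs; rewrite (ipZl ip) su// mulr0. Qed.

Let orthK (s : seq V) v : (forall x, x \in s -> eigen x) -> orth s v -> orth s (K v).
Proof. by move=> se sv x xs; have [mu E] := se x xs; rewrite Ksym E (ipZr ip) sv// mulr0. Qed.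

(* Maximize |K v| over the unit vectors of s^perp: a cluster point y of K x_n, for
   a maximizing sequence x_n, satisfies K (K y) = m^2 y, so that K y + m y or y is
   an eigenvector. *)
Lemma next_eigenvector (s : seq V) : (forall x, x \in s -> eigen x) ->
  (exists2 u, u != 0 & orth s u) ->
  exists e, exists mu : R, [/\ `|e| = 1, K e = mu *: e, orth s e &
    forall v, orth s v -> `|K v| <= `|mu| * `|v|].
Proof.
move=> se [u0 u00 su0]; have [C C0 KC] := Kbounded.
pose S := [set `|K v| | v in [set v | orth s v /\ `|v| <= 1]].
have normed (v : V) : v != 0 -> `|(`|v|^-1 *: v)| = 1.
  move=> v0; rewrite normrZ.
  by rewrite normfV normr_id mulVf ?normr_eq0.
have supS : has_sup S.
  split; first by exists `|K 0|, 0 => //; split; [move=> x _; exact: (ip0l ip)|rewrite normr0].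
  exists C => _ [v [_ v1] <-]; rewrite (le_trans (KC v))// -[leRHS]mulr1.
  by rewrite ler_pM2l.
pose m := sup S.
have Sm v : orth s v -> `|K v| <= m * `|v|.
  move=> sv; have [->|v0] := eqVneq v 0; first by rewrite K0 !normr0 mulr0.
  rewrite -ler_pdivrMr ?normr_gt0//.
  suff -> : `|K v| / `|v| = `|K (`|v|^-1 *: v)|.
    apply: (sup_upper_bound supS); exists (`|v|^-1 *: v) => //; split; first exact: orthZ.
    by rewrite normed.
  by rewrite KZ normrZ normfV normr_id mulrC.
(* The supremum is positive because [K] is injective and [u0] is a nonzero vector of the orthogonal
   complement. *)
have m0 : 0 < m.
  have : 0 < `|K u0| by rewrite normr_gt0; apply: contra_neq u00; exact: Kinj.
  by move=> /lt_le_trans/(_ (Sm _ su0)); rewrite pmulr_lgt0// normr_gt0.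
have /choice[x xP] : forall n, exists x : V, [/\ orth s x, `|x| <= 1 &
    m - n.+1%:R^-1 < `|K x|].
  move=> n; have n0 : 0 < n.+1%:R^-1 :> R by rewrite invr_gt0.
  by have [_ [v [sv v1] <-] mv] := sup_adherent n0 supS; exists v.
have [n|y yP] := @Kcompact x; first by case: (xP n).
have sy : orth s y.
  move=> z zs; apply/eqP; rewrite -normr_eq0 eq_le normr_ge0 andbT.
  apply/ler_addgt0Pl => eps eps0; rewrite addr0.
  have d0 : 0 < eps / (`|z| + 1) by rewrite divr_gt0// ltr_wpDl.
  have [n _ yn] := yP _ d0 0%N.
  have -> : dot y z = - dot (K (x n) - y) z.
    by rewrite (ipBl ip) (orthK se (let: And3 h _ _ := xP n in h))// sub0r opprK.
  rewrite normrN (le_trans (ip_CS ip _ _))//.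
  rewrite (@le_trans _ _ (`|K (x n) - y| * (`|z| + 1)))//.
    by rewrite ler_wpM2l// lerDl.
  by rewrite -ler_pdivlMr ?ltr_wpDl// ltW.
(* If [y] were 0, some [n >= 2 / m] would give [m - 1 / (n + 1) < |K (x n)| < m / 2], which is
   impossible. *)
have y0 : y != 0.
  apply/eqP => y0; have m2 : 0 < m / 2 by rewrite divr_gt0.
  have [n Nn] := yP _ m2 (Num.bound (2 / m)).
  rewrite y0 subr0; have [_ _] := xP n.
  move=> h1 h2; have := lt_trans h1 h2.
  rewrite ltrBlDl -ltrBlDr {1}[m]splitr addrK ltNge => /negP; apply; apply: ltW.
  rewrite -[ltRHS]invrK ltf_pV2 ?posrE ?invr_gt0// invf_div.
  apply: (lt_le_trans (archi_boundP _)); first by rewrite divr_ge0// ltW.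
  by rewrite ler_nat ltnW.
have KKy : K (K y) = m ^+ 2 *: y.
  apply/eqP; rewrite -subr_eq0 -normr_eq0 eq_le normr_ge0 andbT.
  apply/ler_addgt0Pl => eps eps0; rewrite addr0.
  (* The three summands are the factors of [dl] in the bounds for the three terms into which
     [K (K y) - m^2 y] is split below. *)
  pose D := C ^+ 2 + C + m ^+ 2.
  have D0 : 0 < D by rewrite !addr_gt0// exprn_gt0.
  pose dl := eps / D; have dl0 : 0 < dl by rewrite divr_gt0.
  have [n Nn yn] := yP _ dl0 (Num.bound (2 * m ^+ 3 / dl ^+ 2)).
  have [sx x1 mx] := xP n; set a := `|K (x n)| in mx.
  have am : a <= m by rewrite (le_trans (Sm _ sx))// ger_pMr.
  have a0 : 0 <= a by exact: normr_ge0.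
  have nm : m - a <= n.+1%:R^-1 by rewrite lerBlDl -lerBlDr ltW.
  have nn : 2 * m ^+ 3 * n.+1%:R^-1 <= dl ^+ 2.
    rewrite ler_pdivrMr// -ler_pdivrMl ?exprn_gt0// mulrC.
    apply: (le_trans (ltW (archi_boundP _))); last by rewrite ler_nat ltnW.
    by rewrite !mulr_ge0 ?invr_ge0 ?exprn_ge0// ltW.
  (* By symmetry [<K (K x), x> = |K x|^2 = a^2], so the squared norm is at most [m^2 a^2 - 2 m^2 a^2
     + m^4 = m^2 (m - a) (m + a)], hence at most [2 m^3 / (n + 1)]. *)
  have Ex : `|K (K (x n)) - m ^+ 2 *: x n| <= dl.
    rewrite -(@ler_pXn2r _ 2)// ?nnegrE ?(ltW dl0)// (le_trans _ nn)//.
    rewrite (ip_sqrB ip) (ipZr ip) Ksym (ipE ip) -/a normrZ.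
    have h1 : `|K (K (x n))| ^+ 2 <= (m * a) ^+ 2.
      rewrite ler_pXn2r ?nnegrE//; last by rewrite mulr_ge0// ltW.
      by apply: Sm; exact: orthK.
    have h2 : (`|m ^+ 2| * `|x n|) ^+ 2 <= (m ^+ 2) ^+ 2.
      rewrite ler_pXn2r ?nnegrE ?sqr_ge0// ?(mulr_ge0 (normr_ge0 _) (normr_ge0 _))//.
      by rewrite ger0_norm ?sqr_ge0// ger_pMr// exprn_gt0.
    have h3 : m ^+ 2 * (m - a) * (m + a) <= m ^+ 2 * n.+1%:R^-1 * (2 * m).
      have mm0 : 0 < m ^+ 2 by rewrite exprn_gt0.
      apply: ler_pM; [|by rewrite addr_ge0// ltW| |lra].
      - by rewrite mulr_ge0 ?subr_ge0// ltW.
      - by rewrite ler_pM2l.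
    apply: (le_trans (lerD (lerB h1 (lexx _)) h2)).
    move: (n.+1%:R^-1 : R) h3 => q h3.
    rewrite (_ : _ + _ = m ^+ 2 * (m - a) * (m + a)); last by ring.
    by rewrite (le_trans h3)// (_ : _ * (2 * m) = 2 * m ^+ 3 * q)//; ring.
  have -> : K (K y) - m ^+ 2 *: y = - K (K (K (x n) - y)) +
      K (K (K (x n)) - m ^+ 2 *: x n) + m ^+ 2 *: (K (x n) - y).
    by rewrite !KB KZ scalerBr opprB !addrA !subrK.
  rewrite (le_trans (ler_normD _ _))// (le_trans (lerD (ler_normD _ _) (lexx _)))//.
  rewrite normrN normrZ (ger0_norm (sqr_ge0 m)).
  have -> : eps = C ^+ 2 * dl + C * dl + m ^+ 2 * dl.
    by rewrite -!mulrDl -/D mulrC divfK// gt_eqF.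
  rewrite !lerD//.
  - rewrite (le_trans (KC _))// expr2 -mulrA ler_pM2l// (le_trans (KC _))// ler_pM2l//.
    exact: ltW.
  - by rewrite (le_trans (KC _))// ler_pM2l.
  - by rewrite ler_wpM2l ?sqr_ge0// ltW.
pose z := K y + m *: y.
have [z0|z0] := eqVneq z 0.
  exists (`|y|^-1 *: y), (- m); split; [exact: normed| |exact: orthZ|].
    rewrite KZ (_ : K y = - m *: y) ?scalerA 1?mulrC//.
    by apply/eqP; rewrite scaleNr -addr_eq0 -/z z0.
  by move=> v /Sm; rewrite normrN (gtr0_norm m0).
exists (`|z|^-1 *: z), m; split; [exact: normed| | |].
- rewrite KZ scalerA mulrC -scalerA; congr (_ *: _).
  by rewrite /z KD KKy KZ scalerDr scalerA -expr2 addrC.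
- by apply: orthZ; rewrite /z addrC; apply: orthZD => //; exact: orthK.
- by move=> v /Sm; rewrite (gtr0_norm m0).
Qed.

Hypothesis infdim : forall s : seq V, exists2 u, u != 0 & orth s u.
Hypothesis Kdense : forall u eps, 0 < eps -> exists v, `|u - K v| < eps.

(** Extremality makes [|mu n|] nonincreasing. If it stayed above some [dl], the vectors [K (e n)]
    would be at mutual distance at least [dl], against compactness. For completeness of the basis, a
    vector [K v] has remainder [K (v - P_n v)], of norm at most [|mu n| |v|], and the range of [K]
    is dense. *)
Theorem compact_symmetric_spectral : exists e (mu : R ^nat),
  [/\ orthonormal_basis dot e, forall k, K (e k) = mu k *: e k & mu @ \oo --> 0].
Proof.
(* The pair [(0, 0)] is a default for lists that contain a vector which is not an eigenvector;
   [Leig] shows that no [L n] is such a list. *)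
have /choice[E EP] : forall s : seq V, exists em : V * R,
    (forall x, x \in s -> eigen x) -> [/\ `|em.1| = 1, K em.1 = em.2 *: em.1,
    orth s em.1 & forall v, orth s v -> `|K v| <= `|em.2| * `|v|].
  move=> s; have [se|] := pselect (forall x, x \in s -> eigen x); last by exists (0, 0).
  by have [e [mu h]] := next_eigenvector se (infdim s); exists (e, mu).
pose L := fix L n := if n is n'.+1 then (E (L n')).1 :: L n' else [::].
pose e n := (E (L n)).1; pose mu n := (E (L n)).2.
have Leig n : forall x, x \in L n -> eigen x.
  elim: n => [//|n ih] x; rewrite /= inE => /orP[/eqP->|/ih//].
  by have [_ ? _ _] := EP _ ih; exists (mu n).
have Lmem n k : (k < n)%N -> e k \in L n.
  elim: n => [//|n ih]; rewrite ltnS leq_eqVlt => /orP[/eqP->|/ih kn] /=.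
    by rewrite inE eqxx.
  by rewrite inE kn orbT.
have Lorth n v : (forall k, (k < n)%N -> dot v (e k) = 0) -> orth (L n) v.
  elim: n => [//|n ih] h x; rewrite /= inE => /orP[/eqP->|].
    exact: (h n).
  by move=> xn; apply: ih => // k kn; apply: h; exact: ltnW.
have Ke n : K (e n) = mu n *: e n by have [_ ? _ _] := EP _ (Leig n).
have ne n : `|e n| = 1 by have [? _ _ _] := EP _ (Leig n).
have Kmu n v : orth (L n) v -> `|K v| <= `|mu n| * `|v|.
  by have [_ _ _] := EP _ (Leig n); exact.
have elt i j : (i < j)%N -> dot (e j) (e i) = 0.
  by move=> ij; have [_ _ h _] := EP _ (Leig j); apply: h; exact: Lmem.
have one : orthonormal dot e.
  move=> i j; have [ij|ji|->] := ltngtP i j.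
  - by rewrite (ipC ip) elt// ltn_eqF.
  - by rewrite elt// gtn_eqF.
  - by rewrite (ipE ip) ne expr1n.
have mu_le i j : (i <= j)%N -> `|mu j| <= `|mu i|.
  move=> ij; have := @Kmu i (e j); rewrite Ke normrZ ne !mulr1; apply.
  by apply: Lorth => k ki; apply: elt; exact: leq_trans ij.
have mu0 : mu @ \oo --> 0.
  suff small (dl : R) : 0 < dl -> exists N, `|mu N| < dl.
    apply/cvgrPdist_lt => dl dl0; have [N muN] := small _ dl0.
    by exists N => // n /= Nn; rewrite sub0r normrN (le_lt_trans (mu_le _ _ Nn)).
  move=> dl0; apply: contrapT => nN.
  have dlmu n : dl <= `|mu n| by rewrite leNgt; apply/negP => h; apply: nN; exists n.
  have [n|y yP] := @Kcompact e; first by rewrite ne.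
  have dl2 : 0 < dl / 2 by rewrite divr_gt0.
  have [n _ yn] := yP _ dl2 0%N; have [p np yp] := yP _ dl2 n.+1.
  have : `|K (e n) - K (e p)| < dl.
    have -> : K (e n) - K (e p) = (K (e n) - y) - (K (e p) - y) by rewrite opprB addrA subrK.
    by rewrite (le_lt_trans (ler_normB _ _))//; lra.
  rewrite -(@ltr_pXn2r _ 2)// ?nnegrE ?(ltW dl0)// (ip_sqrB ip) !Ke (ipZl ip) (ipZr ip).
  rewrite one ltn_eqF// !mulr0 subr0 !normrZ !ne !mulr1.
  have : dl ^+ 2 <= `|mu n| ^+ 2 by rewrite ler_pXn2r ?nnegrE ?(ltW dl0).
  have := sqr_ge0 `|mu p|; lra.
exists e, mu; split=> //; split=> // u; apply/cvgrPdist_lt => eps eps0.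
have e2 : 0 < eps / 2 by rewrite divr_gt0.
have [v uv] := Kdense u e2.
have e3 : 0 < eps / 2 / (`|v| + 1) by rewrite divr_gt0// ltr_wpDl.
have /cvgrPdist_lt/(_ _ e3) := mu0; apply: filterS => n; rewrite sub0r normrN => mun.
have PB w w' : orth_proj dot e (w - w') n = orth_proj dot e w n - orth_proj dot e w' n.
  by rewrite -sumrB; apply: eq_bigr => k _; rewrite (ipBl ip) scalerBl.
have PK w : orth_proj dot e (K w) n = K (orth_proj dot e w n).
  rewrite K_sum; apply: eq_bigr => k _.
  by rewrite KZ Ke Ksym Ke (ipZr ip) scalerA mulrC.
(* The first bracket is small because [u - K v] is, and the second because [mu n] tends to 0; [v] is
   fixed before [n]. *)
have -> : u - orth_proj dot e u n = ((u - K v) - orth_proj dot e (u - K v) n) +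
    K (v - orth_proj dot e v n).
  by rewrite PB PK KB opprB addrAC !addrA !subrK.
rewrite (le_lt_trans (ler_normD _ _))// [ltRHS]splitr ltr_leD//.
  by rewrite (le_lt_trans (orth_proj_le ip one _ _)).
rewrite (le_trans (@Kmu n _ _))//.
  apply: Lorth => k kn.
  by rewrite (ipBl ip) /orth_proj (ip_comb ip one (fun k => dot v (e k))) kn subrr.
rewrite (@le_trans _ _ (`|mu n| * (`|v| + 1)))//.
  by rewrite ler_wpM2l// (le_trans (orth_proj_le ip one _ _))// lerDl.
by rewrite -ler_pdivlMr ?ltr_wpDl// ltW.
Qed.

End spectral.

(** * Completeness of L2 *)

Section L2_theory.
Context d (T : measurableType d) (R : realType) (mu : {measure set T -> \bar R}).
Notation H := (L2 mu).
Implicit Types (u v w : H) (f : T -> R).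

Lemma measurable_L2rep u : measurable_fun setT (L2rep u).
Proof. exact: measurable_funPT. Qed.

Lemma Lfun2P f : measurable_fun setT f -> (\int[mu]_x (f x ^+ 2)%:E < +oo)%E ->
  f \in Lfun mu 2%:E.
Proof.
move=> mf fi; apply/andP; split; apply: mem_set => //=.
rewrite /finite_norm ltNge leye_eq; apply/negP => /eqP foo.
have := @poweR_Lnorm _ _ _ mu (EFin \o f) 2 ltac:(by rewrite pnatr_eq0).
rewrite foo poweRyr ?pnatr_eq0//; move: fi; rewrite ltNge leye_eq => /eqP fi /esym E.
apply: fi; rewrite -E; apply: eq_integral => x _.
by rewrite /= powR_mulrn// real_normK ?num_real.
Qed.

Lemma toL2_rep f : measurable_fun setT f -> (\int[mu]_x (f x ^+ 2)%:E < +oo)%E ->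
  \forall x \ae mu, L2rep (toL2 mu f) x = f x.
Proof.
move=> mf fi; rewrite /toL2; case: pselect => [Pf|]; last by move: (Lfun2P mf fi).
exact: (repr_L2class (Lfun_Sub (lee1n 2) Pf)).
Qed.

(** [repr] picks a representative of each class independently, so linearity survives only almost
    everywhere. *)
Lemma L2repP a u v : \forall x \ae mu, L2rep (a *: u + v) x = a * L2rep u x + L2rep v x.
Proof.
rewrite -(L2classK u) -(L2classK v).
rewrite (_ : a *: _ + _ = L2class (a *: (repr u : L2fun mu) + repr v)); last first.
  by rewrite L2classD -L2scale_class.
have hu := repr_L2class (repr u : L2fun mu).
have hv := repr_L2class (repr v : L2fun mu).
have h := repr_L2class (a *: (repr u : L2fun mu) + repr v).
by apply: filterS3 h hu hv => x; rewrite /L2rep => -> -> ->.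
Qed.

Lemma integrable_L2rep_mul u v :
  mu.-integrable setT (fun x => (L2rep u x * L2rep v x)%:E).
Proof.
apply/Lfun1_integrable; apply: Lfun2_mul_Lfun1.
- exact: (LfunP (repr u : L2fun mu)).
- exact: (LfunP (repr v : L2fun mu)).
Qed.

Lemma integrable_L2rep_sqr u : mu.-integrable setT (fun x => (L2rep u x ^+ 2)%:E).
Proof. by under eq_fun do rewrite expr2; exact: integrable_L2rep_mul. Qed.

Lemma L2dot_inner_product : inner_product (@L2dot d T R mu).
Proof.
split=> [u v|a u v w|u]; last exact: L2dotE.
  by rewrite /L2dot; apply: eq_Rintegral => x _; rewrite mulrC.
rewrite /L2dot -RintegralZl//; last exact: integrable_L2rep_mul.
rewrite -RintegralD//; last 2 first.
- apply: eq_integrable (integrableZl _ a (integrable_L2rep_mul u w)) => //.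
- exact: integrable_L2rep_mul.
congr fine; apply: ae_eq_integral => //.
- by apply/measurable_EFinP; apply: measurable_funM; exact: measurable_L2rep.
- apply/measurable_EFinP; apply: measurable_funD.
    apply: measurable_funM => //; apply: measurable_funM; exact: measurable_L2rep.
  by apply: measurable_funM; exact: measurable_L2rep.
by apply: filterS (L2repP a u v) => x -> _ /=; rewrite mulrDl mulrA.
Qed.

Lemma L2_sqr_norm u : (\int[mu]_x (L2rep u x ^+ 2)%:E = (`|u| ^+ 2)%:E)%E.
Proof.
rewrite -L2dotE /L2dot /Rintegral fineK; last exact: integrable_fin_num (integrable_L2rep_mul u u).
by apply: eq_integral => x _; rewrite expr2.
Qed.

Lemma L2_sqr_dist u v :
  (\int[mu]_x ((L2rep u x - L2rep v x) ^+ 2)%:E = (`|u - v| ^+ 2)%:E)%E.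
Proof.
rewrite -L2_sqr_norm; apply: ae_eq_integral => //.
- by apply/measurable_EFinP; apply: measurable_funX; apply: measurable_funB; exact: measurable_L2rep.
- by apply/measurable_EFinP; exact: measurable_funX (measurable_L2rep _).
apply: filterS (L2repP (-1) v u) => x h _.
have E : u - v = -1 *: v + u by rewrite scaleN1r addrC.
by rewrite E h mulN1r addrC.
Qed.

(** The clause [k <= s k] lets a Cauchy estimate valid from an index on be used along the
    subsequence from the same index on. *)
Lemma cauchy_subseq (x : H ^nat) :
  (forall eps, 0 < eps -> exists N, forall m n, (N <= m <= n)%N -> `|x n - x m| < eps) ->
  forall c : R ^nat, (forall k, 0 < c k) ->
  exists s : nat -> nat, forall k, `|x (s k.+1) - x (s k)| < c k /\ (k <= s k)%N.
Proof.
move=> cx c c0.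
have /choice[N NP] : forall k, exists N, forall m n, (N <= m <= n)%N -> `|x n - x m| < c k.
  by move=> k; exact: cx.
pose s := fix s k := if k is k'.+1 then maxn (maxn (s k').+1 (N k)) (N k') else N 0%N.
have sN k : (N k <= s k)%N by case: k => //= k; rewrite !leq_max leqnn orbT.
have sS k : (s k < s k.+1)%N by rewrite /= !leq_max ltnSn.
exists s => k; split; first by apply: NP; rewrite sN ltnW.
by elim: k => // k ih; exact: leq_ltn_trans (sS k).
Qed.

(* Along a fast subsequence sum_k 2^k |x_(k+1) - x_k|^2 is integrable, and
   |t| <= 2^k t^2 + 2^-k makes the representatives converge a.e. *)
Theorem L2_complete (x : H ^nat) :
  (forall eps, 0 < eps -> exists N, forall m n, (N <= m <= n)%N -> `|x n - x m| < eps) ->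
  exists l : H, x k @[k --> \oo] --> l.
Proof.
move=> cx.
have q0 k : 0 < 2 ^- k.+1 :> R by rewrite invr_gt0 exprn_gt0.
have [s sP] := cauchy_subseq cx q0.
pose y k := x (s k).
pose dd k t := L2rep (y k.+1) t - L2rep (y k) t.
have mdd k : measurable_fun setT (dd k) by apply: measurable_funB; exact: measurable_L2rep.
(* With distances below [2^-(k+1)], term [k] has integral at most [2^k 2^-(2k+2) <= 2^-(k+1)], which
   is summable. *)
pose G t := (\sum_(0 <= k <oo) (2 ^+ k * dd k t ^+ 2)%:E)%E.
have mG k : measurable_fun setT (fun t => (2 ^+ k * dd k t ^+ 2)%:E).
  by apply/measurable_EFinP; apply: measurable_funM => //; exact: measurable_funX.
have G0 k t : (0 <= (2 ^+ k * dd k t ^+ 2)%:E)%E.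
  by rewrite lee_fin mulr_ge0// ?sqr_ge0// exprn_ge0.
have iG : (\int[mu]_t G t < +oo)%E.
  rewrite /G integral_nneseries//.
  apply: (@le_lt_trans _ _ (\sum_(0 <= k <oo) (1 / (2 ^ k.+1)%:R)%:E)%E); last first.
    apply: (le_lt_trans (epsilon_trick0 xpredT _)) => //; exact: ltry.
  apply: lee_nneseries => [k _ _|k _]; first by apply: integral_ge0 => t _; exact: G0.
  under eq_integral do rewrite EFinM.
  have m2 : measurable_fun setT (fun t => (dd k t ^+ 2)%:E).
    by apply/measurable_EFinP; exact: measurable_funX.
  rewrite ge0_integralZl//; try (by move=> t _; rewrite lee_fin sqr_ge0);
    try by rewrite lee_fin exprn_ge0.
  rewrite L2_sqr_dist -EFinM lee_fin natrX div1r.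
  have [/ltW yk _] := sP k.
  apply: (@le_trans _ _ (2 ^+ k * (2 ^- k.+1) ^+ 2)).
    by rewrite ler_pM2l ?exprn_gt0// ler_pXn2r// nnegrE// ltW.
  rewrite expr2 mulrA ger_pMl// exprS invfM [_^-1 * _]mulrC mulrA mulfV ?gt_eqF ?exprn_gt0//.
  by rewrite mul1r invf_le1// ler1n.
have Gfin : \forall t \ae mu, (G t < +oo)%E.
  have mGG : measurable_fun setT G by exact: ge0_emeasurable_sum.
  have : mu.-integrable setT G.
    apply/integrableP; split => //.
    rewrite (eq_integral G)// => t _; rewrite gee0_abs//.
    by apply: nneseries_ge0 => k _ _; exact: G0.
  move/(integrable_ae measurableT); apply: filterS => t /(_ Logic.I).
  by rewrite ge0_fin_numE// nneseries_ge0// => k _ _; exact: G0.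
(* An upper limit is measurable on the whole space, so the null set where the representatives
   diverge need not be removed. *)
pose f t := fine (limn_esup (fun k => (L2rep (y k) t)%:E)).
have mf : measurable_fun setT f.
  apply: measurableT_comp; first exact: fine_measurable.
  apply: measurable_fun_limn_esup => k; apply/measurable_EFinP; exact: measurable_L2rep.
have yf : \forall t \ae mu, L2rep (y k) t @[k --> \oo] --> f t.
  apply: filterS Gfin => t Gt.
  have : cvgn (fun k => L2rep (y k) t).
    have : cvgn [series `|dd k t|]_k.
      apply: nnseries_is_cvg => [k|]; first exact: normr_ge0.
      apply: (@le_lt_trans _ _ (\sum_(0 <= k <oo) ((2 ^+ k * dd k t ^+ 2)%:E +
         (2 / (2 ^ k.+1)%:R)%:E)%E)%E); last first.
        apply: (le_lt_trans (epsilon_trick xpredT _ _)) => //.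
        by rewrite lte_add_pinfty// ltry.
      apply: lee_nneseries => [k _ _|k _]; first by rewrite lee_fin normr_ge0.
      rewrite -EFinD lee_fin natrX.
      have p0 : 0 < 2 ^+ k :> R by rewrite exprn_gt0.
      have -> : 2 / 2 ^+ k.+1 = (2 ^+ k)^-1 :> R by rewrite exprS invfM mulrA mulfV ?mul1r.
      rewrite [leLHS]/=.
      rewrite -[dd k t ^+ 2]real_normK ?num_real//.
      move: (2 ^+ k : R) p0 (`|dd k t|) (normr_ge0 (dd k t)) => P p0 X X0.
      rewrite -(ler_pM2l p0) mulrDr mulfV ?gt_eqF//.
      by have := sqr_ge0 (P * X - 1); have := mulr_ge0 (ltW p0) X0; rewrite !expr2; lra.
    move=> /normed_cvg cv.
    have -> : (fun k => L2rep (y k) t) = (fun k => L2rep (y 0%N) t + series (dd^~ t) k).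
      apply/funext => k; rewrite /series/= telescope_sumr// addrC subrK//.
    by apply: is_cvgD => //; exact: is_cvg_cst.
  move=> /cvg_ex[/= l yl]; rewrite /f.
  have yl' : (L2rep (y k) t)%:E @[k --> \oo] --> l%:E by apply/fine_cvgP; split; [exact: nearW|].
  by rewrite (cvg_limn_einf_sup yl').2.
(* Fatou's lemma transfers the Cauchy estimate to the pointwise limit. It is used twice: to see that
   [f] is square integrable, and to get the convergence. *)
have fx N eps : 0 < eps -> (forall m n, (N <= m <= n)%N -> `|x n - x m| < eps) ->
    forall m, (N <= m)%N -> (\int[mu]_t ((f t - L2rep (x m) t) ^+ 2)%:E <= (eps ^+ 2)%:E)%E.
  move=> eps0 Ne m Nm.
  pose h k t := ((L2rep (y k) t - L2rep (x m) t) ^+ 2)%:E.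
  have mh k : measurable_fun setT (h k).
    by apply/measurable_EFinP; apply: measurable_funX; apply: measurable_funB; exact: measurable_L2rep.
  have -> : (\int[mu]_t ((f t - L2rep (x m) t) ^+ 2)%:E = \int[mu]_t limn_einf (h^~ t))%E.
    apply: ae_eq_integral => //.
    - by apply/measurable_EFinP; apply: measurable_funX; apply: measurable_funB => //; exact: measurable_L2rep.
    - apply: measurableT_comp => //; apply: measurable_fun_limn_esup => k.
      exact: measurableT_comp.
    - apply: filterS yf => t yt _.
      have : h^~ t @ \oo --> ((f t - L2rep (x m) t) ^+ 2)%:E.
        apply/fine_cvgP; split; first exact: nearW.
        apply: (@cvgM _ _ _ _ (fun k => L2rep (y k) t - L2rep (x m) t)
          (fun k => L2rep (y k) t - L2rep (x m) t)); apply: cvgB => //; exact: cvg_cst.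
      by move=> /cvg_limn_einf_sup[->].
  apply: (le_trans (fatou _ _ _ _)) => //; first by move=> k t _; rewrite lee_fin sqr_ge0.
  rewrite (le_trans (limn_einf_sup _))// limn_esup_lim.
  apply: lime_le; first exact: is_cvg_esups.
  exists m => // k /= mk; apply: ge_ereal_sup => _ [j /= kj <-].
  rewrite L2_sqr_dist lee_fin ler_pXn2r ?nnegrE ?(ltW eps0)//.
  apply/ltW/Ne; rewrite Nm/=; have [_ js] := sP j.
  exact: leq_trans mk (leq_trans kj js).
have fi : (\int[mu]_t (f t ^+ 2)%:E < +oo)%E.
  have [N NP] := cx 1 ltr01; have h := fx N 1 ltr01 NP N (leqnn N).
  apply: (@le_lt_trans _ _ (\int[mu]_t (2%:E * ((f t - L2rep (x N) t) ^+ 2)%:E +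
    2%:E * (L2rep (x N) t ^+ 2)%:E))%E).
    apply: ge0_le_integral => //.
    - by move=> t _; rewrite lee_fin sqr_ge0.
    - by apply/measurable_EFinP; exact: measurable_funX.
    - apply/measurable_EFinP; apply: measurable_funD; apply: measurable_funM => //.
        by apply: measurable_funX; apply: measurable_funB => //; exact: measurable_L2rep.
      exact: measurable_funX (measurable_L2rep _).
    - move=> t _; rewrite -!EFinM -EFinD lee_fin.
      by have := sqr_ge0 (f t - 2 * L2rep (x N) t); rewrite !expr2; lra.
  rewrite ge0_integralD//; last 4 first.
  - by move=> t _; rewrite -EFinM lee_fin mulr_ge0// sqr_ge0.
  - apply/measurable_EFinP; apply: measurable_funM => //.
    by apply: measurable_funX; apply: measurable_funB => //; exact: measurable_L2rep.
  - by move=> t _; rewrite -EFinM lee_fin mulr_ge0// sqr_ge0.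
  - apply/measurable_EFinP; apply: measurable_funM => //.
    exact: measurable_funX (measurable_L2rep _).
  rewrite !ge0_integralZl_EFin//; try (by move=> t _; rewrite lee_fin sqr_ge0); last 2 first.
  - by apply/measurable_EFinP; exact: measurable_funX (measurable_L2rep _).
  - apply/measurable_EFinP.
    by apply: measurable_funX; apply: measurable_funB => //; exact: measurable_L2rep.
  rewrite L2_sqr_norm -EFinM lte_add_pinfty ?ltry// lte_mul_pinfty//.
  exact: le_lt_trans h (ltry _).
exists (toL2 mu f); apply/cvgrPdist_le => eps eps0.
have [N NP] := cx _ eps0; exists N => // m /= Nm.
rewrite -(@ler_pXn2r _ 2)// ?nnegrE ?(ltW eps0)// -lee_fin -L2_sqr_dist.
apply: le_trans (fx N eps eps0 NP m Nm).
rewrite le_eqVlt; apply/orP; left; apply/eqP.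
apply: ae_eq_integral => //.
- by apply/measurable_EFinP; apply: measurable_funX; apply: measurable_funB; exact: measurable_L2rep.
- by apply/measurable_EFinP; apply: measurable_funX; apply: measurable_funB => //; exact: measurable_L2rep.
- by apply: filterS (toL2_rep mf fi) => t -> _.
Qed.

End L2_theory.

(** * Infinite dimension of L2 of a domain *)

(** Orthogonality to [s] is a system of [size s] linear equations; on the span of [size s + 1]
    orthogonal vectors it has a nonzero solution, taken in the kernel of [M]. *)
Lemma ip_infinite_dim (R : realType) (V : normedModType R) (dot : V -> V -> R)
    (ip : inner_product dot) :
  (forall N, exists h : 'I_N -> V,
    (forall i, h i != 0) /\ forall i j, i != j -> dot (h i) (h j) = 0) ->
  forall s : seq V, exists2 u, u != 0 & forall x, x \in s -> dot u x = 0.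
Proof.
move=> hN s; have [h [h0 hh]] := hN (size s).+1.
pose M := \matrix_(i < (size s).+1, j < size s) dot (h i) s`_j.
have : kermx M != 0.
  by rewrite -mxrank_eq0 mxrank_ker subn_eq0 -ltnNge ltnS rank_leq_col.
case/rowV0Pn => a /sub_kermxP aM a0.
exists (\sum_i a 0 i *: h i); last first.
  move=> x xs; have := congr1 (fun B : 'rV[R]_(size s) => B 0 (Ordinal (etrans (index_mem x s) xs))) aM.
  rewrite !mxE (ip_suml ip) => E; apply: etrans E; apply: eq_bigr => i _.
  by rewrite mxE/= nth_index// (ipZl ip).
apply: contra_neq a0 => u0; apply/rowP => i; rewrite mxE.
have := ip0l ip (h i); rewrite -u0 (ip_suml ip) (bigD1 i)//= big1 ?addr0; last first.
  by move=> j ji; rewrite (ipZl ip) hh// mulr0.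
move/eqP; rewrite (ipZl ip) (ipE ip) mulf_eq0 sqrf_eq0 normr_eq0 (negbTE (h0 i)) orbF.
by move/eqP.
Qed.

Section toL2_theory.
Context d (T : measurableType d) (R : realType) (mu : {measure set T -> \bar R}).
Variables f g : T -> R.
Hypothesis mf : measurable_fun setT f.
Hypothesis fi : (\int[mu]_x (f x ^+ 2)%:E < +oo)%E.

Lemma sqr_norm_toL2 : ((`|toL2 mu f| ^+ 2)%:E = \int[mu]_x (f x ^+ 2)%:E)%E.
Proof.
rewrite -L2_sqr_norm; apply: ae_eq_integral => //.
- by apply/measurable_EFinP; exact: measurable_funX (measurable_L2rep _).
- by apply/measurable_EFinP; exact: measurable_funX.
- by apply: filterS (toL2_rep mf fi) => y -> _.
Qed.

Hypothesis mg : measurable_fun setT g.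
Hypothesis gi : (\int[mu]_x (g x ^+ 2)%:E < +oo)%E.

Lemma L2dot_toL2 : L2dot (toL2 mu f) (toL2 mu g) = \int[mu]_x (f x * g x).
Proof.
congr fine; apply: ae_eq_integral => //.
- by apply/measurable_EFinP; apply: measurable_funM; exact: measurable_L2rep.
- by apply/measurable_EFinP; exact: measurable_funM.
- by apply: filterS2 (toL2_rep mf fi) (toL2_rep mg gi) => y -> -> _.
Qed.

End toL2_theory.

(** * Integration against a restricted measure *)

Section mrestr_integral.
Context d (T : measurableType d) (R : realType) (mu : {measure set T -> \bar R}).
Local Open Scope ereal_scope.

(** [mu] is the sum of its restrictions to [D] and to the complement; the second one does not see
    [f \_ D], and for the first one [f \_ D] is almost everywhere [f]. *)
Lemma ge0_integral_mrestr (D : set T) (mD : measurable D) (f : T -> \bar R) :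
  measurable_fun setT f -> (forall x, 0 <= f x) ->
  \int[mrestr mu mD]_x f x = \int[mu]_(x in D) f x.
Proof.
move=> mf f0; have mDC := measurableC mD.
have mfD : measurable_fun setT (f \_ D).
  by apply/(measurable_restrictT _ _).1 => //; exact: measurable_funTS.
have fD0 x : 0 <= (f \_ D) x by rewrite patchE; case: ifPn.
rewrite [RHS]integral_mkcond.
rewrite (eq_measure_integral (measure_add (mrestr mu mD) (mrestr mu mDC))); last first.
  move=> A mA _.
  transitivity (mrestr mu mD A + mrestr mu mDC A); last first.
    exact/esym/(measure_addE (mrestr mu mD) (mrestr mu mDC)).
  rewrite /mrestr -measureU//; last 3 first.
  - exact: measurableI.
  - exact: measurableI.
  - by rewrite setIACA setICr setI0.
  by rewrite -setIUr setUv setIT.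
rewrite ge0_integral_measure_add// [X in _ = _ + X](_ : _ = 0) ?adde0; last first.
  rewrite -(integral0 (mrestr mu mDC) setT).
  apply: ae_eq_integral => //; exists D; split => //.
    by rewrite /= /mrestr setICr measure0.
  move=> x /=; apply: contra_notP => xD _; rewrite patchE.
  by case: ifPn => //; rewrite inE.
apply: ae_eq_integral => //; exists (~` D); split => //.
  by rewrite /= /mrestr setICl measure0.
move=> x /=; apply: contra_not => xD _; rewrite patchE.
by rewrite ifT// inE.
Qed.

End mrestr_integral.

(** * Lebesgue measure of balls and of bounded sets *)

Section lebesgue_rV_theory.
Context (R : realType).

(** Balls of row vectors are those of the sup norm, hence cubes, and a cube is a product. *)
Lemma cons_rV_ball n (v : 'rV[R]_n.+1) e : 0 < e ->
  @cons_rV R n @^-1` ball v e = ball (v ord0 ord0) e `*` ball (uncons_rV v).2 e.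
Proof.
move=> e0; apply/seteqP; split => -[x w] /=.
  move=> /ball_rVE -/(_ e0) h; split.
    by have := h ord0; rewrite mxE unlift_none.
  by apply/ball_rVE => // j; have := h (lift ord0 j); rewrite !mxE liftK.
move=> [h1 /ball_rVE -/(_ e0) h2]; apply/ball_rVE => // i; rewrite mxE.
by case: unliftP => [j|] -> //=; have := h2 j; rewrite mxE.
Qed.

Lemma lebesgue_rV_ball n (v : 'rV[R]_n) e : 0 < e ->
  (0 < lebesgue_rV R n (ball v e) < +oo)%E.
Proof.
move=> e0; elim: n v => [|n ih] v.
  rewrite /= /dirac indicE mem_set ?lte01 ?ltry//.
  by apply/ball_rVE => // -[].
rewrite /= /lebesgue_rVS cons_rV_ball// product_measure1E//; last 2 first.
- by apply: open_measurable; exact: ball_open.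
- by apply: measurable_open_rV; exact: ball_open.
have /andP[h1 h2] := ih (uncons_rV v).2.
rewrite [X in (0 < X * _ < _)%E](_ : _ = (e *+ 2)%:E); last first.
  exact: lebesgue_measure_ball (ltW e0).
rewrite mule_gt0 ?lte_fin ?mulrn_wgt0//=.
by rewrite lte_mul_pinfty ?lee_fin ?mulrn_wge0 ?(ltW e0).
Qed.

Lemma lebesgue_rV_bounded n (D : set 'rV[R]_n) : measurable D -> bounded_set D ->
  (lebesgue_rV R n D < +oo)%E.
Proof.
move=> mD [M [_ MD]].
have M0 : 0 < `|M| + 2 by rewrite ltr_wpDl.
have /andP[_] := @lebesgue_rV_ball n 0 _ M0; apply: le_lt_trans.
apply: le_measure; rewrite ?inE//; first by apply: measurable_open_rV; exact: ball_open.
move=> x Dx; rewrite -ball_normE/= sub0r normrN.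
apply: (@le_lt_trans _ _ (`|M| + 1)); last by rewrite ltrD2l ltr1n.
by apply: MD => //; rewrite (le_lt_trans (ler_norm M))// ltrDl.
Qed.

End lebesgue_rV_theory.

Section L2dom_theory.
Context (R : realType) (n : nat) (Omega : smooth_bounded_domain R n).

Lemma measurable_dom : measurable (Omega : set _).
Proof. exact: measurable_open_rV (@dom_open _ _ Omega). Qed.

Lemma lebesgue_on_fin : (lebesgue_on Omega setT < +oo)%E.
Proof.
rewrite /lebesgue_on /= /mrestr setTI; apply: lebesgue_rV_bounded; first exact: measurable_dom.
exact: dom_bounded.
Qed.

(** The orthogonal family consists of indicators of [N] cubes in Omega, with centres
    [x + i h (1, ..., 1)] and radius [h / 2]. The first coordinates, which exist as [n > 0], show
    that they are disjoint; [h = rho / (N + 1)] keeps them in the ball of radius [rho] around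
    [x]. *)
Lemma L2dom_infinite_dim : (0 < n)%N -> forall s : seq (L2dom Omega),
  exists2 u : L2dom Omega, u != 0 & forall x, x \in s -> L2dot u x = 0.
Proof.
move=> n0; apply: (ip_infinite_dim (L2dot_inner_product _)) => N.
have [x Ox] := @dom_nonempty _ _ Omega.
have /nbhs_ballP[rho /= rho0 xO] : nbhs x Omega.
  by apply: open_nbhs_nbhs; split => //; exact: dom_open.
pose h : R := rho / N.+1%:R.
have h0 : 0 < h by rewrite divr_gt0.
have h20 : 0 < h / 2 by rewrite divr_gt0.
pose B (i : 'I_N) := ball (x + const_mx (i%:R * h)) (h / 2) : set 'rV[R]_n.
have mB i : measurable (B i) by by apply: measurable_open_rV; exact: ball_open.
have BP i y : B i y -> `|x ord0 (Ordinal n0) + i%:R * h - y ord0 (Ordinal n0)| < h / 2.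
  by move=> /ball_rVE -/(_ h20)/(_ (Ordinal n0)); rewrite !mxE.
have BO i : B i `<=` Omega.
  move=> y /ball_rVE -/(_ h20) Biy; apply: xO; apply/ball_rVE => // j.
  have := Biy j; rewrite !mxE /ball/= => hj.
  have -> : x ord0 j - y ord0 j = (x ord0 j + i%:R * h - y ord0 j) - i%:R * h by ring.
  rewrite (le_lt_trans (ler_normB _ _))// (@ger0_norm _ (i%:R * h)) ?mulr_ge0 ?(ltW h0) ?(ltW rho0)//.
  apply: (@lt_le_trans _ _ (h / 2 + i%:R * h)); first by rewrite ltrD2r.
  have -> : rho = N.+1%:R * h by rewrite /h mulrC divfK.
  have : i%:R * h <= N%:R * h by rewrite ler_pM2r// ler_nat ltnW.
  by rewrite -[N.+1%:R]natr1 mulrDl mul1r; move: h0; lra.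
have mI i : measurable_fun setT (\1_(B i) : _ -> R) by exact: measurable_indic.
have iI i : (\int[lebesgue_on Omega]_y ((\1_(B i) y : R) ^+ 2)%:E =
    lebesgue_rV R n (B i))%E.
  under eq_integral do rewrite indicE expr2 -natrM mulnb andbb -indicE.
  by rewrite integral_indic//= setIT /mrestr (setIidl (@BO i)).
have /(_ _ _ h20) Bpos := @lebesgue_rV_ball R n.
have fin i : (\int[lebesgue_on Omega]_y ((\1_(B i) y : R) ^+ 2)%:E < +oo)%E.
  by rewrite iI; have /andP[] := Bpos (x + const_mx (i%:R * h)).
exists (fun i => toL2 (lebesgue_on Omega) (\1_(B i))); split => [i|i j ij].
  apply/eqP => E; have := sqr_norm_toL2 (mI i) (fin i).
  rewrite iI E normr0 expr0n /= => F; have /andP[] := Bpos (x + const_mx (i%:R * h)).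
  by rewrite -/(B i) -F ltxx.
rewrite (L2dot_toL2 (mI i) (fin i) (mI j) (fin j)).
transitivity (\int[lebesgue_on Omega]_y (0 : R)); last by rewrite /Rintegral integral0.
apply: eq_Rintegral => y _; rewrite !indicE -natrM mulnb; case: (boolP (_ && _)) => // /andP[].
  rewrite !inE => /BP iy /BP jy; exfalso.
  have : `|i%:R * h - j%:R * h| < h.
    have -> : i%:R * h - j%:R * h = (x ord0 (Ordinal n0) + i%:R * h - y ord0 (Ordinal n0)) -
      (x ord0 (Ordinal n0) + j%:R * h - y ord0 (Ordinal n0)) by ring.
    by rewrite (le_lt_trans (ler_normB _ _))//; lra.
  rewrite -mulrBl normrM (gtr0_norm h0) gtr_pMl// ltNge => /negP; apply.
  have [ij'|ji|E] := ltngtP i j; last by move: ij; rewrite (val_inj E) eqxx.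
    by rewrite distrC -natrB ?(ltnW ij')// normr_nat ler1n subn_gt0.
  by rewrite -natrB ?(ltnW ji)// normr_nat ler1n subn_gt0.
Qed.

End L2dom_theory.

(** * Eigenbases and fractional powers *)

Lemma powR_half_sqr (R : realType) (x : R) : 0 <= x -> (x `^ 2^-1) ^+ 2 = x.
Proof. by move=> x0; rewrite -powR_mulrn ?powR_ge0// -powRrM mulVf ?pnatr_eq0// powRr1. Qed.

Lemma powR_half_mul (R : realType) (x : R) : 0 <= x -> x `^ 2^-1 * x `^ 2^-1 = x.
Proof. by move=> x0; rewrite -expr2 powR_half_sqr. Qed.

Section operator_theory.
Context d (T : measurableType d) (R : realType) (mu : {measure set T -> \bar R}).
Notation H := (L2 mu).
Variable A : unbounded_operator H.
Hypothesis A_sa : selfadjoint_op A.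
Let ip := L2dot_inner_product mu.

Lemma selfadjoint_sym (u v : H) : op_dom A u -> op_dom A v -> L2dot (A u) v = L2dot u (A v).
Proof.
by move=> Au Av; have [_ h] := A_sa v (A v); have := h (conj Av erefl); exact.
Qed.

Section existence.
Hypothesis A_lin : linear_op A.
Hypothesis A_dense : dense (op_dom A).
Hypothesis A_pos : positive_op A.
Hypothesis A_res : compact_resolvent A.
Hypothesis infdim : forall s : seq H, exists2 u : H, u != 0 &
  forall x, x \in s -> L2dot u x = 0.

(** The resolvent inherits symmetry from A, is injective, and has the dense range D(A). An
    eigenvalue [m k] of [K] gives [lam k = l + 1 / m k] for A. Since [m k] tends to 0, [|lam k - l|]
    tends to infinity, and positivity of A fixes the sign. *)
Theorem exists_eigenbasis : exists e lam, eigenbasis A e lam.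
Proof.
have [A0 AL] := A_lin; have [l [K [K1 K2 Kc]]] := A_res.
have AZ a u : op_dom A u -> op_dom A (a *: u) /\ A (a *: u) = a *: A u.
  have A00 : A 0 = 0.
    have [_] := AL (-1) 0 0 A0 A0; rewrite scaler0 addr0 scaleN1r addNr.
    by [].
  by move=> Au; have := AL a u 0 Au A0; rewrite !addr0 A00 addr0.
have A00 : A 0 = 0 by have [_] := AZ 0 0 A0; rewrite !scale0r.
have Klin a u v : K (a *: u + v) = a *: K u + K v.
  have [du Eu] := K1 u; have [dv Ev] := K1 v; have [dw Ew] := AL a _ _ du dv.
  rewrite -(K2 _ dw) Ew; congr K; rewrite -{1}Eu -{1}Ev.
  rewrite scalerBr scalerDr opprD addrACA; congr (_ + _ + (_ - _)).
  by rewrite !scalerA mulrC.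
have Ksym u v : L2dot (K u) v = L2dot u (K v).
  have [du Eu] := K1 u; have [dv Ev] := K1 v.
  rewrite -{1}Ev -{2}Eu (ipBr ip) (ipBl ip) (ipZr ip) (ipZl ip).
  by rewrite selfadjoint_sym.
have Kinj u : K u = 0 -> u = 0.
  by move=> Ku; have [_] := K1 u; rewrite Ku A00 scaler0 subrr.
have Kcomp (x : H ^nat) : (forall k, `|x k| <= 1) ->
    exists y : H, forall eps, 0 < eps ->
    forall N, exists2 k, (N <= k)%N & `|K (x k) - y| < eps.
  move=> x1; pose B := [set u : H | `|u| <= 1].
  have bB : bounded_set B.
    by exists 1; split; [exact: num_real|move=> M M1 u /= /le_trans; apply; exact: ltW].
  have := Kc _ bB ((fun k => K (x k)) @ \oo).
  case.
    exists 0%N => // k _ /=; apply: subset_closure; exists (x k) => //; exact: x1.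
  move=> y [_ cy]; exists y => eps eps0 N.
  have [||_ [[k Nk <-]]] := cy [set K (x k) | k in [set k | (N <= k)%N]] (ball y eps).
  - by exists N => // k Nk /=; exists k.
  - exact: nbhsx_ballx.
  by rewrite -ball_normE /= distrC => h; exists k.
have Kdense (u : H) (eps : R) : 0 < eps -> exists v : H, `|u - K v| < eps.
  move=> eps0; have [||w] := @A_dense (ball u eps).
  - by exists u; exact: ballxx.
  - exact: ball_open.
  rewrite -ball_normE /= => -[uw dw]; exists (A w - l *: w).
  by rewrite K2.
have [e [m [[one onb] Ke m0]]] := compact_symmetric_spectral ip Klin Ksym Kinj Kcomp infdim Kdense.
have e0 k : e k != 0 by rewrite -normr_eq0 (norm_orthonormal ip one) oner_eq0.
have mn0 k : m k != 0.
  apply/eqP => mk; have := Ke k; rewrite mk scale0r => /Kinj ek0.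
  by have := e0 k; rewrite ek0 eqxx.
pose lam k := l + (m k)^-1.
have Ae k : op_dom A (e k) /\ A (e k) = lam k *: e k.
  have [d1 E1] := K1 (e k); have [d2 E2] := AZ (m k)^-1 _ d1.
  have E : (m k)^-1 *: K (e k) = e k by rewrite Ke scalerA mulVf// scale1r.
  rewrite E in d2 E2; split => //; rewrite E2 /lam scalerDl.
  have /eqP := E1; rewrite subr_eq => /eqP ->.
  by rewrite scalerDr addrC scalerA mulrC -scalerA E.
have lam0 k : 0 < lam k.
  have [dk Ek] := Ae k; have := A_pos dk (e0 k).
  by rewrite Ek (ipZl ip) one eqxx mulr1.
exists e, lam; split => //.
apply/cvgryPge => M.
have D0 : 0 < (`|M| + `|l| + 1)^-1 by rewrite invr_gt0 ltr_wpDl// addr_ge0.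
move/cvgrPdist_lt : m0 => /(_ _ D0); apply: filterS => k.
rewrite sub0r normrN => mk.
have : `|M| + `|l| + 1 < `|m k|^-1.
  by rewrite -[ltLHS]invrK ltf_pV2// posrE ?invr_gt0// normr_gt0.
have -> : `|m k|^-1 = `|lam k - l| by rewrite /lam addrAC subrr add0r normfV.
have := ler_normB (lam k) l; rewrite (gtr0_norm (lam0 k)).
by have := ler_norm M; lra.
Qed.

End existence.

Section powers.
Variables (e : H ^nat) (lam : R ^nat).
Hypothesis eb : eigenbasis A e lam.

Lemma eigenbasis_onb : orthonormal_basis (@L2dot d T R mu) e.
Proof. by have [one onb _ _ _] := eb. Qed.
Let onb := eigenbasis_onb.

Lemma eigenvalue_gt0 k : 0 < lam k. Proof. by have [_ _ _ h _] := eb. Qed.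

Lemma eigenvalue_ge0 k : 0 <= lam k. Proof. exact/ltW/eigenvalue_gt0. Qed.

Lemma eigenvalue_ge C : exists N, forall k, (N <= k)%N -> C <= lam k.
Proof. by have [_ _ _ _ /cvgryPge/(_ C)[N _ NP]] := eb; exists N. Qed.

(** From some index on 1 is a lower bound, and finitely many eigenvalues remain. The gap [c] lets
    the energy control the norm. *)
Lemma eigenvalue_lbound : exists2 c : R, 0 < c & forall k, c <= lam k.
Proof.
have [N NP] := eigenvalue_ge 1.
suff [c c0 cP] : exists2 c : R, 0 < c & forall k, (k < N)%N -> c <= lam k.
  exists (Num.min c 1); first by rewrite lt_min c0 ltr01.
  move=> k; rewrite ge_min; case: (ltnP k N) => kN; first by rewrite cP.
  by rewrite NP// orbT.
elim: N {NP} => [|N [c c0 cP]]; first by exists 1.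
exists (Num.min c (lam N)); first by rewrite lt_min c0 eigenvalue_gt0.
move=> k; rewrite ltnS leq_eqVlt ge_min => /orP[/eqP->|/cP->//].
by rewrite lexx orbT.
Qed.

(** [pow_graph] allows any eigenbasis; this shows that the choice does not matter. By symmetry of A,
    [e' k] and [e j] are orthogonal unless [lam' k = lam j], so the factors [lam' k ^ a] and
    [lam j ^ a] agree in every nonzero term. *)
Lemma pow_graphP a u w :
  pow_graph A a u w <-> forall j, L2dot w (e j) = lam j `^ a * L2dot u (e j).
Proof.
split=> [[e' [lam' [eb' cw]]] j|h]; last first.
  exists e, lam; split=> //.
  have [_ + _ _ _] := eb => /(_ w).
  by rewrite /series/=; under eq_fun do under eq_bigr do rewrite h.
have [_ cu Ae' _ _] := eb'; have [_ _ Ae _ _] := eb.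
have h1 := ip_cvg ip (w := e j) cw.
have h2 := cvgM (cvg_cst (lam j `^ a)) (ip_cvg ip (w := e j) (cu u)).
apply: (cvg_unique (@norm_hausdorff _ _) h1).
rewrite (_ : (fun k => _) = (fun n => lam j `^ a *
  L2dot (series (fun k => L2dot u (e' k) *: e' k) n) (e j))); first exact: h2.
apply/funext => n.
rewrite /series/= !(ip_suml ip) mulr_sumr; apply: eq_bigr => k _.
rewrite !(ipZl ip) mulrA.
have [d1 E1] := Ae' k; have [d2 E2] := Ae j.
have := selfadjoint_sym d1 d2; rewrite E1 E2 (ipZl ip) (ipZr ip) => /eqP.
rewrite -subr_eq0 -mulrBl mulf_eq0 => /orP[|/eqP->]; last by rewrite !mulr0.
by rewrite subr_eq0 => /eqP ->.
Qed.

(** Coordinates determine a vector, so the [get] in [op_pow] has only one candidate. *)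
Lemma op_powP a u w : (forall j, L2dot w (e j) = lam j `^ a * L2dot u (e j)) ->
  op_dom (op_pow A a) u /\ op_pow A a u = w.
Proof.
move=> h; have gw : pow_graph A a u w by apply/pow_graphP.
split; first by exists w.
apply: (coord_inj ip onb) => j; rewrite h.
have : pow_graph A a u (op_pow A a u) by exact: (getPex (ex_intro _ w gw)).
by move/pow_graphP.
Qed.

Lemma op_pow_coord a u : op_dom (op_pow A a) u ->
  forall j, L2dot (op_pow A a u) (e j) = lam j `^ a * L2dot u (e j).
Proof. by move=> [w gw]; apply/pow_graphP; exact: (getPex (ex_intro _ w gw)). Qed.

Lemma op_dom_pow a u C :
  (forall n, \sum_(0 <= k < n) (lam k `^ a * L2dot u (e k)) ^+ 2 <= C) ->
  op_dom (op_pow A a) u.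
Proof.
move=> h; have [w wP] := riesz_fischer ip onb (@L2_complete _ _ _ mu) h.
by have [] := op_powP wP.
Qed.

Lemma op_dom_half u C :
  (forall n, \sum_(0 <= k < n) lam k * L2dot u (e k) ^+ 2 <= C) ->
  op_dom (op_pow A 2^-1) u.
Proof.
move=> h; apply: (@op_dom_pow _ _ C) => n; apply: le_trans (h n).
by apply: ler_sum => k _; rewrite exprMn powR_half_sqr// eigenvalue_ge0.
Qed.

Lemma op_dom_neg_half u : op_dom (op_pow A (- 2^-1)) u.
Proof.
have [c c0 cP] := eigenvalue_lbound.
apply: (@op_dom_pow _ _ (c^-1 * `|u| ^+ 2)) => n.
apply: (@le_trans _ _ (c^-1 * \sum_(0 <= k < n) L2dot u (e k) ^+ 2)).
  rewrite mulr_sumr; apply: ler_sum => k _.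
  rewrite exprMn ler_wpM2r ?sqr_ge0// powRN exprVn powR_half_sqr ?eigenvalue_ge0//.
  by rewrite lef_pV2// posrE ?eigenvalue_gt0.
by rewrite ler_wpM2l ?invr_ge0 ?(ltW c0)//; exact: bessel (proj1 onb) _ _.
Qed.

End powers.
End operator_theory.

(** * Integrals over real intervals *)

Section bounded_integrable.
Context d (T : measurableType d) (R : realType) (mu : {measure set T -> \bar R}).

Lemma integrable_bounded (D : set T) (f : T -> R) (M : R) : measurable D ->
  (mu D < +oo)%E -> measurable_fun D f -> (forall x, D x -> `|f x| <= M) ->
  mu.-integrable D (fun x => (f x)%:E).
Proof.
move=> mD Doo mf fM; apply: measurable_bounded_integrable => //.
exists M; split; first exact: num_real.
by move=> C MC x Dx; rewrite /= (le_trans (fM _ Dx))// ltW.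
Qed.

Lemma integrable_mul_bounded (D : set T) (f h : T -> R) (M : R) : measurable D ->
  mu.-integrable D (fun x => (f x)%:E) -> measurable_fun D h ->
  (forall x, D x -> `|h x| <= M) ->
  mu.-integrable D (fun x => (f x * h x)%:E).
Proof.
move=> mD fi mh hM; rewrite (_ : (fun x => _) = ((fun x => (f x)%:E) \* (EFin \o h))%E)//.
apply: integrableMl => //; exists M; split; first exact: num_real.
by move=> C MC x Dx; rewrite /= (le_trans (hM _ Dx))// ltW.
Qed.

Lemma Rintegral_le_cst (D : set T) (f : T -> R) (M : R) : measurable D ->
  (mu D < +oo)%E -> measurable_fun D f -> (forall x, D x -> `|f x| <= M) ->
  `|\int[mu]_(x in D) f x| <= M * fine (mu D).
Proof.
move=> mD Doo mf fM; have fi := integrable_bounded mD Doo mf fM.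
rewrite (le_trans (le_normr_Rintegral mD fi))// -Rintegral_cst//.
apply: le_Rintegral => //.
- by have := integrable_abse fi.
- apply: (@integrable_bounded _ _ `|M|) => //.
Qed.

Lemma integrable_patch (D : set T) (f : T -> R) : measurable D ->
  mu.-integrable D (fun x => (f x)%:E) -> mu.-integrable setT (fun x => ((f \_ D) x)%:E).
Proof.
move=> mD /(integrable_mkcond _ mD); apply: eq_integrable => // x _.
by rewrite !patchE; case: ifPn.
Qed.

Lemma integrable_addR (D : set T) (f g : T -> R) :
  mu.-integrable D (fun x => (f x)%:E) -> mu.-integrable D (fun x => (g x)%:E) ->
  measurable D -> mu.-integrable D (fun x => (f x + g x)%:E).
Proof. by move=> fi gi mD; exact: (integrableD mD fi gi). Qed.

Lemma integrable_scaleR (D : set T) (c : R) (f : T -> R) :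
  mu.-integrable D (fun x => (f x)%:E) -> measurable D ->
  mu.-integrable D (fun x => (c * f x)%:E).
Proof. by move=> fi mD; exact: (integrableZl mD c fi). Qed.

Lemma le_integrableR (D : set T) (f g : T -> R) :
  mu.-integrable D (fun x => (g x)%:E) -> measurable_fun D f ->
  (forall x, D x -> `|f x| <= g x) -> measurable D ->
  mu.-integrable D (fun x => (f x)%:E).
Proof.
move=> gi mf fg mD; apply: le_integrable gi => //; first exact/measurable_EFinP.
by move=> x Dx; rewrite /= lee_fin (le_trans (fg _ Dx))// ler_norm.
Qed.

Lemma Rintegral_sum (D : set T) (f : nat -> T -> R) n :
  (forall k, mu.-integrable D (fun x => (f k x)%:E)) -> measurable D ->
  mu.-integrable D (fun x => (\sum_(0 <= k < n) f k x)%:E) /\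
  \int[mu]_(x in D) (\sum_(0 <= k < n) f k x) = \sum_(0 <= k < n) \int[mu]_(x in D) f k x.
Proof.
move=> fi mD; elim: n => [|n [ih1 ih2]].
  rewrite big_geq//; split.
    by under eq_fun do rewrite big_geq//; exact: integrable0.
  by under eq_Rintegral do rewrite big_geq//; rewrite /Rintegral integral0.
split; first by under eq_fun do rewrite big_nat_recr//=; exact: integrable_addR.
rewrite big_nat_recr//= -ih2 -RintegralD//; last exact: fi.
by apply: eq_Rintegral => x _; rewrite big_nat_recr.
Qed.

End bounded_integrable.

Section interval_calculus.
Context (R : realType).
Notation leb := (@lebesgue_measure R).
Implicit Types (a b t s T : R) (f g p q : R -> R).

Lemma lebesgue_itvcc_lty a b : (leb `[a, b] < +oo)%E.
Proof. by rewrite lebesgue_measure_itv /=; case: ifPn => // _; rewrite -EFinD ltry. Qed.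

Lemma lebesgue_itvoo_lty a b : (leb `]a, b[ < +oo)%E.
Proof. by rewrite lebesgue_measure_itv /=; case: ifPn => // _; rewrite -EFinD ltry. Qed.

Lemma fine_lebesgue_itvcc a b : a <= b -> fine (leb `[a, b]) = b - a.
Proof.
rewrite le_eqVlt => /predU1P[->|ab].
  by rewrite lebesgue_measure_itv /= ltxx subrr.
by rewrite lebesgue_measure_itv /= lte_fin ab.
Qed.

Lemma integrable_within_continuous a b f : {within `[a, b], continuous f} ->
  leb.-integrable `[a, b] (fun x => (f x)%:E).
Proof. by move=> cf; apply: continuous_compact_integrable => //; exact: segment_compact. Qed.

Lemma integrable_itvS a b c e f : c <= a -> b <= e ->
  leb.-integrable `[c, e] (fun x => (f x)%:E) -> leb.-integrable `[a, b] (fun x => (f x)%:E).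
Proof.
move=> ca be; apply: integrableS => //.
by apply: subset_itv; rewrite bnd_simp.
Qed.

Lemma integrable_itvZl a b c f : leb.-integrable `[a, b] (fun x => (f x)%:E) ->
  leb.-integrable `[a, b] (fun x => (c * f x)%:E).
Proof. by move=> fi; exact: (integrableZl _ c fi). Qed.

Lemma integrable_itvD a b f g : leb.-integrable `[a, b] (fun x => (f x)%:E) ->
  leb.-integrable `[a, b] (fun x => (g x)%:E) ->
  leb.-integrable `[a, b] (fun x => (f x + g x)%:E).
Proof. by move=> fi gi; exact: (integrableD _ fi gi). Qed.

Lemma integrable_itvB a b f g : leb.-integrable `[a, b] (fun x => (f x)%:E) ->
  leb.-integrable `[a, b] (fun x => (g x)%:E) ->
  leb.-integrable `[a, b] (fun x => (f x - g x)%:E).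
Proof. by move=> fi gi; exact: (integrableB _ fi gi). Qed.

Lemma Rintegral_itv_cat a b c f : a <= b -> b <= c ->
  leb.-integrable `[a, c] (fun x => (f x)%:E) ->
  \int[leb]_(x in `[a, c]) f x =
  \int[leb]_(x in `[a, b]) f x + \int[leb]_(x in `[b, c]) f x.
Proof.
move=> ab bc fi; have := @Rintegral_itvB R f (BLeft a) (BRight c) b fi.
rewrite !bnd_simp => /(_ ab bc) => /eqP; rewrite subr_eq => /eqP ->.
rewrite addrC; congr (_ + _); apply: Rintegral_itv_obnd_cbnd.
apply: integrableS fi => //.
by apply: subset_itv; rewrite bnd_simp.
Qed.

Lemma measurable_primitive T p : 0 <= T ->
  leb.-integrable `[0, T] (fun x => (p x)%:E) ->
  measurable_fun `[0, T] (fun t => \int[leb]_(s in `[0, t]) p s).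
Proof.
move=> T0 pi; apply: subspace_continuous_measurable_fun => //.
exact: parameterized_integral_continuous.
Qed.

Lemma normr_primitive_le T p t : t \in `[0, T] ->
  leb.-integrable `[0, T] (fun x => (p x)%:E) ->
  `|\int[leb]_(s in `[0, t]) p s| <= \int[leb]_(s in `[0, T]) `|p s|.
Proof.
rewrite in_itv/= => /andP[t0 tT] pi.
have pti : leb.-integrable `[0, t] (fun x => (p x)%:E) by exact: integrable_itvS pi.
rewrite (le_trans (le_normr_Rintegral _ pti))//.
rewrite (@Rintegral_itv_cat 0 t T)//; last exact: integrable_abse pi.
by rewrite lerDl Rintegral_ge0.
Qed.

(* Both sides are the integral of p s * q t over the triangle 0 <= s <= t <= T. *)
Lemma Rintegral_triangle T p q : 0 <= T ->
  leb.-integrable `[0, T] (fun x => (p x)%:E) ->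
  leb.-integrable `[0, T] (fun x => (q x)%:E) ->
  \int[leb]_(t in `[0, T]) ((\int[leb]_(s in `[0, t]) p s) * q t) =
  \int[leb]_(s in `[0, T]) (p s * \int[leb]_(t in `[s, T]) q t).
Proof.
move=> T0 pi qi.
pose D : set R := `[0, T]%classic; pose pD := p \_ D; pose qD := q \_ D.
have piD : leb.-integrable setT (fun x => (pD x)%:E).
  by apply: (integrable_patch _ pi); exact: measurable_itv.
have qiD : leb.-integrable setT (fun x => (qD x)%:E).
  by apply: (integrable_patch _ qi); exact: measurable_itv.
have mp : measurable_fun setT pD by apply/measurable_EFinP; exact: measurable_int piD.
have mq : measurable_fun setT qD by apply/measurable_EFinP; exact: measurable_int qiD.
pose tri := [set z : R * R | z.2 <= z.1].
have mtri : measurable tri.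
  have := @measurable_fun_ler _ _ _ setT snd fst (@measurable_snd _ _ R R) (@measurable_fst _ _ R R).
  move=> /(_ measurableT [set true]); rewrite setTI => h.
  rewrite (_ : tri = (fun z : R * R => z.2 <= z.1) @^-1` [set true]); first exact: h.
  by apply/seteqP; split.
pose f (z : R * R) := (pD z.2 * qD z.1 * \1_tri z)%:E.
have mf : measurable_fun setT f.
  apply/measurable_EFinP; apply: measurable_funM; last exact: measurable_indic.
  apply: measurable_funM.
    exact: (measurableT_comp mp (@measurable_snd _ _ R R)).
  exact: (measurableT_comp mq (@measurable_fst _ _ R R)).
(* Tonelli: [|f|] is dominated by [|p s| |q t|], extended by 0 outside the square, and its iterated
   integral is finite. *)
have fi : (leb \x leb)%E.-integrable setT f.
  apply/integrable12ltyP => //.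
  apply: (@le_lt_trans _ _ (\int[leb]_x (`|(qD x)%:E| * \int[leb]_y `|(pD y)%:E|))%E).
    apply: ge0_le_integral => //.
    - by move=> x _; exact: integral_ge0.
    - apply: (@measurable_fun_fubini_tonelli_F _ _ _ _ _ leb (abse \o f)) => //=.
      exact: measurableT_comp.
    - by apply: emeasurable_funM => //; apply: measurableT_comp => //; exact/measurable_EFinP.
    move=> x _; rewrite -ge0_integralZl//; last first.
      by apply: measurableT_comp => //; exact/measurable_EFinP.
    apply: ge0_le_integral => //.
    - by apply: measurableT_comp => //; exact: measurableT_comp.
    - by apply: emeasurable_funM => //; apply: measurableT_comp => //; exact/measurable_EFinP.
    - move=> y _; rewrite -abseM -EFinM /= lee_fin !normrM [leRHS]mulrC -[leRHS]mulr1.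
      rewrite ler_wpM2l ?mulr_ge0// indicE.
      by case: (_ \in _); rewrite ?normr0 ?normr1 ?ler01.
  rewrite ge0_integralZr//; last 2 first.
  - by apply: measurableT_comp => //; exact/measurable_EFinP.
  - exact: integral_ge0.
  move/integrableP : piD => [_ piD]; move/integrableP : qiD => [_ qiD].
  apply: lte_mul_pinfty => //; first by apply: integral_ge0.
  by rewrite ge0_fin_numE//; apply: integral_ge0.
have F1 t : D t -> (\int[leb]_s f (t, s) = ((\int[leb]_(s in `[0, t]) p s) * q t)%:E)%E.
  move=> Dt; have /andP[t0 tT] : 0 <= t <= T by move: Dt; rewrite /D/= in_itv.
  have pti : leb.-integrable `[0, t] (fun x => (p x)%:E) by exact: integrable_itvS pi.
  rewrite mulrC EFinM /Rintegral fineK; last exact: integrable_fin_num pti.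
  rewrite -integralZl// [RHS]integral_mkcond; apply: eq_integral => s _.
  rewrite /f /= /pD /qD !patchE (mem_set Dt) indicE.
  have [st|st] := boolP (s \in `[0, t]%classic).
    move: st; rewrite inE/= in_itv/= => /andP[s0 st].
    rewrite !mem_set/tri//=; last by rewrite /D/= in_itv/= s0 (le_trans st).
    by rewrite mulr1 mulrC EFinM.
  case: ifPn => [Ds|_]; last by rewrite !mul0r.
  rewrite memNset ?mulr0// /tri/= => ts; move/negP : st; apply.
  by move: Ds; rewrite !inE/D/= !in_itv/= => /andP[-> _].
have F2 s : D s -> (\int[leb]_t f (t, s) = (p s * \int[leb]_(t in `[s, T]) q t)%:E)%E.
  move=> Ds; have /andP[s0 sT] : 0 <= s <= T by move: Ds; rewrite /D/= in_itv.
  have qti : leb.-integrable `[s, T] (fun x => (q x)%:E) by exact: integrable_itvS qi.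
  rewrite EFinM /Rintegral fineK; last exact: integrable_fin_num qti.
  rewrite -integralZl// [RHS]integral_mkcond; apply: eq_integral => t _.
  rewrite /f /= /pD /qD !patchE (mem_set Ds) indicE.
  have [st|st] := boolP (t \in `[s, T]%classic).
    move: st; rewrite inE/= in_itv/= => /andP[st tT].
    rewrite !mem_set/tri//=; last by rewrite /D/= in_itv/= tT (le_trans s0).
    by rewrite mulr1 EFinM.
  case: ifPn => [Dt|_]; last by rewrite mulr0 mul0r.
  rewrite memNset ?mulr0// /tri/= => ts; move/negP : st; apply.
  by move: Dt; rewrite !inE/D/= !in_itv/= ts => /andP[_ ->].
have F10 t : ~ D t -> (\int[leb]_s f (t, s) = 0)%E.
  move=> Dt; rewrite -(integral0 leb setT); apply: eq_integral => s _.
  by rewrite /f /= /qD patchE memNset// mulr0 mul0r.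
have F20 s : ~ D s -> (\int[leb]_t f (t, s) = 0)%E.
  move=> Ds; rewrite -(integral0 leb setT); apply: eq_integral => t _.
  by rewrite /f /= /pD patchE memNset// !mul0r.
rewrite /Rintegral; congr fine.
transitivity (\int[leb]_t \int[leb]_s f (t, s))%E.
  rewrite [LHS]integral_mkcond; apply: eq_integral => t _; rewrite patchE.
  by case: ifPn => [/set_mem/F1//|/negP Dt]; rewrite F10// => /mem_set.
rewrite (Fubini fi) [RHS]integral_mkcond; apply: eq_integral => s _; rewrite patchE.
by case: ifPn => [/set_mem/F2//|/negP Ds]; rewrite F20// => /mem_set.
Qed.

(** No derivative is taken: [y] and [v] are primitives of integrable functions, the product of
    integrals is reordered over the triangle, and [v T = 0] turns the integral of [p] over [[s, T]]
    into [- v s]. *)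
Lemma Rintegral_by_parts T y0 v0 p k y v : 0 <= T ->
  leb.-integrable `[0, T] (fun x => (p x)%:E) ->
  leb.-integrable `[0, T] (fun x => (k x)%:E) ->
  (forall t, t \in `[0, T] -> y t = y0 + \int[leb]_(s in `[0, t]) k s) ->
  (forall t, t \in `[0, T] -> v t = v0 + \int[leb]_(s in `[0, t]) p s) ->
  v T = 0 ->
  - (\int[leb]_(t in `[0, T]) (y t * p t)) = y0 * v0 + \int[leb]_(t in `[0, T]) (k t * v t).
Proof.
move=> T0 pi ki yE vE vT.
have T_in : T \in `[0, T] by rewrite in_itv/= lexx T0.
have kpi : leb.-integrable `[0, T] (fun t => ((\int[leb]_(s in `[0, t]) k s) * p t)%:E).
  have := integrable_mul_bounded _ pi (measurable_primitive T0 ki)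
    (fun t tT => normr_primitive_le tT ki).
  by move=> /(_ (measurable_itv _)); apply: eq_integrable => // t _; rewrite mulrC.
have -> : \int[leb]_(t in `[0, T]) (y t * p t) =
    \int[leb]_(t in `[0, T]) (y0 * p t + (\int[leb]_(s in `[0, t]) k s) * p t).
  by apply: eq_Rintegral => t; rewrite inE => tT; rewrite yE// mulrDl.
rewrite RintegralD//; last exact: (integrableZl _ y0 pi).
rewrite RintegralZl// Rintegral_triangle//.
have -> : \int[leb]_(s in `[0, T]) p s = - v0.
  by have /eqP := vE T T_in; rewrite vT eq_sym addrC addr_eq0 => /eqP.
have -> : \int[leb]_(s in `[0, T]) (k s * \int[leb]_(t in `[s, T]) p t) =
    \int[leb]_(s in `[0, T]) (- 1 * (k s * v s)).
  apply: eq_Rintegral => s; rewrite inE => sT.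
  have /andP[s0 sT'] : 0 <= s <= T by move: sT; rewrite /= in_itv.
  have := vE T T_in; rewrite vT (Rintegral_itv_cat s0 sT' pi) addrA -vE// => /esym/eqP.
  by rewrite addrC addr_eq0 => /eqP ->; ring.
rewrite RintegralZl//; first by ring.
apply: (@integrable_mul_bounded _ _ _ _ _ _ _ (`|v0| + \int[leb]_(s in `[0, T]) `|p s|)) => //.
  apply: (eq_measurable_fun (fun t => v0 + \int[leb]_(s in `[0, t]) p s)).
    by move=> t; rewrite inE => tT; rewrite vE.
  by apply: measurable_funD => //; exact: measurable_primitive.
move=> t tT; rewrite vE// (le_trans (ler_normD _ _))// lerD2l.
exact: normr_primitive_le.
Qed.

Lemma Rintegral_expR c a b : a <= b ->
  \int[leb]_(s in `[a, b]) (c * expR (c * s)) = expR (c * b) - expR (c * a).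
Proof.
rewrite le_eqVlt => /predU1P[->|ab].
  by rewrite set_itv1 Rintegral_set1 subrr.
have dF (x : R) : is_derive x (1 : R) (fun s => expR (c * s)) (c * expR (c * x)).
  have dg : is_derive x (1 : R) (fun s : R => c * s) c.
    have h : is_derive x (1 : R) (c \*: (@id R)) (c *: (1 : R)) by exact: is_deriveZ.
    by rewrite /GRing.scale/= mulr1 in h.
  by rewrite mulrC; exact: (is_derive1_comp (f := expR) (g := fun s => c * s)).
have cf : continuous (fun s => c * expR (c * s)).
  move=> x; apply: cvgM; first exact: cvg_cst.
  apply: continuous_comp; last exact: continuous_expR.
  by apply: cvgM; [exact: cvg_cst|exact: cvg_id].
have cF : continuous (fun s => expR (c * s)).
  move=> x; apply: continuous_comp; last exact: continuous_expR.
  by apply: cvgM; [exact: cvg_cst|exact: cvg_id].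
rewrite /Rintegral (continuous_FTC2 (F := fun s => expR (c * s)) ab)//.
- exact: continuous_subspaceT.
- split => [x _|//|//]; first by have [] := dF x.
    by apply: cvg_at_right_filter; exact: cF.
  by apply: cvg_at_left_filter; exact: cF.
- by move=> x _; rewrite derive1E; have [_ ->] := dF x.
Qed.

End interval_calculus.

(** * Scalar Duhamel integrals *)

(** The solution of [y' = g - a y], [y 0 = 0]. The kernel [exp (- a (t - s))] is factored so that
    the integral is a primitive, with an integrand independent of [t]. *)
Definition duhamel (R : realType) (a : R) (g : R -> R) (t : R) : R :=
  expR (- (a * t)) * \int[@lebesgue_measure R]_(s in `[0, t]) (expR (a * s) * g s).

Section duhamel_theory.
Context (R : realType) (a : R).
Hypothesis a0 : 0 < a.
Notation leb := (@lebesgue_measure R).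
Implicit Types (t s T M : R) (g : R -> R).

Let continuous_expRM c : continuous (fun s : R => expR (c * s)).
Proof.
move=> x; apply: continuous_comp; last exact: continuous_expR.
by apply: cvgM; [exact: cvg_cst|exact: cvg_id].
Qed.

Lemma measurable_expRM c (D : set R) : measurable_fun D (fun s : R => expR (c * s)).
Proof.
apply: measurable_funTS; apply: continuous_measurable_fun; exact: continuous_expRM.
Qed.

Lemma eq_duhamel g h t : (forall s, 0 <= s <= t -> g s = h s) -> duhamel a g t = duhamel a h t.
Proof.
move=> gh; congr (_ * _); apply: eq_Rintegral => s; rewrite inE /= in_itv /= => st.
by rewrite gh.
Qed.

Section bounded_source.
Variables (g : R -> R) (M : R).
Hypothesis mg : measurable_fun setT g.
Hypothesis gM : forall s, `|g s| <= M.

Let M0 : 0 <= M. Proof. exact: le_trans (gM 0). Qed.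

Lemma integrable_source s t : leb.-integrable `[s, t] (fun x => (g x)%:E).
Proof.
by apply: (@integrable_bounded _ _ _ _ _ _ M) => //; [exact: lebesgue_itvcc_lty|exact: measurable_funTS].
Qed.

Let norm_weighted s t : s \in `[0, t] -> `|expR (a * s) * g s| <= expR (a * t) * M.
Proof.
rewrite in_itv/= => /andP[_ st]; rewrite normrM gtr0_norm ?expR_gt0//.
by apply: ler_pM => //; rewrite ?expR_ge0// ler_expR ler_pM2l.
Qed.

Let measurable_weighted (D : set R) : measurable_fun D (fun s => expR (a * s) * g s).
Proof.
by apply: measurable_funM; [exact: measurable_expRM|exact: measurable_funTS].
Qed.

Lemma integrable_weighted t : leb.-integrable `[0, t] (fun s => (expR (a * s) * g s)%:E).
Proof.
apply: (@integrable_bounded _ _ _ _ _ _ (expR (a * t) * M)) => //.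
- exact: lebesgue_itvcc_lty.
- exact: measurable_weighted.
- by move=> s st; exact: norm_weighted.
Qed.

Lemma duhamel_bound t : 0 <= t -> `|duhamel a g t| <= M * t.
Proof.
move=> t0; rewrite /duhamel normrM gtr0_norm ?expR_gt0// expRN ler_pdivrMl ?expR_gt0//.
have /(_ (fun x => expR (a * x) * g x) (expR (a * t) * M)) :=
  @Rintegral_le_cst _ _ _ leb `[0, t]%classic.
rewrite fine_lebesgue_itvcc// subr0 mulrA; apply => //.
- exact: lebesgue_itvcc_lty.
- exact: measurable_weighted.
- by move=> s st; exact: norm_weighted.
Qed.

(* Cauchy-Schwarz for expR (- a (t - s)) and g s: the quadratic
   0 <= \int (c expR (a s) - g s)^2 is evaluated at c = 2 a expR (- a t) duhamel t. *)
Lemma duhamel_sqr t : 0 <= t ->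
  2 * a * duhamel a g t ^+ 2 <= \int[leb]_(s in `[0, t]) (g s) ^+ 2.
Proof.
move=> t0; set I := \int[leb]_(s in `[0, t]) (expR (a * s) * g s).
have wi := integrable_weighted t.
have g2i : leb.-integrable `[0, t] (fun s => (g s ^+ 2)%:E).
  apply: (@integrable_bounded _ _ _ _ _ _ (M ^+ 2)) => //.
  - exact: lebesgue_itvcc_lty.
  - by apply: measurable_funX; exact: measurable_funTS.
  - by move=> s _; rewrite normrX ler_pXn2r ?nnegrE.
have e2i : leb.-integrable `[0, t] (fun s => (expR (2 * a * s))%:E).
  by apply: integrable_within_continuous; exact/continuous_subspaceT/continuous_expRM.
have X : \int[leb]_(s in `[0, t]) expR (2 * a * s) = (expR (2 * a * t) - 1) / (2 * a).
  apply: (@mulfI _ (2 * a)); first by rewrite gt_eqF// mulr_gt0.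
  rewrite -RintegralZl// Rintegral_expR// mulr0 expR0 [RHS]mulrC divfK// gt_eqF// mulr_gt0//.
(* The minimiser of the quadratic is this value divided by [1 - expR (- (a t))^2]. Leaving out the
   divisor avoids a separate case at [t = 0] and costs only the term [2 a (E z)^2], which has the
   right sign. *)
pose c := 2 * a * expR (- (a * t)) * duhamel a g t.
have : 0 <= \int[leb]_(s in `[0, t]) (c * expR (a * s) - g s) ^+ 2.
  by apply: Rintegral_ge0 => s _; exact: sqr_ge0.
have -> : \int[leb]_(s in `[0, t]) (c * expR (a * s) - g s) ^+ 2 =
   \int[leb]_(s in `[0, t]) ((c ^+ 2 * expR (2 * a * s) + (- (2 * c)) * (expR (a * s) * g s))
     + g s ^+ 2).
  apply: eq_Rintegral => s _.
  have -> : expR (2 * a * s) = expR (a * s) ^+ 2.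
    by rewrite expr2 -expRD; congr expR; ring.
  by ring.
have i1 := integrable_itvZl (c ^+ 2) e2i.
have i2 := integrable_itvZl (- (2 * c)) wi.
rewrite RintegralD//; last exact: integrable_itvD i1 i2.
rewrite RintegralD// !RintegralZl// X -/I.
have -> : (expR (2 * a * t) - 1) = (expR (- (a * t)))^-1 ^+ 2 - 1.
  by congr (_ - _); rewrite expRN invrK expr2 -expRD; congr expR; ring.
have zI : duhamel a g t = expR (- (a * t)) * I by [].
have : 0 < expR (- (a * t)) by exact: expR_gt0.
rewrite /c; move: (expR (- (a * t))) zI => E zI E0.
have -> : I = E^-1 * duhamel a g t by rewrite zI mulrA mulVf ?gt_eqF// mul1r.
move: (duhamel a g t) => z; set Y := (X in _ + X).
have -> : (2 * a * E * z) ^+ 2 * ((E^-1 ^+ 2 - 1) / (2 * a)) +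
    - (2 * (2 * a * E * z)) * (E^-1 * z) = - 2 * a * z ^+ 2 - 2 * a * (E * z) ^+ 2.
  by field; rewrite !gt_eqF.
have : 0 <= 2 * a * (E * z) ^+ 2 by rewrite mulr_ge0 ?sqr_ge0// mulr_ge0// ltW.
by rewrite -/Y; lra.
Qed.

Lemma measurable_duhamel T : 0 <= T -> measurable_fun `[0, T] (duhamel a g).
Proof.
move=> T0; apply: measurable_funM.
  rewrite (_ : (fun t => _) = (fun t => expR (- a * t))); first exact: measurable_expRM.
  by apply/funext => t; rewrite mulNr.
by apply: measurable_primitive => //; exact: integrable_weighted.
Qed.

Lemma integrable_duhamel T : 0 <= T -> leb.-integrable `[0, T] (fun s => (duhamel a g s)%:E).
Proof.
move=> T0; apply: (@integrable_bounded _ _ _ _ _ _ (M * T)) => //.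
- exact: lebesgue_itvcc_lty.
- exact: measurable_duhamel.
move=> s; rewrite /= in_itv/= => /andP[s0 sT].
by rewrite (le_trans (duhamel_bound s0))// ler_wpM2l.
Qed.

(** As [g] is only measurable, the equation is proved in integral form: exchanging the integrals
    over the triangle leaves [\int_s^t a exp (- a x) dx], which is explicit. *)
Lemma duhamel_ode t : 0 <= t ->
  duhamel a g t = \int[leb]_(s in `[0, t]) (g s - a * duhamel a g s).
Proof.
move=> t0.
rewrite RintegralB//; last 2 first.
- exact: integrable_source.
- exact: (integrable_itvZl a (integrable_duhamel t0)).
have -> : \int[leb]_(s in `[0, t]) (a * duhamel a g s) = - \int[leb]_(s in `[0, t])
    ((\int[leb]_(x in `[0, s]) (expR (a * x) * g x)) * (- a * expR (- a * s))).
  rewrite -mulN1r -RintegralZl//; last first.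
    have := integrable_itvZl (- a) (integrable_duhamel t0).
    apply: eq_integrable => // s _; rewrite /= /duhamel (mulNr a s); congr EFin; ring.
  by apply: eq_Rintegral => s _; rewrite /duhamel (mulNr a s); ring.
rewrite Rintegral_triangle//; last 2 first.
- exact: integrable_weighted.
- apply: integrable_within_continuous; apply: continuous_subspaceT => x.
  by apply: cvgM; [exact: cvg_cst|exact: continuous_expRM].
rewrite opprK.
have -> : \int[leb]_(s in `[0, t]) (expR (a * s) * g s *
    \int[leb]_(x in `[s, t]) (- a * expR (- a * x))) =
  \int[leb]_(s in `[0, t]) (expR (- (a * t)) * (expR (a * s) * g s) - g s).
  apply: eq_Rintegral => s; rewrite inE/= in_itv/= => /andP[s0 st].
  rewrite Rintegral_expR// !mulNr (expRN (a * s)) mulrBr.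
  rewrite [X in _ - X]mulrAC mulfV ?mul1r 1?mulrC//.
  by rewrite gt_eqF// expR_gt0.
have wi := integrable_weighted t.
rewrite RintegralB//; last 2 first.
- exact: (integrable_itvZl (expR (- (a * t))) wi).
- exact: integrable_source.
by rewrite RintegralZl// /duhamel; ring.
Qed.

(** The integrand of [duhamel_ode] is bounded. The constant grows with [a], so this gives
    equicontinuity one mode at a time; high modes are controlled by the energy. *)
Lemma duhamel_lipschitz T s t : 0 <= s -> s <= t -> t <= T ->
  `|duhamel a g t - duhamel a g s| <= (M + a * (M * T)) * (t - s).
Proof.
move=> s0 st tT; have t0 := le_trans s0 st; have T0 := le_trans t0 tT.
have ki : leb.-integrable `[0, t] (fun s => (g s - a * duhamel a g s)%:E).
  exact: integrable_itvB (integrable_source 0 t)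
    (integrable_itvZl a (integrable_duhamel t0)).
rewrite !duhamel_ode// (Rintegral_itv_cat s0 st)// addrAC subrr add0r.
rewrite -(fine_lebesgue_itvcc st); apply: Rintegral_le_cst => //.
- exact: lebesgue_itvcc_lty.
- apply: measurable_funB; first exact: measurable_funTS.
  apply: measurable_funM => //; apply: measurable_funS (measurable_duhamel t0) => //.
  by apply: subset_itv; rewrite bnd_simp.
- move=> x; rewrite /= in_itv/= => /andP[sx xt]; have x0 := le_trans s0 sx.
  rewrite (le_trans (ler_normB _ _))// lerD// normrM (gtr0_norm a0) ler_pM2l//.
  by rewrite (le_trans (duhamel_bound x0))// ler_wpM2l// (le_trans xt).
Qed.

Definition mode y0 t := expR (- (a * t)) * y0 + duhamel a g t.

Lemma mode_ode y0 t : 0 <= t ->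
  mode y0 t = y0 + \int[leb]_(s in `[0, t]) (g s - a * mode y0 s).
Proof.
move=> t0; rewrite /mode.
have -> : \int[leb]_(s in `[0, t]) (g s - a * (expR (- (a * s)) * y0 + duhamel a g s)) =
  \int[leb]_(s in `[0, t]) ((g s - a * duhamel a g s) + y0 * (- a * expR (- a * s))).
  by apply: eq_Rintegral => s _; rewrite (mulNr a s); ring.
have ei : leb.-integrable `[0, t] (fun s => (- a * expR (- a * s))%:E).
  apply: integrable_within_continuous; apply: continuous_subspaceT => x.
  by apply: cvgM; [exact: cvg_cst|exact: continuous_expRM].
rewrite RintegralD//; last 2 first.
- exact: integrable_itvB (integrable_source 0 t)
    (integrable_itvZl a (integrable_duhamel t0)).
- exact: (integrable_itvZl y0 ei).
rewrite RintegralZl// Rintegral_expR// -duhamel_ode// mulr0 expR0 mulNr.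
by ring.
Qed.

Lemma integrable_mode y0 T : 0 <= T -> leb.-integrable `[0, T] (fun s => (mode y0 s)%:E).
Proof.
move=> T0.
have ei : leb.-integrable `[0, T] (fun s => (expR (- a * s) * y0)%:E).
  apply: integrable_within_continuous; apply: continuous_subspaceT => x.
  by apply: cvgM; [exact: continuous_expRM|exact: cvg_cst].
have := integrable_itvD ei (integrable_duhamel T0).
by apply: eq_integrable => // s _; rewrite /mode mulNr.
Qed.

End bounded_source.

(** Dominated convergence with the constant [expR (a t) M]; it identifies the limit of the Euler
    scheme. *)
Lemma duhamel_cvg (gk : nat -> R -> R) g M t :
  (forall k, measurable_fun setT (gk k)) -> measurable_fun setT g ->
  (forall k s, `|gk k s| <= M) ->
  (forall s, 0 <= s <= t -> gk k s @[k --> \oo] --> g s) ->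
  duhamel a (gk k) t @[k --> \oo] --> duhamel a g t.
Proof.
move=> mgk mg gkM gkg; apply: cvgM; first exact: cvg_cst.
have [||||||] := @dominated_convergence _ _ _ leb `[0, t]%classic _
  (fun k s => (expR (a * s) * gk k s)%:E) (fun s => (expR (a * s) * g s)%:E)
  (fun s => (expR (a * t) * M)%:E).
- exact: measurable_itv.
- move=> k; apply/measurable_EFinP; apply: measurable_funM; first exact: measurable_expRM.
  exact: measurable_funTS (mgk k).
- apply/measurable_EFinP; apply: measurable_funM; first exact: measurable_expRM.
  exact: measurable_funTS.
- apply: aeW => s; rewrite /= in_itv/= => st.
  apply/fine_cvgP; split; first exact: nearW.
  by apply: cvgM; [exact: cvg_cst|exact: gkg].
- apply: (@integrable_bounded _ _ _ _ _ _ `|expR (a * t) * M|) => //.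
  exact: lebesgue_itvcc_lty.
- apply: aeW => s k; rewrite /= in_itv/= => /andP[s0 st].
  rewrite lee_fin normrM gtr0_norm ?expR_gt0//.
  by apply: ler_pM => //; rewrite ?expR_ge0// ler_expR ler_pM2l.
move=> gi _ h; apply: fine_cvg; rewrite /Rintegral fineK//.
by apply: integrable_fin_num gi.
Qed.

End duhamel_theory.

(** * Hilbert-valued functions of time *)

Section time_dependent.
Context d (T : measurableType d) (R : realType) (mu : {measure set T -> \bar R}).
Notation H := (L2 mu).
Notation leb := (@lebesgue_measure R).
Notation dot := (@L2dot d T R mu).
Let ip := L2dot_inner_product mu.
Implicit Types (I : set R) (g p q : R -> H).

Lemma measurable_continuous_comp I g (F : H -> R) : continuous F ->
  measurable_fun I (g : R -> g_sigma_algebraType (@open H)) ->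
  measurable_fun I (F \o g).
Proof.
move=> cF mg mI; apply: (measurability _ (RGenOpens.measurableE R)) => //.
move=> _ [_ [a [b ->] <-]]; rewrite comp_preimage; apply: mg => //.
apply: sub_sigma_algebra; apply: open_comp; last exact: interval_open.
by move=> x _; exact: cF.
Qed.

Lemma measurable_coord I g (w : H) :
  measurable_fun I (g : R -> g_sigma_algebraType (@open H)) ->
  measurable_fun I (fun t => dot (g t) w).
Proof. exact: measurable_continuous_comp (continuous_ipl ip (w := w)). Qed.

Lemma measurable_normL2 I g : measurable_fun I (g : R -> g_sigma_algebraType (@open H)) ->
  measurable_fun I (fun t => `|g t|).
Proof. by apply: (@measurable_continuous_comp _ _ (fun u : H => `|u|)); exact: norm_continuous. Qed.

Section basis.
Variable e : H ^nat.
Hypothesis onb : orthonormal_basis dot e.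
Let one := proj1 onb.

(** [pettis] depends on this, so the norm is reached as a limit of Parseval sums and not as a
    continuous function of a Borel map. *)
Lemma measurable_sqr_norm_coord I g (mI : measurable I) :
  (forall j, measurable_fun I (fun t => dot (g t) (e j))) ->
  measurable_fun I (fun t => `|g t| ^+ 2).
Proof.
move=> mg; apply: (measurable_fun_cvg
  (h := fun n t => \sum_(0 <= k < n) dot (g t) (e k) ^+ 2)) => [n|t _].
  by apply: measurable_sum => k; exact: measurable_funX (mg k).
exact: (parseval_sqr ip onb).
Qed.

Let comb (q : seq rat) : H := \sum_(0 <= k < size q) ratr (nth 0 q k) *: e k.

Let comb_dense (x : H) (eps : R) : 0 < eps -> exists q : seq rat, `|x - comb q| < eps.
Proof.
move=> eps0; have e2 : 0 < eps / 2 by rewrite divr_gt0.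
have /cvgrPdist_lt /(_ _ e2) [n _ /(_ n (leqnn n)) xn] := proj2 onb x.
(* The [n] coordinate errors then add up to at most [eps / 2]; [n + 1] in place of [n] covers
   [n = 0]. *)
pose dl := eps / 2 / n.+1%:R; have dl0 : 0 < dl by rewrite divr_gt0.
have /choice[q qP] : forall k, exists r : rat, `|dot x (e k) - ratr r| < dl.
  move=> k; have [r] := @rat_in_itvoo R (dot x (e k) - dl) (dot x (e k) + dl) ltac:(lra).
  by rewrite in_itv/= => /andP[h1 h2]; exists r; rewrite ltr_distlC h1 h2.
exists (mkseq q n); rewrite /comb size_mkseq.
rewrite -(subrK (orth_proj dot e x n) x) -addrA (le_lt_trans (ler_normD _ _))//.
rewrite [ltRHS]splitr ltr_leD// /orth_proj -sumrB.
apply: (@le_trans _ _ (\sum_(0 <= k < n) dl)).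
  rewrite (le_trans (ler_norm_sum _ _ _))//; apply: ler_sum_nat => k kn.
  by rewrite -scalerBl normrZ (norm_orthonormal ip one) mulr1 nth_mkseq// ltW.
rewrite sumr_const_nat subn0 -[leLHS]mulr_natr /dl -mulrA ler_piMr ?(ltW e2)// mulrC.
by rewrite ler_pdivrMr// mul1r ler_nat.
Qed.

(* Pettis: the Borel sigma-algebra of H is generated by the countably many balls
   centred at rational combinations of the basis. *)
Theorem pettis I g : measurable I ->
  (forall j, measurable_fun I (fun t => dot (g t) (e j))) ->
  measurable_fun I (g : R -> g_sigma_algebraType (@open H)).
Proof.
move=> mI mg; apply: (@measurability _ _ _ (g_sigma_algebraType (@open H)) I g (@open H)) => //.
move=> _ [U oU <-].
pose B (p : seq rat * nat) := ball (comb p.1) (p.2.+1%:R^-1 : R).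
have -> : U = \bigcup_(p : seq rat * nat) (if `[< B p `<=` U >] then B p else set0).
  apply/seteqP; split => [x Ux|x [p _]]; last first.
    by case: ifPn => // /asboolP; exact.
  have /nbhs_ballP[eps /= eps0 xU] : nbhs x U by exact: open_nbhs_nbhs.
  have /ltr_add_invr[k] : 0 < eps / 2 by rewrite divr_gt0.
  rewrite add0r => ke; have k0 : 0 < k.+1%:R^-1 :> R by rewrite invr_gt0.
  have [q xq] := comb_dense x k0.
  exists (q, k) => //; case: ifPn => [_|/asboolP[]]; first by rewrite /B -ball_normE/= distrC.
  move=> y; rewrite /B -ball_normE/= => qy; apply: xU; rewrite -ball_normE/=.
  rewrite -(subrK (comb q) x) -addrA (le_lt_trans (ler_normD _ _))//.
  by rewrite [ltRHS]splitr ltrD// ?(lt_trans xq)// (lt_trans qy).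
rewrite preimage_bigcup setI_bigcupr.
apply: countable_bigcupT_measurable => [|p]; first exact: countableP.
case: ifPn => _; last first.
  by rewrite preimage_set0 setI0.
pose rho : R := p.2.+1%:R^-1; have rho0 : 0 < rho by rewrite invr_gt0.
have mh : measurable_fun I (fun t => `|g t - comb p.1| ^+ 2).
  apply: measurable_sqr_norm_coord => // j.
  by under eq_fun do rewrite (ipBl ip); apply: measurable_funB.
have -> : I `&` g @^-1` B p = I `&` (fun t => `|g t - comb p.1| ^+ 2) @^-1` `]-oo, rho ^+ 2[%classic.
  apply/seteqP; split => t [It] /=; rewrite /B -ball_normE/= in_itv/= distrC => h; split => //.
    by rewrite ltr_pXn2r ?nnegrE// ltW.
  by move: h; rewrite ltr_pXn2r ?nnegrE// ?ltW.
by apply: mh => //; exact: measurable_itv.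
Qed.

Lemma integral_sqr_norm_coord I g : measurable I ->
  measurable_fun I (g : R -> g_sigma_algebraType (@open H)) ->
  (\int[leb]_(t in I) (`|g t| ^+ 2)%:E =
   \sum_(0 <= j <oo) \int[leb]_(t in I) (dot (g t) (e j) ^+ 2)%:E)%E.
Proof.
move=> mI mg; under eq_integral do rewrite -(parseval_ereal ip onb).
rewrite integral_nneseries// => j.
  by apply/measurable_EFinP; apply: measurable_funX; exact: measurable_coord.
by move=> t _; rewrite lee_fin sqr_ge0.
Qed.

Lemma integrable_sqr_L2time I g : measurable I -> L2time I g ->
  leb.-integrable I (fun t => (`|g t| ^+ 2)%:E).
Proof.
move=> mI [mg gi]; apply/integrableP; split.
  by apply/measurable_EFinP; apply: measurable_funX; exact: measurable_normL2.
by under eq_integral do rewrite gee0_abs ?lee_fin ?sqr_ge0//.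
Qed.

Lemma L2timeP I g : measurable I ->
  (forall j, measurable_fun I (fun t => dot (g t) (e j))) ->
  leb.-integrable I (fun t => (`|g t| ^+ 2)%:E) -> L2time I g.
Proof.
move=> mI mg gi; split; first exact: pettis.
have /integrableP[_] := gi; by under eq_integral do rewrite gee0_abs ?lee_fin ?sqr_ge0//.
Qed.

Lemma L2timeD I p q : measurable I -> L2time I p -> L2time I q -> L2time I (fun t => p t + q t).
Proof.
move=> mI pI qI; have [mp _] := pI; have [mq _] := qI.
have mpq : measurable_fun I ((fun t => p t + q t) : R -> g_sigma_algebraType (@open H)).
  apply: pettis => // j; under eq_fun do rewrite (ipDl ip).
  by apply: measurable_funD; exact: measurable_coord.
apply: L2timeP => // [j|]; first exact: measurable_coord.
have h1 := integrable_scaleR 2 (integrable_sqr_L2time mI pI) mI.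
have h2 := integrable_scaleR 2 (integrable_sqr_L2time mI qI) mI.
apply: (le_integrableR (integrable_addR h1 h2 mI)) => //.
  by apply: measurable_funX; exact: measurable_normL2.
by move=> t _; rewrite ger0_norm ?sqr_ge0//; exact: (ip_sqr_le2 ip).
Qed.

Lemma L2timeZ I p c : measurable I -> L2time I p -> L2time I (fun t => c *: p t).
Proof.
move=> mI pI; have [mp _] := pI; apply: L2timeP => // [j|].
  under eq_fun do rewrite (ipZl ip).
  by apply: measurable_funM => //; exact: measurable_coord.
have := integrable_scaleR (`|c| ^+ 2) (integrable_sqr_L2time mI pI) mI.
by apply: eq_integrable => // t _; rewrite normrZ exprMn.
Qed.

Lemma L2timeB I p q : measurable I -> L2time I p -> L2time I q -> L2time I (fun t => p t - q t).
Proof.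
move=> mI pI qI; have := L2timeD mI pI (L2timeZ (-1) mI qI).
by congr L2time; apply/funext => t; rewrite scaleN1r.
Qed.

Lemma L2timeS I J p : measurable I -> measurable J -> J `<=` I -> L2time I p -> L2time J p.
Proof.
move=> mI mJ JI [mp pi]; have mpJ := measurable_funS mI JI mp; split => //.
apply: le_lt_trans pi; apply: ge0_subset_integral => //.
by apply/measurable_EFinP; apply: measurable_funX; exact: measurable_normL2.
Qed.

Let mul_le_sqrD (x y : R) : 0 <= x -> 0 <= y -> x * y <= x ^+ 2 + y ^+ 2.
Proof.
move=> x0 y0; have := sqr_ge0 (x - y); have := mulr_ge0 x0 y0.
by rewrite sqrrB mulr2n; lra.
Qed.

Lemma integrable_ip I p q : measurable I -> L2time I p -> L2time I q ->
  leb.-integrable I (fun t => (dot (p t) (q t))%:E).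
Proof.
move=> mI pI qI; have [mp _] := pI; have [mq _] := qI.
apply: (le_integrableR (integrable_addR (integrable_sqr_L2time mI pI)
  (integrable_sqr_L2time mI qI) mI)) => //.
  apply: (measurable_fun_cvg
    (h := fun n t => \sum_(0 <= k < n) dot (p t) (e k) * dot (q t) (e k))) => [n|t _].
    by apply: measurable_sum => k; apply: measurable_funM; exact: measurable_coord.
  exact: (parseval ip onb).
move=> t _; rewrite (le_trans (ip_CS ip _ _))//.
exact: mul_le_sqrD.
Qed.

Lemma integrable_coord_mul I p q k : measurable I -> L2time I p -> L2time I q ->
  leb.-integrable I (fun t => (dot (p t) (e k) * dot (q t) (e k))%:E).
Proof.
move=> mI pI qI; have [mp _] := pI; have [mq _] := qI.
apply: (le_integrableR (integrable_addR (integrable_sqr_L2time mI pI)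
  (integrable_sqr_L2time mI qI) mI)) => //.
  by apply: measurable_funM; exact: measurable_coord.
have c1 (u : H) : `|dot u (e k)| <= `|u|.
  by rewrite (le_trans (ip_CS ip _ _))// (norm_orthonormal ip one) mulr1.
move=> t _; rewrite normrM (le_trans _ (mul_le_sqrD _ _))//.
exact: ler_pM.
Qed.

(** A partial sum is [<P_n (p t), q t>], hence at most [|p t| |q t|]: this bound, uniform in [n],
    permits dominated convergence. It carries identities for single modes over to the weak
    formulation. *)
Lemma parseval_integral I p q : measurable I -> L2time I p -> L2time I q ->
  \sum_(0 <= k < n) \int[leb]_(t in I) (dot (p t) (e k) * dot (q t) (e k))
    @[n --> \oo] --> \int[leb]_(t in I) dot (p t) (q t).
Proof.
move=> mI pI qI; have [mp _] := pI; have [mq _] := qI.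
have bnd n t : `|\sum_(0 <= k < n) dot (p t) (e k) * dot (q t) (e k)| <=
    `|p t| ^+ 2 + `|q t| ^+ 2.
  have -> : \sum_(0 <= k < n) dot (p t) (e k) * dot (q t) (e k) =
      dot (orth_proj dot e (p t) n) (q t).
    by rewrite /orth_proj (ip_suml ip); apply: eq_bigr => k _; rewrite (ipZl ip) (ipC ip (q t)).
  rewrite (le_trans (ip_CS ip _ _))//.
  have np : `|orth_proj dot e (p t) n| <= `|p t|.
    rewrite -(@ler_pXn2r _ 2)// ?nnegrE// (sqr_norm_comb ip one).
    exact: (bessel ip one).
  by rewrite (le_trans _ (mul_le_sqrD _ _))// ler_wpM2r.
have pqi k := integrable_coord_mul k mI pI qI.
have sumi n := Rintegral_sum n pqi mI.
have [||||||gi _ h] := @dominated_convergence _ _ _ leb I _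
  (fun n t => (\sum_(0 <= k < n) dot (p t) (e k) * dot (q t) (e k))%:E)
  (fun t => (dot (p t) (q t))%:E) (fun t => (`|p t| ^+ 2 + `|q t| ^+ 2)%:E).
- exact: mI.
- by move=> n; exact: measurable_int (sumi n).1.
- exact: measurable_int (integrable_ip mI pI qI).
- apply: aeW => t _; apply/fine_cvgP; split; first exact: nearW.
  exact: (parseval ip onb).
- exact: (integrable_addR (integrable_sqr_L2time mI pI) (integrable_sqr_L2time mI qI) mI).
- by apply: aeW => t n _; rewrite lee_fin.
rewrite (_ : (fun n => _) = (fun n => fine (\int[leb]_(t in I)
   (\sum_(0 <= k < n) dot (p t) (e k) * dot (q t) (e k))%:E)%E)); last first.
  by apply/funext => n; rewrite -(sumi n).2.
apply: fine_cvg; rewrite fineK; first exact: h.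
exact: integrable_fin_num gi.
Qed.

End basis.
End time_dependent.

(** * Continuity of translations in L2 *)

(** Convergence to 0 for nonnegative extended reals, kept as an upper bound so that it passes to
    smaller sequences without finiteness conditions. *)
Definition eventually_small (R : realType) (u : nat -> \bar R) :=
  forall eps : R, 0 < eps -> \forall k \near \oo, (u k <= eps%:E)%E.

Section eventually_small.
Context (R : realType).
Implicit Types u v : nat -> \bar R.

Lemma cvg0_small u : u @ \oo --> 0%E -> eventually_small u.
Proof.
move=> /fine_cvgP[fu /cvgrPdist_le cu] eps eps0.
have := cu _ eps0; apply: filterS2 fu => k fk.
rewrite sub0r normrN => h; rewrite -(fineK fk) lee_fin.
exact: le_trans (ler_norm _) h.
Qed.

Lemma le_small u v : (forall k, (u k <= v k)%E) -> eventually_small v -> eventually_small u.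
Proof. by move=> uv sv eps eps0; apply: filterS (sv _ eps0) => k; exact: le_trans. Qed.

Lemma smallD u v : eventually_small u -> eventually_small v ->
  eventually_small (fun k => u k + v k)%E.
Proof.
move=> su sv eps eps0; have e2 : 0 < eps / 2 by rewrite divr_gt0.
apply: filterS2 (su _ e2) (sv _ e2) => k uk vk.
by rewrite [eps]splitr EFinD; exact: leeD.
Qed.

Lemma smallZ u (c : R) : 0 <= c -> eventually_small u -> eventually_small (fun k => c%:E * u k)%E.
Proof.
move=> c0 su eps eps0; have e2 : 0 < eps / (c + 1) by rewrite divr_gt0// ltr_wpDl.
apply: filterS (su _ e2) => k uk.
apply: (@le_trans _ _ (c%:E * (eps / (c + 1))%:E)%E); first by rewrite lee_wpmul2l// lee_fin.
rewrite -EFinM lee_fin mulrCA ger_pMr// ler_pdivrMr ?ltr_wpDl// mul1r.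
by rewrite lerDl.
Qed.

(* It suffices to be small up to an error that can be prescribed in advance. *)
Lemma small_approx u : (forall eps : R, 0 < eps -> exists2 v, eventually_small v &
  forall k, (u k <= eps%:E + v k)%E) -> eventually_small u.
Proof.
move=> h eps eps0; have e2 : 0 < eps / 2 by rewrite divr_gt0.
have [v sv uv] := h _ e2; apply: filterS (sv _ e2) => k vk.
by rewrite (le_trans (uv k))// [X in (_ <= X%:E)%E]splitr EFinD leeD.
Qed.

Lemma small_sum (u : nat -> nat -> \bar R) N : (forall j, eventually_small (u j)) ->
  eventually_small (fun k => \sum_(0 <= j < N) u j k)%E.
Proof.
move=> su; elim: N => [|N ih].
  move=> eps eps0; apply: nearW => k; rewrite big_geq//.
  by rewrite lee_fin ltW.
have := smallD ih (su N); apply: le_small => k.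
by rewrite big_nat_recr.
Qed.

End eventually_small.

Section translation.
Context (R : realType).
Notation leb := (@lebesgue_measure R).
Local Open Scope ereal_scope.

Lemma measurable_shift (h : R) : measurable_fun setT (fun s : R => s + h)%R.
Proof. exact: measurable_funD. Qed.

Lemma lebesgue_measure_shift (h : R) (A : set R) : measurable A ->
  pushforward leb ((fun s => s + h)%R : _ -> measurableTypeR R) A = leb A.
Proof.
move=> mA; apply/esym/lebesgue_measure_unique => //=.
  exact: measurable_shift.
move=> _ _ [[a b]] _ <-.
rewrite /pushforward.
have -> : (fun s => s + h)%R @^-1` `]a, b] = `](a - h)%R, (b - h)%R]%classic.
  by apply/seteqP; split => s /=; rewrite !in_itv/= ltrBlDr lerBrDr.
rewrite !lebesgue_measure_itv/= !lte_fin ltrD2r.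
by case: ifPn => // _; rewrite -!EFinD; congr EFin; lra.
Qed.

Lemma ge0_integral_shift (h : R) (f : R -> \bar R) : measurable_fun setT f ->
  (forall s, 0 <= f s) -> \int[leb]_s f (s + h)%R = \int[leb]_s f s.
Proof.
move=> mf f0; have mh := measurable_shift h.
rewrite -[RHS](@eq_measure_integral _ _ _ _ _
  (pushforward leb ((fun s => s + h)%R : _ -> measurableTypeR R))); last first.
  by move=> A mA _; exact: lebesgue_measure_shift.
by rewrite ge0_integral_pushforward.
Qed.

Lemma measurable_sublevel (f : R -> R) (c : R) : measurable_fun setT f ->
  measurable [set s | (f s <= c)%R].
Proof.
move=> mf; rewrite (_ : [set _ | _] = setT `&` f @^-1` `]-oo, c]); first exact: mf.
by apply/seteqP; split => s /=; rewrite in_itv//= => -[].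
Qed.

Variable h : nat -> R.
Hypothesis h1 : forall k, (`|h k| <= 1)%R.
Hypothesis h0 : h @ \oo --> (0%R : R).

Let measurable_comp_shift (f : R -> R) k : measurable_fun setT f ->
  measurable_fun setT (fun s : R => f (s + h k)%R).
Proof. by move=> mf; exact: measurableT_comp mf (measurable_shift _). Qed.

(** Stated in L1, where [f] is approximated by continuous functions; boundedness makes the step to
    L2 possible in [translation_L2]. *)
Lemma translation_bounded (f : R -> R) (C K : R) : measurable_fun setT f ->
  (forall s, `|f s| <= C)%R -> (0 <= K)%R -> (forall s, K < `|s| -> f s = 0)%R ->
  eventually_small (fun k => \int[leb]_s (`|f (s + h k) - f s|%:E)).
Proof.
move=> mf fC K0 fK.
(* As [|h k| <= 1], a point of [E'] and its translate both lie in [E], and for a point outside [E']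
   both lie where [f] vanishes. *)
pose E : set R := `[(- (K + 2))%R, (K + 2)%R]%classic.
pose E' : set R := `[(- (K + 1))%R, (K + 1)%R]%classic.
have EP s : E s <-> (`|s| <= K + 2)%R by rewrite /E/= in_itv/= ler_norml.
have E'P s : E' s <-> (`|s| <= K + 1)%R by rewrite /E'/= in_itv/= ler_norml.
have mE : measurable E by exact: measurable_itv.
have mE' : measurable E' by exact: measurable_itv.
have fiE : leb.-integrable E (EFin \o f).
  apply: (@integrable_bounded _ _ _ _ _ _ C) => //; first exact: lebesgue_itvcc_lty.
  exact: measurable_funTS.
have [g_ [cg gi gf]] := approximation_continuous_integrable mE (lebesgue_itvcc_lty _ _) fiE.
apply: small_approx => eps eps0.
have e2 : (0 < eps / 2)%R by rewrite divr_gt0.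
have [n _ /(_ n (leqnn n)) fgn] := cvg0_small gf e2.
pose g := g_ n; have mg : measurable_fun setT g by exact: continuous_measurable_fun (cg n).
exists (fun k => \int[leb]_(s in E') `|g (s + h k) - g s|%:E); last first.
  move=> k; pose P s := (((fun s => `|f s - g s|%R) \_ E) s)%:E.
  have P0 s : 0 <= P s by rewrite lee_fin patchE; case: ifPn.
  have mP : measurable_fun setT P.
    apply/measurable_EFinP; apply/(measurable_restrictT _ _).1 => //.
    by apply: measurable_funTS; apply: measurableT_comp => //; exact: measurable_funB.
  have intP : \int[leb]_s P s <= (eps / 2)%:E.
    apply: le_trans fgn; rewrite [leRHS]integral_mkcond le_eqVlt; apply/orP; left; apply/eqP.
    by apply: eq_integral => s _; rewrite /P !patchE; case: ifPn.
  pose Q s := ((fun s => `|g (s + h k) - g s|%:E) \_ E') s.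
  have Q0 s : 0 <= Q s by rewrite /Q patchE; case: ifPn.
  have mQ : measurable_fun setT Q.
    apply/(measurable_restrictT _ _).1 => //; apply: measurable_funTS.
    apply/measurable_EFinP; apply: measurableT_comp => //; apply: measurable_funB => //.
    exact: measurable_comp_shift.
  apply: (@le_trans _ _ (\int[leb]_s (P (s + h k)%R + P s + Q s))).
    apply: ge0_le_integral => //.
    - apply/measurable_EFinP; apply: measurableT_comp => //; apply: measurable_funB => //.
      exact: measurable_comp_shift.
    - apply: emeasurable_funD => //; apply: emeasurable_funD => //.
      exact: (measurableT_comp mP (measurable_shift _)).
    - move=> s _; have hk := h1 k.
      have tri := ler_normD s (h k); have tri2 := ler_normB (s + h k)%R (h k).
      rewrite addrK in tri2.
      have [sE'|sE'] := pselect (E' s).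
        have sE : E s by apply/EP; move/E'P : sE'; lra.
        have shE : E (s + h k)%R by apply/EP; move/E'P : sE'; lra.
        rewrite /P /Q !patchE !mem_set// -!EFinD lee_fin.
        have -> : (f (s + h k) - f s = (f (s + h k) - g (s + h k)) +
          (g (s + h k) - g s) - (f s - g s))%R by ring.
        rewrite (le_trans (ler_normB _ _))// [leRHS]addrAC lerD2r.
        exact: ler_normD.
      rewrite fK; last first.
        by rewrite ltNge; apply/negP => a; apply: sE'; apply/E'P; lra.
      rewrite fK; last first.
        by rewrite ltNge; apply/negP => a; apply: sE'; apply/E'P; lra.
      by rewrite subrr normr0 !adde_ge0.
  rewrite ge0_integralD//; last 2 first.
  - by move=> s _; rewrite adde_ge0.
  - by apply: emeasurable_funD => //; exact: (measurableT_comp mP (measurable_shift _)).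
  rewrite ge0_integralD//; last exact: (measurableT_comp mP (measurable_shift _)).
  rewrite ge0_integral_shift//; apply: leeD.
    by rewrite [X in _ <= X%:E]splitr EFinD leeD.
  by rewrite [leRHS]integral_mkcond.
have cE : compact E by exact: segment_compact.
have [B BP] : exists B, forall s, E s -> (`|g s| <= B)%R.
  have : compact (g @` E).
    by apply: continuous_compact => //; apply: continuous_subspaceT => s; exact: cg.
  move=> /compact_bounded[M [_ MP]]; exists (M + 1)%R => s Es.
  by apply: (MP (M + 1)%R); [rewrite ltrDl|exists s].
apply: cvg0_small.
have [|||||_ _] := @dominated_convergence _ _ _ leb E' mE'
  (fun k s => `|g (s + h k) - g s|%:E) (cst 0) (fun s => (B + B)%:E).
- move=> k; apply/measurable_EFinP; apply: measurable_funTS; apply: measurableT_comp => //.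
  apply: measurable_funB => //; exact: measurable_comp_shift.
- exact: measurable_cst.
- apply: aeW => s _; apply/fine_cvgP; split; first exact: nearW.
  rewrite -(@normr0 _ R) -(subrr (g s)); apply: cvg_norm; apply: cvgB; last exact: cvg_cst.
  have sh : (s + h k)%R @[k --> \oo] --> (s : R).
    by rewrite -[X in _ --> X]addr0; apply: cvgD => //; exact: cvg_cst.
  exact: (cvg_comp _ _ sh (cg n s)).
- apply: (@integrable_bounded _ _ _ _ _ _ `|B + B|%R) => //; exact: lebesgue_itvcc_lty.
- apply: aeW => s k /E'P sE'; rewrite /= lee_fin normr_id.
  have tri := ler_normD s (h k); have hk := h1 k.
  rewrite (le_trans (ler_normB _ _))// lerD//; apply: BP; apply/EP; lra.
by rewrite integral0.
Qed.

(** [F n] cuts [f] in support and in height. For the cut function [z = F n (s + h) - F n s]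
    satisfies [z^2 <= 2 n |z|], which reduces L2 to L1. *)
Lemma translation_L2 (f : R -> R) : measurable_fun setT f ->
  \int[leb]_s (f s ^+ 2)%:E < +oo ->
  eventually_small (fun k => \int[leb]_s ((f (s + h k) - f s) ^+ 2)%:E).
Proof.
move=> mf fi.
pose A n := [set s : R | `|s| <= n%:R]%R `&` [set s | `|f s| <= n%:R]%R.
have mA n : measurable (A n).
  by apply: measurableI; apply: measurable_sublevel => //; exact: measurableT_comp.
pose F n := f \_ (A n).
have mF n : measurable_fun setT (F n).
  by apply/(measurable_restrictT _ _).1 => //; exact: measurable_funTS.
have FS : eventually_small (fun n => \int[leb]_s ((f s - F n s) ^+ 2)%:E).
  apply: cvg0_small.
  have [|||||_ _] := @dominated_convergence _ _ _ leb setT measurableT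
    (fun n s => ((f s - F n s) ^+ 2)%:E) (cst 0) (fun s => (f s ^+ 2)%:E).
  - by move=> n; apply/measurable_EFinP; apply: measurable_funX; exact: measurable_funB mf (mF n).
  - exact: measurable_cst.
  - apply: aeW => s _; apply: cvg_near_cst.
    near=> n; rewrite /F patchE mem_set ?subrr ?expr0n//.
    split => /=.
      by near: n; exact: nbhs_infty_ger.
    by near: n; exact: nbhs_infty_ger.
  - apply/integrableP; split; first by apply/measurable_EFinP; exact: measurable_funX.
    by under eq_integral do rewrite gee0_abs ?lee_fin ?sqr_ge0//.
  - apply: aeW => s n _; rewrite gee0_abs ?lee_fin ?sqr_ge0//.
    rewrite /F patchE; case: ifPn => _; last by rewrite subr0.
    by rewrite subrr expr0n sqr_ge0.
  by rewrite integral0.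
apply: small_approx => eps eps0.
(* From [(x - y + z)^2 <= 3 (x^2 + y^2 + z^2)]: the terms [x] and [y] contribute
   [3 (eps / 6 + eps / 6) = eps], and [z] the factor [6 n = 3 * 2 n]. *)
have e6 : (0 < eps / 6)%R by rewrite divr_gt0.
have [n _ /(_ n (leqnn n)) Fn] := FS _ e6.
pose G s := ((f s - F n s) ^+ 2)%:E.
have G0 s : 0 <= G s by rewrite lee_fin sqr_ge0.
have mG : measurable_fun setT G.
  by apply/measurable_EFinP; apply: measurable_funX; exact: measurable_funB.
have FB s : (`|F n s| <= n%:R)%R.
  by rewrite /F patchE; case: ifPn => [/set_mem[]//|]; rewrite normr0.
pose U k := \int[leb]_s `|F n (s + h k) - F n s|%:E.
have mU k : measurable_fun setT (fun s : R => `|F n (s + h k) - F n s|%:E).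
  apply/measurable_EFinP; apply: measurableT_comp => //; apply: measurable_funB => //.
  exact: measurable_comp_shift.
exists (fun k => (6 * n%:R)%:E * U k).
  apply: smallZ; first by rewrite mulr_ge0.
  apply: (@translation_bounded _ n%:R n%:R) => // s ns.
  by rewrite /F patchE memNset// => -[/=]; rewrite leNgt ns.
move=> k.
apply: (@le_trans _ _ (\int[leb]_s (3%:E * (G (s + h k)%R + G s) +
   (6 * n%:R)%:E * `|F n (s + h k) - F n s|%:E))).
  apply: ge0_le_integral => //.
  - by move=> s _; rewrite lee_fin sqr_ge0.
  - apply/measurable_EFinP; apply: measurable_funX; apply: measurable_funB => //.
    exact: measurable_comp_shift.
  - apply: emeasurable_funD; last exact: (measurable_funeM _ (mU k)).
    apply: measurable_funeM; apply: emeasurable_funD => //.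
    exact: (measurableT_comp mG (measurable_shift _)).
  - move=> s _; rewrite -[leRHS]/((3 * ((f (s + h k) - F n (s + h k)) ^+ 2 + (f s - F n s) ^+ 2) +
      6 * n%:R * `|F n (s + h k) - F n s|)%R%:E) lee_fin.
    set x := (f (s + h k) - F n (s + h k))%R; set y := (f s - F n s)%R.
    have -> : (f (s + h k) - f s = x - y + (F n (s + h k) - F n s))%R by rewrite /x /y; ring.
    set z := (F n (s + h k) - F n s)%R.
    have zn : (`|z| <= 2 * n%:R)%R.
      by rewrite (le_trans (ler_normB _ _))//; have := FB s; have := FB (s + h k)%R; lra.
    have z2 : (z ^+ 2 <= 2 * n%:R * `|z|)%R.
      by rewrite -real_normK ?num_real// expr2 ler_wpM2r.
    have a1 := sqr_ge0 (x + y); have a2 := sqr_ge0 (x - z); have a3 := sqr_ge0 (y + z).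
    by move: a1 a2 a3 z2; rewrite !expr2; lra.
have mGG : measurable_fun setT (fun s : R => 3%:E * (G (s + h k)%R + G s)).
  apply: measurable_funeM; apply: emeasurable_funD => //.
  exact: (measurableT_comp mG (measurable_shift _)).
have GG0 (s : R) : 0 <= 3%:E * (G (s + h k)%R + G s) by rewrite mule_ge0// adde_ge0.
have mUn := measurable_funeM (6 * n%:R)%:E (mU k).
have U0 (s : R) : 0 <= (6 * n%:R)%:E * `|F n (s + h k) - F n s|%:E.
  by rewrite mule_ge0// lee_fin mulr_ge0.
rewrite ge0_integralD//.
apply: leeD; last first.
  by rewrite ge0_integralZl//; exact: mU k.
rewrite ge0_integralZl//; last 2 first.
- apply: emeasurable_funD => //; exact: (measurableT_comp mG (measurable_shift _)).
- by move=> s _; rewrite adde_ge0.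
rewrite ge0_integralD//; last exact: (measurableT_comp mG (measurable_shift _)).
rewrite ge0_integral_shift//.
apply: (@le_trans _ _ (3%:E * ((eps / 6)%:E + (eps / 6)%:E))).
  by rewrite lee_wpmul2l// leeD.
by rewrite -EFinD -EFinM lee_fin; lra.
Unshelve. all: by end_near. Qed.

Context d (T : measurableType d) (mu : {measure set T -> \bar R}) (e : (L2 mu) ^nat).
Hypothesis onb : orthonormal_basis (@L2dot d T R mu) e.

(** By Parseval the integral is a series over the modes. Each term is small by the scalar case, and
    term [j] is at most [4 b j], a summable bound independent of [k]; so finitely many modes
    suffice. *)
Theorem L2time_translation (w : R -> L2 mu) : L2time setT w ->
  eventually_small (fun k => \int[leb]_s (`|w (s + h k) - w s| ^+ 2)%:E).
Proof.
move=> wI; have [mw wi] := wI; have ip := L2dot_inner_product mu.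
pose f j s := L2dot (w s) (e j).
have mf j : measurable_fun setT (f j) by exact: measurable_coord.
pose b j := \int[leb]_s (f j s ^+ 2)%:E.
have b0 j : 0 <= b j by apply: integral_ge0 => s _; rewrite lee_fin sqr_ge0.
have bE : \int[leb]_s (`|w s| ^+ 2)%:E = \sum_(0 <= j <oo) b j.
  exact: integral_sqr_norm_coord.
have boo j : b j < +oo.
  apply: le_lt_trans wi; rewrite bE (le_trans _ (nneseries_lim_ge j.+1 _))//.
  by rewrite big_nat_recr//= leeDr// sume_ge0.
pose a j k := \int[leb]_s ((f j (s + h k) - f j s) ^+ 2)%:E.
have a0 j k : 0 <= a j k by apply: integral_ge0 => s _; rewrite lee_fin sqr_ge0.
have aE k : \int[leb]_s (`|w (s + h k) - w s| ^+ 2)%:E = \sum_(0 <= j <oo) a j k.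
  have mg : measurable_fun setT
      ((fun s => w (s + h k)%R - w s)%R : R -> g_sigma_algebraType (@open (L2 mu))).
    apply: (pettis onb) => // j; under eq_fun do rewrite (ipBl ip).
    apply: measurable_funB; last exact: mf.
    exact: measurable_comp_shift (mf j).
  rewrite (integral_sqr_norm_coord onb measurableT mg).
  by apply: eq_eseriesr => j _; apply: eq_integral => s _; rewrite (ipBl ip).
have ab j k : a j k <= 4%:E * b j.
  apply: (@le_trans _ _ (\int[leb]_s (2%:E * ((f j (s + h k) ^+ 2)%:E + (f j s ^+ 2)%:E)))).
    apply: ge0_le_integral => //.
    - by move=> s _; rewrite lee_fin sqr_ge0.
    - apply/measurable_EFinP; apply: measurable_funX.
      by apply: measurable_funB; [exact: measurable_comp_shift (mf j)|exact: mf].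
    - apply: measurable_funeM; apply: emeasurable_funD; apply/measurable_EFinP;
        apply: measurable_funX; [exact: measurable_comp_shift (mf j)|exact: mf].
    - move=> s _; rewrite -EFinD -EFinM lee_fin.
      move: (f j (s + h k)%R) (f j s) => x y.
      by have := sqr_ge0 (x + y); rewrite !expr2; lra.
  have m2 : measurable_fun setT (fun s => (f j s ^+ 2)%:E).
    by apply/measurable_EFinP; apply: measurable_funX; exact: mf.
  have m3 : measurable_fun setT (fun s : R => (f j (s + h k) ^+ 2)%:E).
    by apply/measurable_EFinP; apply: measurable_funX; exact: measurable_comp_shift (mf j).
  rewrite ge0_integralZl//; last 2 first.
  - exact: emeasurable_funD.
  - by move=> s _; rewrite adde_ge0// lee_fin sqr_ge0.
  rewrite ge0_integralD//; try by move=> s _; rewrite lee_fin sqr_ge0.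
  rewrite (ge0_integral_shift _ m2)//; last by move=> s; rewrite lee_fin sqr_ge0.
  change (2%:E * (b j + b j) <= 4%:E * b j).
  rewrite -(@fineK _ (b j)); last by rewrite ge0_fin_numE// boo.
  by rewrite -EFinD -!EFinM lee_fin; lra.
apply: small_approx => eps eps0.
have e4 : (0 < eps / 4)%R by rewrite divr_gt0.
have := nneseries_tail_cvg (f := b) (P := xpredT).
rewrite -bE => /(_ wi (fun j _ => b0 j)) /cvg0_small /(_ _ e4) [N _ /(_ N (leqnn N)) bN].
exists (fun k => \sum_(0 <= j < N) a j k).
  by apply: small_sum => j; apply: translation_L2 => //; exact: boo.
move=> k; rewrite aE (nneseries_split 0 N)// add0n addeC leeD2r//.
apply: (@le_trans _ _ (\sum_(N <= j <oo) 4%:E * b j)).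
  by apply: lee_nneseries.
rewrite nneseriesZl//; apply: (@le_trans _ _ (4%:E * (eps / 4)%:E)).
  by rewrite lee_wpmul2l.
by rewrite -EFinM lee_fin; lra.
Qed.

End translation.

(** * The delay term *)

Lemma lipschitz_nbhs_continuous (R : realType) (b : R -> R) (w : R) (U : set R) :
  nbhs w U -> [lipschitz b y | y in U] -> {for w, continuous b}.
Proof.
move=> wU [M [_ bM]]; set K := `|M| + 1.
have K0 : 0 < K by rewrite ltr_wpDl.
have /bM bK : M < K by rewrite (le_lt_trans (ler_norm M))// ltrDl.
have wUw := nbhs_singleton wU.
apply/cvgrPdist_le => eps eps0.
have e0 : 0 < eps / K by rewrite divr_gt0.
have wE : nbhs w [set y | `|w - y| <= eps / K].
  by apply/nbhs_ballP; exists (eps / K) => //= y /ltW.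
change (nbhs w [set y | `|b w - b y| <= eps]).
apply: filterS2 wU wE => y Uy wy.
by apply: (le_trans (bK (w, y) (conj wUw Uy))); rewrite /= mulrC -ler_pdivlMr.
Qed.

(** * Measurability of maps into R^n and of parameter integrals *)

Section measurable_rV.
Context (R : realType).

Lemma measurable_rV_coord n (i : 'I_n) :
  measurable_fun setT (fun v : 'rV[R]_n => v ord0 i).
Proof.
apply: (measurability _ (RGenOpens.measurableE R)).
move=> _ [_ [a [b ->] <-]]; rewrite setTI; apply: measurable_open_rV.
by apply: open_comp => [v _|]; [exact: coord_continuous|exact: interval_open].
Qed.

Lemma measurable_rVP d (T : measurableType d) n (g : T -> 'rV[R]_n) :
  (forall i, measurable_fun setT (fun t => g t ord0 i)) -> measurable_fun setT g.
Proof.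
elim: n g => [|n ih] g mg.
  have -> : g = cst 0 by apply/funext => t; apply/rowP => -[].
  exact: measurable_cst.
have -> : g = @cons_rV R n \o (fun t => uncons_rV (g t)).
  by apply/funext => t /=; rewrite uncons_rVK.
apply: measurableT_comp; first exact: measurable_cons_rV.
apply/measurable_fun_pairP; split => /=; first exact: mg.
by apply: ih => i /=; under eq_fun do rewrite mxE; exact: mg.
Qed.

Lemma measurable_rVB d (T : measurableType d) n (g h : T -> 'rV[R]_n) :
  measurable_fun setT g -> measurable_fun setT h ->
  measurable_fun setT (fun t => g t - h t).
Proof.
move=> mg mh; apply: measurable_rVP => i.
under eq_fun do rewrite mxE [in X in _ + X]mxE.
apply: measurable_funB.
  exact: (measurableT_comp (measurable_rV_coord i) mg).
exact: (measurableT_comp (measurable_rV_coord i) mh).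
Qed.

End measurable_rV.

(** Tonelli applied to the positive and the negative part; [fine] then turns the difference into a
    measurable real function, also where the integral is infinite. *)
Lemma measurable_Rintegral_param d1 d2 (X : measurableType d1) (Y : measurableType d2)
    (R : realType) (m : {sigma_finite_measure set Y -> \bar R}) (f : X * Y -> R) :
  measurable_fun setT f -> measurable_fun setT (fun x => \int[m]_y f (x, y)).
Proof.
move=> mf; apply: measurableT_comp; first exact: fine_measurable.
have mp : measurable_fun setT (fubini_F m (fun p => ((EFin \o f)^\+ p)%E)).
  apply: measurable_fun_fubini_tonelli_F => //.
  by apply: measurable_funepos; exact/measurable_EFinP.
have mn : measurable_fun setT (fubini_F m (fun p => ((EFin \o f)^\- p)%E)).
  apply: measurable_fun_fubini_tonelli_F => //.
  by apply: measurable_funeneg; exact/measurable_EFinP.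
have -> : (fun x => \int[m]_y (f (x, y))%:E)%E =
  (fun x => fubini_F m (fun p => ((EFin \o f)^\+ p)%E) x -
            fubini_F m (fun p => ((EFin \o f)^\- p)%E) x)%E.
  apply/funext => x; rewrite integralE.
  by congr (_ - _)%E; apply: eq_integral => y _; rewrite ?funeposE ?funenegE.
exact: emeasurable_funB.
Qed.

Section integral_mrestr.
Context d (T : measurableType d) (R : realType) (mu : {measure set T -> \bar R}).

Lemma Rintegral_mrestr (D : set T) (mD : measurable D) (f : T -> R) :
  measurable_fun setT f -> \int[mrestr mu mD]_x f x = \int[mu]_(x in D) f x.
Proof.
move=> /measurable_EFinP mf; congr fine; rewrite integralE [RHS]integralE.
congr (_ - _)%E; apply: ge0_integral_mrestr => //.
  exact: measurable_funepos.
exact: measurable_funeneg.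
Qed.

Lemma Rintegral_patch (D : set T) (f : T -> R) :
  \int[mu]_x (f \_ D) x = \int[mu]_(x in D) f x.
Proof.
by congr fine; rewrite [RHS]integral_mkcond; apply: eq_integral => x _; rewrite !patchE; case: ifPn.
Qed.

Hypothesis fin : (mu setT < +oo)%E.

Lemma toL2_bounded (f : T -> R) (C : R) : measurable_fun setT f ->
  (forall x, `|f x| <= C) -> (\int[mu]_x (f x ^+ 2)%:E < +oo)%E.
Proof.
move=> mf fC; have : mu.-integrable setT (fun x => (f x ^+ 2)%:E).
  apply: (@integrable_bounded _ _ _ _ _ _ (C ^+ 2)) => //; first exact: measurable_funX.
  move=> x _; rewrite normrX; have := fC x; have := normr_ge0 (f x) => h1 h2.
  by rewrite lerXn2r// nnegrE (le_trans h1).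
move=> /integrableP[_]; by under eq_integral do rewrite gee0_abs ?lee_fin ?sqr_ge0//.
Qed.

(** With [m] the total mass, [C^2 m <= (C (1 + m))^2]; the factor [1 + m] replaces the square root
    of [m]. *)
Lemma integral_sqr_bounded (f : T -> R) (C : R) : measurable_fun setT f -> 0 <= C ->
  (forall x, `|f x| <= C) ->
  (\int[mu]_x (f x ^+ 2)%:E <= ((C * (1 + fine (mu setT))) ^+ 2)%:E)%E.
Proof.
move=> mf C0 fC; set m := fine (mu setT).
have m0 : 0 <= m by rewrite fine_ge0.
apply: (@le_trans _ _ (\int[mu]_x (C ^+ 2)%:E)%E).
  apply: ge0_le_integral => //.
  - by move=> x _; rewrite lee_fin sqr_ge0.
  - by apply/measurable_EFinP; exact: measurable_funX.
  - by move=> x _; rewrite lee_fin -real_normK ?num_real// lerXn2r// nnegrE.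
rewrite integral_cst// -(@fineK _ (mu setT)) ?ge0_fin_numE// -/m -EFinM lee_fin.
rewrite exprMn ler_wpM2l ?sqr_ge0// sqrrD expr1n mul1r mulr2n.
by have := sqr_ge0 m; lra.
Qed.

Lemma norm_toL2 (f : T -> R) (C : R) : measurable_fun setT f -> 0 <= C ->
  (forall x, `|f x| <= C) -> `|toL2 mu f| <= C * (1 + fine (mu setT)).
Proof.
move=> mf C0 fC; have m0 : 0 <= fine (mu setT) by rewrite fine_ge0.
rewrite -(@ler_pXn2r _ 2)// ?nnegrE// ?mulr_ge0 ?addr_ge0// -lee_fin.
rewrite (sqr_norm_toL2 mf (toL2_bounded mf fC)).
exact: integral_sqr_bounded.
Qed.

Lemma dist_toL2 (f g : T -> R) (C M : R) : measurable_fun setT f -> measurable_fun setT g ->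
  (forall x, `|f x| <= M) -> (forall x, `|g x| <= M) -> 0 <= C ->
  (forall x, `|f x - g x| <= C) -> `|toL2 mu f - toL2 mu g| <= C * (1 + fine (mu setT)).
Proof.
move=> mf mg fM gM C0 fgC; have m0 : 0 <= fine (mu setT) by rewrite fine_ge0.
rewrite -(@ler_pXn2r _ 2)// ?nnegrE// ?mulr_ge0 ?addr_ge0// -lee_fin.
have mfg : measurable_fun setT (fun x => f x - g x) by exact: measurable_funB.
apply: le_trans (integral_sqr_bounded mfg C0 fgC).
rewrite -L2_sqr_dist le_eqVlt; apply/orP; left; apply/eqP; apply: ae_eq_integral => //.
- by apply/measurable_EFinP; apply: measurable_funX; apply: measurable_funB; exact: measurable_L2rep.
- by apply/measurable_EFinP; exact: measurable_funX.
- apply: filterS2 (toL2_rep mf (toL2_bounded mf fM)) (toL2_rep mg (toL2_bounded mg gM)).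
  by move=> x -> ->.
Qed.

End integral_mrestr.

(** A pointwise inequality whose integral shows that [u |-> b(u)] is continuous from L2 to L1. For
    [|x| > M] the term [eps x^2] exceeds [2 C]; for [|x| <= M] uniform continuity handles
    [|x - y| < rho], and [K (x - y)^2 >= 2 C] the rest. *)
Lemma nemytskii_bound (R : realType) (b : R -> R) (C eps : R) : continuous b ->
  (forall x, `|b x| <= C) -> 0 < eps ->
  exists2 K : R, 0 <= K & forall x y, `|b x - b y| <= eps + eps * x ^+ 2 + K * (x - y) ^+ 2.
Proof.
move=> cb bC eps0; have C0 : 0 <= C by exact: le_trans (bC 0).
(* Chosen so that [eps M >= 2 C], and at least 1 so that [M <= x^2] as soon as [|x| > M]. *)
pose M := 2 * C / eps + 1.
have M1 : 1 <= M by rewrite /M lerDr divr_ge0 ?mulr_ge0 ?(ltW eps0).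
have cM : compact `[- M, M] by exact: segment_compact.
(* The radius is made uniform over [x] in the compact interval, while [y] ranges over all of R. *)
have /compact_near_coveringP/(_ R (0 : R)^'+
  (fun dl x => forall y, `|x - y| < dl -> `|b x - b y| < eps)) := cM.
case=> [x _|dl0 /= dl00 dlP].
  have e2 : 0 < eps / 2 by rewrite divr_gt0.
  have /cvgrPdist_lt /(_ _ e2) /nbhs_ballP[rho /= rho0 xb] := cb x.
  have rho2 : 0 < rho / 2 by rewrite divr_gt0.
  exists (ball x (rho / 2), [set dl | dl < rho / 2]).
    by split; [exact: nbhsx_ballx|exact: nbhs_right_lt].
  move=> [z dl] /= [xz dlr] y zy; move: xz; rewrite /ball/= => xz.
  have h1 : `|b x - b z| < eps / 2 by apply: xb; rewrite /ball/=; lra.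
  have h2 : `|b x - b y| < eps / 2.
    apply: xb; rewrite /ball/= -(subrKA z) (le_lt_trans (ler_normD _ _))//; lra.
  have -> : b z - b y = (b x - b y) - (b x - b z) by ring.
  by rewrite (le_lt_trans (ler_normB _ _))//; lra.
have dl1 : `|0 - dl0 / 2| < dl0 by rewrite sub0r normrN gtr0_norm ?divr_gt0//; lra.
have {dlP}uc := dlP _ dl1 (divr_gt0 dl00 (ltr0Sn _ 1)).
pose rho := dl0 / 2; have rho0 : 0 < rho by rewrite divr_gt0.
exists (2 * C / rho ^+ 2) => [|x y]; first by rewrite !mulr_ge0 ?invr_ge0 ?sqr_ge0.
have bxy : `|b x - b y| <= 2 * C.
  by rewrite (le_trans (ler_normB _ _))//; have := bC x; have := bC y; lra.
have t1 : 0 <= eps * x ^+ 2 by rewrite mulr_ge0 ?sqr_ge0 ?(ltW eps0).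
have t2 : 0 <= 2 * C / rho ^+ 2 * (x - y) ^+ 2.
  by apply: mulr_ge0; [rewrite divr_ge0 ?sqr_ge0 ?mulr_ge0|exact: sqr_ge0].
have [xM|xM] := leP `|x| M.
  have [xyr|xyr] := ltP `|x - y| rho.
    have : `|b x - b y| < eps by apply: uc => //; rewrite /= in_itv/= -ler_norml.
    by lra.
  apply: (le_trans bxy); apply: (@le_trans _ _ (2 * C / rho ^+ 2 * (x - y) ^+ 2)); last by lra.
  rewrite mulrAC ler_pdivlMr ?exprn_gt0// ler_wpM2l ?mulr_ge0//.
  by rewrite -[leRHS]real_normK ?num_real// lerXn2r ?nnegrE ?(ltW rho0).
apply: (le_trans bxy); apply: (@le_trans _ _ (eps * x ^+ 2)); last by lra.
have Mx : M <= x ^+ 2.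
  rewrite -real_normK ?num_real// expr2 (le_trans (ltW xM))// ler_peMl//.
  by rewrite (le_trans M1)// ltW.
have : eps * M <= eps * x ^+ 2 by rewrite ler_pM2l.
by rewrite /M mulrDr mulrCA mulfV ?gt_eqF// !mulr1; lra.
Qed.

Lemma continuous_eps_delta (R : realType) (V : normedModType R) (F : V -> R) :
  (forall u eps, 0 < eps -> exists2 dl, 0 < dl &
    forall v, `|u - v| < dl -> `|F u - F v| <= eps) -> continuous F.
Proof.
move=> h u; apply/cvgrPdist_le => eps eps0; have [dl dl0 Fdl] := h u _ eps0.
by near=> v; apply: Fdl; near: v; exact: cvgr_dist_lt.
Unshelve. all: by end_near. Qed.

(** * The convolution factor of the delay term *)

Section convolution.
Context (R : realType) (n : nat) (Omega : smooth_bounded_domain R n).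
Notation mu := (lebesgue_on Omega).
Notation H := (L2 (lebesgue_on Omega)).
Notation dot := (@L2dot _ _ R (lebesgue_on Omega)).
Notation leb := (@lebesgue_measure R).
Variables (b : R -> R) (f : 'rV[R]_n -> R) (Cb Cf : R).
Hypothesis cb : continuous b.
Hypothesis bC : forall x, `|b x| <= Cb.
Hypothesis mf : measurable_fun (difference_set Omega) f.
Hypothesis fC : forall z, difference_set Omega z -> `|f z| <= Cf.
Let f0 := f \_ (difference_set Omega).
Let m := fine (mu setT).
Let ip := L2dot_inner_product mu.

(** A union of translates of an open set; it makes the extension [f0] of [f] by 0 measurable on
    R^n. *)
Lemma open_difference_set : open (difference_set Omega).
Proof.
rewrite openE => _ [x Ox [y Oy <-]].
have /nbhs_ballP[rho /= rho0 xO] : nbhs x Omega.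
  by apply: open_nbhs_nbhs; split => //; exact: dom_open.
apply/nbhs_ballP; exists rho => //= z; rewrite -ball_normE/= => xyz.
exists (z + y); last by exists y => //; rewrite addrK.
by apply: xO; rewrite -ball_normE/= opprD addrA addrAC.
Qed.

Let Cb0 : 0 <= Cb. Proof. exact: le_trans (bC 0). Qed.

Let m0 : 0 <= m. Proof. by rewrite fine_ge0. Qed.

Let Cf0 : 0 <= Cf.
Proof.
have [x Ox] := @dom_nonempty _ _ Omega.
by apply: le_trans (fC (z := x - x) _) => //; exists x => //; exists x.
Qed.

Let mf0 : measurable_fun setT f0.
Proof.
apply/(measurable_restrictT _ _).1 => //.
by apply: measurable_open_rV; exact: open_difference_set.
Qed.

Let f0C z : `|f0 z| <= Cf.
Proof. by rewrite /f0 patchE; case: ifPn => [/set_mem/fC//|_]; rewrite normr0. Qed.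

Let mb (g : 'rV[R]_n -> R) : measurable_fun setT g -> measurable_fun setT (fun y => b (g y)).
Proof. by move=> mg; apply: measurableT_comp mg; exact: continuous_measurable_fun. Qed.

Let mf0x x : measurable_fun setT (fun y : 'rV[R]_n => f0 (x - y)).
Proof. by apply: measurableT_comp mf0 _; apply: measurable_rVB. Qed.

(** The extension [f0] makes the kernel bounded and measurable for every [x], also outside Omega, as
    joint measurability in [x] and [t] requires; on Omega nothing changes by [convE]. *)
Definition conv (u : H) (x : 'rV[R]_n) : R := \int[mu]_y (b (L2rep u y) * f0 (x - y)).

Let mconv (u : H) (x : 'rV[R]_n) : measurable_fun setT (fun y : 'rV[R]_n => b (L2rep u y) * f0 (x - y)).
Proof. by apply: measurable_funM => //; apply: mb; exact: measurable_L2rep. Qed.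

Let convC (u : H) (x y : 'rV[R]_n) : `|b (L2rep u y) * f0 (x - y)| <= Cb * Cf.
Proof. by rewrite normrM ler_pM. Qed.

Let iconv (u : H) (x : 'rV[R]_n) : mu.-integrable setT (fun y : 'rV[R]_n => (b (L2rep u y) * f0 (x - y))%:E).
Proof. by apply: (@integrable_bounded _ _ _ _ _ _ (Cb * Cf)) => //; exact: lebesgue_on_fin. Qed.

Lemma conv_bound u x : `|conv u x| <= Cb * Cf * m.
Proof.
rewrite /conv /m; apply: Rintegral_le_cst => //; exact: lebesgue_on_fin.
Qed.

Lemma convE u x : (Omega : set _) x ->
  \int[lebesgue_rV R n]_(y in Omega) (b (L2rep u y) * f (x - y)) = conv u x.
Proof.
move=> Ox; rewrite /conv Rintegral_mrestr//; apply: eq_Rintegral => y /set_mem Oy.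
by rewrite /f0 patchE mem_set//; exists x => //; exists y.
Qed.

(** The integrated form of [nemytskii_bound]. Uniformity in [x] turns it into an estimate of the L2
    norm over Omega. *)
Lemma conv_close eps : 0 < eps -> exists2 K, 0 <= K & forall u v x,
  `|conv u x - conv v x| <= Cf * (eps * m + eps * `|u| ^+ 2 + K * `|u - v| ^+ 2).
Proof.
move=> eps0; have [K K0 bK] := nemytskii_bound cb bC eps0; exists K => // u v x.
rewrite /conv -RintegralB; [|by []|exact: iconv|exact: iconv].
pose B y := Cf * (eps + eps * L2rep u y ^+ 2 + K * (L2rep u y - L2rep v y) ^+ 2).
have ic : mu.-integrable setT (fun=> eps%:E).
  apply: (@integrable_bounded _ _ _ _ _ (fun=> eps) eps) => //; first exact: lebesgue_on_fin.
  by move=> y _; rewrite gtr0_norm.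
have i1 : mu.-integrable setT (fun y => (eps * L2rep u y ^+ 2)%:E).
  by apply: integrable_scaleR => //; exact: integrable_L2rep_sqr.
have i2' : mu.-integrable setT (fun y => ((L2rep u y - L2rep v y) ^+ 2)%:E).
  apply/integrableP; split.
    by apply/measurable_EFinP; apply: measurable_funX; apply: measurable_funB; exact: measurable_L2rep.
  under eq_integral do rewrite gee0_abs ?lee_fin ?sqr_ge0//.
  by rewrite L2_sqr_dist ltry.
have i2 : mu.-integrable setT (fun y => (K * (L2rep u y - L2rep v y) ^+ 2)%:E).
  exact: integrable_scaleR.
have i3 := integrable_addR ic i1 measurableT.
have i4 := integrable_addR i3 i2 measurableT.
have iB : mu.-integrable setT (fun y => (B y)%:E) by exact: integrable_scaleR i4 _.
have <- : \int[mu]_y B y = Cf * (eps * m + eps * `|u| ^+ 2 + K * `|u - v| ^+ 2).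
  rewrite /B RintegralZl// !RintegralD// !RintegralZl//; last exact: integrable_L2rep_sqr.
  rewrite Rintegral_cst// -/m; congr (_ * (_ + _ * _ + _ * _)).
    by rewrite /Rintegral L2_sqr_norm.
  by rewrite /Rintegral L2_sqr_dist.
have id : mu.-integrable setT (fun y => (b (L2rep u y) * f0 (x - y) - b (L2rep v y) * f0 (x - y))%:E).
  exact: (integrableB measurableT (iconv u x) (iconv v x)).
apply: (le_trans (le_normr_Rintegral measurableT id)).
apply: le_Rintegral => // [|y _].
  exact: (integrable_abse id).
rewrite -mulrBl normrM mulrC /B; apply: ler_pM => //; exact: bK.
Qed.

Lemma continuous_conv x : continuous (conv ^~ x).
Proof.
apply: continuous_eps_delta => u eps eps0.
pose D := Cf * (m + `|u| ^+ 2) + 1.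
have D0 : 0 < D by rewrite ltr_wpDl// mulr_ge0// addr_ge0// sqr_ge0.
have e1 : 0 < eps / 2 / D by rewrite !divr_gt0.
have [K K0 cK] := conv_close e1.
have K1 : 0 < Cf * K + 1 by rewrite ltr_wpDl// mulr_ge0.
have rho0 : 0 < Num.min 1 (eps / 2 / (Cf * K + 1)) by rewrite lt_min ltr01 !divr_gt0.
exists (Num.min 1 (eps / 2 / (Cf * K + 1))) => // v uv; apply: (le_trans (cK u v x)).
move: uv; rewrite lt_min ltr_pdivlMr// => /andP[uv1 uv2].
have uv3 : `|u - v| ^+ 2 <= `|u - v| by rewrite expr2 ler_piMl// ltW.
have h1 : eps / 2 / D * (Cf * (m + `|u| ^+ 2)) <= eps / 2.
  rewrite mulrAC ler_pdivrMr// ler_wpM2l ?divr_ge0 ?(ltW eps0)//.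
  by rewrite /D lerDl.
have h2 : Cf * K * `|u - v| ^+ 2 <= eps / 2.
  apply: le_trans (ltW uv2).
  apply: (@le_trans _ _ (Cf * K * `|u - v|)); first by rewrite ler_wpM2l// mulr_ge0.
  by rewrite mulrC ler_wpM2l// lerDl.
have -> : Cf * (eps / 2 / D * m + eps / 2 / D * `|u| ^+ 2 + K * `|u - v| ^+ 2) =
  eps / 2 / D * (Cf * (m + `|u| ^+ 2)) + Cf * K * `|u - v| ^+ 2 by ring.
by rewrite [leRHS]splitr lerD.
Qed.

Variables (e : H ^nat).
Hypothesis onb : orthonormal_basis dot e.

Lemma L2rep_orth_proj u j : \forall y \ae mu,
  L2rep (orth_proj dot e u j) y = \sum_(0 <= k < j) dot u (e k) * L2rep (e k) y.
Proof.
rewrite /orth_proj; elim: j => [|j ih].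
  rewrite big_geq//; apply: filterS (L2repP (-1) 0 (0 : H)) => y.
  by rewrite big_geq// scaler0 addr0 mulN1r addNr.
rewrite big_nat_recr//= addrC.
apply: filterS2 (L2repP (dot u (e j)) (e j) (\sum_(0 <= k < j) dot u (e k) *: e k)) ih => y -> ->.
by rewrite big_nat_recr//= addrC.
Qed.

(** [L2rep (psi t) y] need not be measurable in [(t, y)], since representatives are chosen for each
    [t] separately. The projections of [psi t] on finitely many basis vectors do have jointly
    measurable representatives, and [conv] is continuous in [u]. *)
Lemma measurable_conv (psi : R -> H) :
  measurable_fun setT (psi : R -> g_sigma_algebraType (@open H)) ->
  measurable_fun setT (fun p : 'rV[R]_n * R => conv (psi p.2) p.1).
Proof.
move=> mpsi; have mc k : measurable_fun setT (fun t => dot (psi t) (e k)).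
  exact: measurable_coord mpsi.
pose h j (q : ('rV[R]_n * R) * 'rV[R]_n) :=
  b (\sum_(0 <= k < j) dot (psi q.1.2) (e k) * L2rep (e k) q.2) * f0 (q.1.1 - q.2).
have mh j : measurable_fun setT (h j).
  apply: measurable_funM.
    apply: measurableT_comp; first exact: continuous_measurable_fun.
    apply: measurable_sum => k; apply: measurable_funM.
      by apply: (measurableT_comp (mc k)); exact: measurableT_comp.
    by apply: (measurableT_comp (measurable_L2rep (e k))).
  apply: (measurableT_comp mf0); apply: measurable_rVB => //.
  exact: measurableT_comp.
apply: (measurable_fun_cvg (h := fun j p => \int[lebesgue_rV R n]_y
    (h j (p, y) * \1_Omega y))) => [j|p _].
  apply: (@measurable_Rintegral_param _ _ _ _ _ (lebesgue_rV R n) (fun q => h j q * \1_Omega q.2)).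
  apply: measurable_funM => //.
  by apply: measurableT_comp => //; apply: measurable_indic; exact: measurable_dom.
have hE j : \int[lebesgue_rV R n]_y (h j (p, y) * \1_Omega y) =
    conv (orth_proj dot e (psi p.2) j) p.1.
  transitivity (\int[mu]_y h j (p, y)).
    rewrite Rintegral_mrestr; last exact: measurableT_comp.
    rewrite -[RHS]Rintegral_patch; apply: eq_Rintegral => y _.
    by rewrite patchE indicE; case: ifPn => _; rewrite ?mulr1 ?mulr0.
  congr fine; apply: ae_eq_integral => //.
  - by apply/measurable_EFinP; exact: measurableT_comp.
  - exact/measurable_EFinP.
  - by apply: filterS (L2rep_orth_proj (psi p.2) j) => y yE _; rewrite yE.
rewrite (_ : (fun j => _) = (fun j => conv (orth_proj dot e (psi p.2) j) p.1)); last exact/funext.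
exact: (cvg_comp _ _ (proj2 onb (psi p.2)) (@continuous_conv p.1 (psi p.2))).
Qed.

End convolution.

(** The excess of [|g|] over height [k] tends to 0 pointwise and is dominated by [|g|]. It is
    applied to [xi], which is integrable but need not be bounded in theta. *)
Lemma integrable_tail d (T : measurableType d) (R : realType) (nu : {measure set T -> \bar R})
    (D : set T) (g : T -> R) (eps : R) :
  nu.-integrable D (fun x => (g x)%:E) -> measurable D -> 0 < eps -> exists k : nat,
  nu.-integrable D (fun x => (Num.max (`|g x| - k%:R) 0)%:E) /\
  \int[nu]_(x in D) Num.max (`|g x| - k%:R) 0 <= eps.
Proof.
move=> gi mD eps0; have mg : measurable_fun D g by apply/measurable_EFinP; exact: measurable_int gi.
have mt (k : nat) : measurable_fun D (fun x => Num.max (`|g x| - k%:R) 0).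
  by apply: measurable_maxr => //; apply: measurable_funB => //; exact: measurableT_comp.
have tle (k : nat) x : `|Num.max (`|g x| - k%:R) 0| <= `|g x|.
  rewrite ger0_norm ?le_max ?lexx ?orbT// ge_max normr_ge0 andbT.
  by rewrite lerBlDr lerDl.
have ti k : nu.-integrable D (fun x => (Num.max (`|g x| - k%:R) 0)%:E).
  by apply: (le_integrableR (integrable_abse gi)).
have [|||||_ _] := @dominated_convergence _ _ _ nu D mD
  (fun k x => (Num.max (`|g x| - k%:R) 0)%:E) (cst 0%E) (fun x => `|g x|%:E).
- by move=> k; apply/measurable_EFinP.
- exact: measurable_cst.
- apply: aeW => x _; apply: cvg_near_cst.
  near=> k; congr EFin; apply/max_idPr; rewrite subr_le0.
  by near: k; exact: nbhs_infty_ger.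
- exact: (integrable_abse gi).
- by apply: aeW => x k _; rewrite /= lee_fin.
rewrite integral0 => /cvg0_small /(_ _ eps0) [k _ /(_ k (leqnn k)) ke].
exists k; split => //; rewrite -lee_fin /Rintegral fineK//.
exact: (integrable_fin_num _ (ti k)).
Unshelve. all: by end_near. Qed.

(** The radius [2 s + 2] holds the given history, of squared norm [s], and every history at squared
    distance [q <= 1] from it, so one Lipschitz constant of [xi] serves both. *)
Lemma le_sqr_affine (R : realFieldType) (s q : R) : 0 <= s -> q <= 1 ->
  s <= (2 * s + 2) ^+ 2 /\ 2 * (s + q) <= (2 * s + 2) ^+ 2.
Proof. by move=> s0 q1; split; nra. Qed.

(** * Boundedness and continuity of the delay term *)

Section delay_term.
Context (R : realType) (n : nat) (Omega : smooth_bounded_domain R n).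
Notation mu := (lebesgue_on Omega).
Notation H := (L2 (lebesgue_on Omega)).
Notation dot := (@L2dot _ _ R (lebesgue_on Omega)).
Notation leb := (@lebesgue_measure R).
Variables (r : R) (b : R -> R) (f : 'rV[R]_n -> R) (Cb Cf Cxi : R).
Variable xi : R -> H -> (R -> H) -> R.
Hypothesis cb : continuous b.
Hypothesis bC : forall x, `|b x| <= Cb.
Hypothesis mf : measurable_fun (difference_set Omega) f.
Hypothesis fC : forall z, difference_set Omega z -> `|f z| <= Cf.
Hypothesis xi_ext : history_extensional r xi.
Hypothesis xi_lip : forall M : R, 0 < M -> exists L : R,
  forall (v1 v2 : H) (psi1 psi2 : R -> H),
    L2time `]- r, 0[ psi1 -> L2time `]- r, 0[ psi2 ->
    history_sqnorm r v1 psi1 <= M ^+ 2 -> history_sqnorm r v2 psi2 <= M ^+ 2 ->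
    \int[leb]_(theta in `]- r, 0[) `|xi theta v1 psi1 - xi theta v2 psi2|
    <= L * Num.sqrt (history_sqnorm r (v1 - v2) (fun s => psi1 s - psi2 s)).
Hypothesis xi_L1 : forall (v : H) (psi : R -> H), L2time `]- r, 0[ psi ->
  leb.-integrable `]- r, 0[ (fun theta => (xi theta v psi)%:E) /\
  \int[leb]_(theta in `]- r, 0[) `|xi theta v psi| <= Cxi.
Variables (e : H ^nat).
Hypothesis onb : orthonormal_basis dot e.

Let m := fine (mu setT).
Let K := @conv R n Omega b f.
Let phi w psi x := \int[leb]_(theta in `]- r, 0[) (K (psi theta) x * xi theta w psi).
Let phi0 w psi := phi w psi \_ Omega.

Let Cb0 : 0 <= Cb. Proof. exact: le_trans (bC 0). Qed.

Let m0 : 0 <= m. Proof. by rewrite fine_ge0. Qed.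

Let Cf0 : 0 <= Cf.
Proof.
have [x Ox] := @dom_nonempty _ _ Omega.
by apply: le_trans (fC (z := x - x) _) => //; exists x => //; exists x.
Qed.

Let KC u x : `|K u x| <= Cb * Cf * m. Proof. exact: conv_bound. Qed.

Let B := Cb * Cf * m * Cxi.

Let CK0 : 0 <= Cb * Cf * m. Proof. by rewrite !mulr_ge0. Qed.

Lemma delay_termE w psi : delay_term r b f xi w psi = toL2 mu (phi0 w psi).
Proof.
rewrite /delay_term /phi0 /phi; congr toL2; apply/eq_restrictP => x /set_mem Ox.
apply: eq_Rintegral => t _.
by congr (_ * _); exact: convE.
Qed.

Let mKpsi x (psi : R -> H) : L2time `]- r, 0[ psi ->
  measurable_fun `]- r, 0[ (fun t => K (psi t) x).
Proof.
move=> [mpsi _]; apply: (@measurable_continuous_comp _ _ _ _ _ _ (K ^~ x)) => //.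
exact: (continuous_conv cb bC mf fC).
Qed.

Let ixi w psi : L2time `]- r, 0[ psi ->
  leb.-integrable `]- r, 0[ (fun t => (xi t w psi)%:E).
Proof. by move=> /(xi_L1 w)[]. Qed.

Let iKxi (w' : H) (psi psi' : R -> H) x : L2time `]- r, 0[ psi -> L2time `]- r, 0[ psi' ->
  leb.-integrable `]- r, 0[ (fun t => (K (psi t) x * xi t w' psi')%:E).
Proof.
move=> hp hp'.
have : leb.-integrable `]- r, 0[ (fun t => (xi t w' psi' * K (psi t) x)%:E).
  by apply: (@integrable_mul_bounded _ _ _ _ _ _ _ (Cb * Cf * m)) => //; [exact: ixi|exact: mKpsi].
by apply: eq_integrable => // t _; rewrite mulrC.
Qed.

Let phiB w psi x : L2time `]- r, 0[ psi -> `|phi w psi x| <= B.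
Proof.
move=> hp; have ik := iKxi w x hp hp; have ix := ixi w hp.
apply: (le_trans (le_normr_Rintegral _ ik)) => //.
apply: (@le_trans _ _ (\int[leb]_(t in `]- r, 0[) (Cb * Cf * m * `|xi t w psi|))).
  apply: le_Rintegral => //; first exact: (integrable_abse ik).
    by apply: integrable_scaleR => //; exact: (integrable_abse ix).
  by move=> t _; rewrite normrM ler_wpM2r.
rewrite RintegralZl//; last exact: (integrable_abse ix).
by rewrite ler_wpM2l//; have [] := xi_L1 w hp.
Qed.

Let mphi w psi : L2time `]- r, 0[ psi -> measurable_fun setT (phi w psi).
Proof.
move=> hp; have [mpsi _] := hp.
(* [psi] is known to be measurable only on []- r, 0[], while the joint measurability of [conv] is
   stated over the whole line. *)
pose psi0 := psi \_ `]- r, 0[.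
have mpsi0 : measurable_fun setT (psi0 : R -> g_sigma_algebraType (@open H)).
  apply: (pettis onb) => // j.
  have -> : (fun t => dot (psi0 t) (e j)) = (fun t => dot (psi t) (e j)) \_ `]- r, 0[.
    apply/funext => t; rewrite /psi0 !patchE; case: ifPn => // _.
    exact: ip0l (L2dot_inner_product mu) _.
  by apply/(measurable_restrictT _ _).1 => //; exact: measurable_coord.
have mxi0 : measurable_fun setT ((fun t => xi t w psi) \_ `]- r, 0[).
  apply/(measurable_restrictT _ _).1 => //; apply/measurable_EFinP.
  exact: measurable_int (ixi w hp).
have -> : phi w psi = fun x => \int[leb]_t
    (K (psi0 t) x * ((fun t => xi t w psi) \_ `]- r, 0[) t).
  apply/funext => x; rewrite /phi -[LHS]Rintegral_patch; apply: eq_Rintegral => t _.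
  by rewrite /psi0 !patchE; case: ifPn => // _; rewrite mulr0.
apply: (@measurable_Rintegral_param _ _ _ _ _ leb
  (fun p => K (psi0 p.2) p.1 * ((fun t => xi t w psi) \_ `]- r, 0[) p.2)).
apply: measurable_funM; first exact: (measurable_conv cb bC mf fC onb mpsi0).
exact: measurableT_comp.
Qed.

Let mphi0 w psi : L2time `]- r, 0[ psi -> measurable_fun setT (phi0 w psi).
Proof.
move=> hp; apply/(measurable_restrictT _ _).1; first exact: measurable_dom.
by apply: measurable_funTS; exact: mphi.
Qed.

Let B0 : 0 <= B.
Proof.
rewrite mulr_ge0//; have [|_] := xi_L1 0 (psi := fun=> 0).
  split; first exact: measurable_cst.
  by under eq_integral do rewrite normr0 expr0n/=; rewrite integral0.
by apply: le_trans; apply: Rintegral_ge0.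
Qed.

Let phi0B w psi x : L2time `]- r, 0[ psi -> `|phi0 w psi x| <= B.
Proof. by move=> hp; rewrite /phi0 patchE; case: ifPn => _; [exact: phiB|rewrite normr0]. Qed.

Theorem delay_term_bounded : exists M, forall w psi, L2time `]- r, 0[ psi ->
  `|delay_term r b f xi w psi| <= M.
Proof.
exists (B * (1 + m)) => w psi hp; rewrite delay_termE.
apply: norm_toL2 => //; [exact: lebesgue_on_fin|exact: mphi0|move=> x; exact: phi0B].
Qed.

(** Histories are functions on all of R, and those of two solutions that agree up to time [t] may
    differ at positive arguments. *)
Theorem delay_term_ext w psi1 psi2 : L2time `]- r, 0[ psi1 -> L2time `]- r, 0[ psi2 ->
  (forall s, s \in `]- r, 0[ -> psi1 s = psi2 s) ->
  delay_term r b f xi w psi1 = delay_term r b f xi w psi2.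
Proof.
move=> h1 h2 h12; rewrite !delay_termE; congr toL2; apply/funext => x.
rewrite /phi0 !patchE; case: ifPn => // _; apply: eq_Rintegral => t /set_mem tI.
rewrite h12//; congr (_ * _); apply: xi_ext => //.
  by move: tI; rewrite /= !in_itv/= => /andP[/ltW-> /ltW->].
by apply: aeW => s; exact: h12.
Qed.

Let I2 (psi : R -> H) : L2time `]- r, 0[ psi ->
  leb.-integrable `]- r, 0[ (fun s => (`|psi s| ^+ 2)%:E).
Proof. by move=> hp; exact: integrable_sqr_L2time. Qed.

Let sqnorm_ge0 (w : H) psi : 0 <= history_sqnorm r w psi.
Proof. by rewrite addr_ge0 ?sqr_ge0//; apply: Rintegral_ge0 => s _; exact: sqr_ge0. Qed.

Let sqnorm_le2 (w w' : H) psi psi' : L2time `]- r, 0[ psi -> L2time `]- r, 0[ psi' ->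
  history_sqnorm r w' psi' <=
  2 * (history_sqnorm r w psi + history_sqnorm r (w - w') (fun s => psi s - psi' s)).
Proof.
move=> hp hp'; have ip := L2dot_inner_product mu.
have le2 (u v : H) : `|v| ^+ 2 <= 2 * `|u| ^+ 2 + 2 * `|u - v| ^+ 2.
  by have := ip_sqr_le2 ip u (- (u - v)); rewrite normrN opprB addrC subrK.
have hd := L2timeB onb (measurable_itv _) hp hp'.
rewrite /history_sqnorm addrACA mulrDr lerD//; first by rewrite mulrDr.
rewrite mulrDr -!RintegralZl//; try exact: I2.
rewrite -RintegralD//; try by apply: integrable_scaleR => //; exact: I2.
apply: le_Rintegral => //; first exact: I2.
by apply: integrable_addR => //; apply: integrable_scaleR => //; exact: I2.
Qed.

(** The difference of the integrands is [K' (xi - xi') + (K - K') xi], with [xi] taken at the fixed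
    history, so that the cutting height [k] does not depend on the perturbation. [P1] uses the
    Lipschitz bound, [P2] the part of [xi] below [k] with [conv_close], [P3] the excess above
    [k]. *)
Theorem delay_term_continuous w psi eps : L2time `]- r, 0[ psi -> 0 < eps ->
  exists2 dl, 0 < dl & forall w' psi', L2time `]- r, 0[ psi' ->
  history_sqnorm r (w - w') (fun s => psi s - psi' s) <= dl ->
  `|delay_term r b f xi w psi - delay_term r b f xi w' psi'| <= eps.
Proof.
(* The integrals of [P1], [P2], [P3] are at most [c], [2 c] and [c]; [dist_toL2] contributes the
   factor [1 + m]. *)
move=> hp eps0; pose c := eps / (1 + m) / 4.
have m1 : 0 < 1 + m by rewrite ltr_pwDl.
have c0 : 0 < c by rewrite !divr_gt0.
pose CK := Cb * Cf * m; pose S0 := history_sqnorm r w psi.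
have S00 : 0 <= S0 by exact: sqnorm_ge0.
have M0 : 0 < 2 * S0 + 2 by rewrite ltr_wpDl// mulr_ge0.
have [L LP] := xi_lip M0.
have t0 : 0 < c / (2 * CK + 1) by rewrite divr_gt0// ltr_wpDl// mulr_ge0.
have mI : measurable (`]- r, 0[%classic : set R) by exact: measurable_itv.
have [k [ik kP]] := integrable_tail (ixi w hp) mI t0.
pose S := \int[leb]_(s in `]- r, 0[) `|psi s| ^+ 2.
have S1 : 0 <= S by apply: Rintegral_ge0 => s _; exact: sqr_ge0.
pose l := fine (leb `]- r, 0[); have l0 : 0 <= l by rewrite fine_ge0.
have D0 : 0 < Cf * k%:R * (m * l + S) + 1 by rewrite ltr_wpDl// !mulr_ge0 ?addr_ge0 ?mulr_ge0.
have e1 : 0 < c / (Cf * k%:R * (m * l + S) + 1) by rewrite divr_gt0.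
have [K1 K10 cK] := conv_close cb bC mf fC e1.
set eps1 := c / _ in e1 cK.
have D1 : 0 < Cf * k%:R * K1 + 1 by rewrite ltr_wpDl// !mulr_ge0.
have D2 : 0 < CK * `|L| + 1 by rewrite ltr_wpDl// !mulr_ge0.
(* The bound 1 keeps the perturbed history in the ball of [le_sqr_affine], the second makes the [K1]
   term of [P2] at most [c], and the third, squared since [xi] is Lipschitz in the norm, does so for
   [P1]. The sign of [L] is unknown, hence [|L|]. *)
pose dl := Num.min 1 (Num.min (c / (Cf * k%:R * K1 + 1)) ((c / (CK * `|L| + 1)) ^+ 2)).
have dl0 : 0 < dl by rewrite !lt_min ltr01 exprn_gt0 !divr_gt0.
exists dl => // w' psi' hp' hd; rewrite !delay_termE.
have -> : eps = c * 4 * (1 + m) by rewrite /c divfK// divfK// gt_eqF.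
have c4 : 0 <= c * 4 by rewrite mulr_ge0// ltW.
apply: (dist_toL2 (lebesgue_on_fin Omega) (mphi0 w hp) (mphi0 w' hp')
  (fun x => phi0B w x hp) (fun x => phi0B w' x hp') c4).
move=> x; rewrite /phi0 !patchE; case: ifPn => [_|_]; last first.
  by rewrite subrr normr0 mulr_ge0// ltW.
pose q := history_sqnorm r (w - w') (fun s => psi s - psi' s).
have q0 : 0 <= q by exact: sqnorm_ge0.
have [q1 q2 q3] : [/\ q <= 1, q * (Cf * k%:R * K1 + 1) <= c & Num.sqrt q * (CK * `|L| + 1) <= c].
  move: hd; rewrite -/q /dl !le_min => /andP[h1 /andP[h2 h3]]; split => //.
    by rewrite -ler_pdivlMr.
  have cD : 0 <= c / (CK * `|L| + 1) by rewrite divr_ge0// ltW.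
  by rewrite -ler_pdivlMr//; have := ler_wsqrtr h3; rewrite sqrtr_sqr (ger0_norm cD).
have hdI := L2timeB onb (measurable_itv _) hp hp'.
have ixx : leb.-integrable `]- r, 0[ (fun t => (xi t w psi - xi t w' psi')%:E).
  exact: (integrableB _ (ixi w hp) (ixi w' hp')).
pose P1 t := CK * `|xi t w psi - xi t w' psi'|.
pose P2 t := Cf * k%:R * (eps1 * m + eps1 * `|psi t| ^+ 2 + K1 * `|psi t - psi' t| ^+ 2).
pose P3 t := 2 * CK * Num.max (`|xi t w psi| - k%:R) 0.
have iP1 : leb.-integrable `]- r, 0[ (fun t => (P1 t)%:E).
  by apply: integrable_scaleR => //; exact: (integrable_abse ixx).
have ic : leb.-integrable `]- r, 0[ (fun t => (eps1 * m)%:E).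
  by apply: (@integrable_bounded _ _ _ _ _ (fun=> eps1 * m) `|eps1 * m|) => //; exact: lebesgue_itvoo_lty.
have icm : leb.-integrable `]- r, 0[ (fun=> m%:E).
  by apply: (@integrable_bounded _ _ _ _ _ (fun=> m) `|m|) => //; exact: lebesgue_itvoo_lty.
have i1 : leb.-integrable `]- r, 0[ (fun t => (eps1 * `|psi t| ^+ 2)%:E).
  by apply: integrable_scaleR => //; exact: I2.
have i2 : leb.-integrable `]- r, 0[ (fun t => (K1 * `|psi t - psi' t| ^+ 2)%:E).
  by apply: integrable_scaleR => //; exact: (I2 hdI).
have i3 := integrable_addR ic i1 mI.
have i4 := integrable_addR i3 i2 mI.
have iP2 : leb.-integrable `]- r, 0[ (fun t => (P2 t)%:E).
  exact: (integrable_scaleR _ i4).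
have iP3 : leb.-integrable `]- r, 0[ (fun t => (P3 t)%:E).
  exact: (integrable_scaleR _ ik).
have iP := integrable_addR (integrable_addR iP1 iP2 mI) iP3 mI.
have idf : leb.-integrable `]- r, 0[
    (fun t => (K (psi t) x * xi t w psi - K (psi' t) x * xi t w' psi')%:E).
  exact: (integrableB _ (iKxi w x hp hp) (iKxi w' x hp' hp')).
rewrite /phi -RintegralB; [|by []|exact: iKxi|exact: iKxi].
apply: (le_trans (le_normr_Rintegral _ idf)) => //.
apply: (@le_trans _ _ (\int[leb]_(t in `]- r, 0[) (P1 t + P2 t + P3 t))).
  apply: le_Rintegral => //; first exact: (integrable_abse idf).
  move=> t _.
  have -> : K (psi t) x * xi t w psi - K (psi' t) x * xi t w' psi' =
    K (psi' t) x * (xi t w psi - xi t w' psi') + (K (psi t) x - K (psi' t) x) * xi t w psi by ring.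
  rewrite (le_trans (ler_normD _ _))// !normrM -addrA lerD//.
    by rewrite ler_wpM2r.
  apply: (@le_trans _ _ (`|K (psi t) x - K (psi' t) x| * (k%:R + Num.max (`|xi t w psi| - k%:R) 0))).
    by rewrite ler_wpM2l// -lerBlDl le_max lexx.
  rewrite mulrDr lerD//.
    by rewrite /P2 mulrAC ler_wpM2r//; exact: cK.
  rewrite ler_wpM2r ?le_max ?lexx ?orbT// (le_trans (ler_normB _ _))//.
  by rewrite mulr_natl mulr2n lerD.
rewrite RintegralD//; last exact: (integrable_addR iP1 iP2 mI).
rewrite RintegralD//.
have r1 : \int[leb]_(t in `]- r, 0[) P1 t <= c.
  rewrite /P1 RintegralZl//; last exact: (integrable_abse ixx).
  apply: le_trans q3; rewrite mulrDr mulr1 -[leLHS]addr0 lerD ?sqrtr_ge0//.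
  rewrite [leRHS]mulrC -(mulrA CK) ler_wpM2l//.
  apply: (@le_trans _ _ (L * Num.sqrt q)); last by rewrite ler_wpM2r ?sqrtr_ge0// ler_norm.
  apply: LP => //.
    exact: (le_sqr_affine S00 q1).1.
  apply: (le_trans (sqnorm_le2 w w' hp hp')); rewrite -/S0 -/q.
  exact: (le_sqr_affine S00 q1).2.
have r2 : \int[leb]_(t in `]- r, 0[) P2 t <= c + c.
  rewrite /P2 RintegralZl// RintegralD// RintegralD// !RintegralZl//; try solve [exact: I2|exact: icm].
  rewrite Rintegral_cst// -/l -/S.
  set W := \int[leb]_(s in _) `|psi s - psi' s| ^+ 2.
  have -> : Cf * k%:R * (eps1 * (m * l) + eps1 * S + K1 * W) =
    eps1 * (Cf * k%:R * (m * l + S)) + Cf * k%:R * K1 * W by ring.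
  apply: lerD.
    by rewrite /eps1 mulrAC ler_pdivrMr// ler_wpM2l ?(ltW c0)// lerDl.
  apply: le_trans q2; rewrite mulrC.
  have qS : W <= q by rewrite lerDr sqr_ge0.
  apply: ler_pM => //; last by rewrite lerDl.
  - by apply: Rintegral_ge0 => s _; exact: sqr_ge0.
  - by rewrite !mulr_ge0.
have r3 : \int[leb]_(t in `]- r, 0[) P3 t <= c.
  rewrite /P3 RintegralZl//; apply: (@le_trans _ _ (2 * CK * (c / (2 * CK + 1)))).
    by rewrite ler_wpM2l// mulr_ge0.
  rewrite mulrA ler_pdivrMr ?ltr_wpDl ?mulr_ge0// [leRHS]mulrC ler_wpM2r ?(ltW c0)//.
  by rewrite lerDl.
rewrite [leRHS](_ : _ = c + (c + c) + c); last by ring.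
by rewrite !lerD.
Qed.

End delay_term.

(** * Mild solutions for a bounded forcing *)

Definition eps_continuous (R : realType) (V : normedModType R) (I : set R) (p : R -> V) :=
  forall t, I t -> forall eps, 0 < eps -> exists2 dl, 0 < dl &
  forall s, I s -> `|t - s| < dl -> `|p t - p s| <= eps.

Lemma eps_continuousW (R : realType) (V : normedModType R) (I : set R) (p : R -> V) :
  eps_continuous I p -> {within I, continuous p}.
Proof.
move=> cp; apply/subspace_continuousP => t It; apply/cvgrPdist_le => eps eps0.
have [dl dl0 dlP] := cp t It eps eps0; rewrite near_withinE.
by near=> s => Is; apply: dlP => //; near: s; exact: cvgr_dist_lt.
Unshelve. all: by end_near. Qed.

Lemma eps_continuousD (R : realType) (V : normedModType R) (I : set R) (p q : R -> V) :
  eps_continuous I p -> eps_continuous I q -> eps_continuous I (fun t => p t + q t).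
Proof.
move=> cp cq t It eps eps0; have e2 : 0 < eps / 2 by rewrite divr_gt0.
have [d1 d10 h1] := cp t It _ e2; have [d2 d20 h2] := cq t It _ e2.
exists (Num.min d1 d2) => [|s Is]; first by rewrite lt_min d10.
rewrite lt_min => /andP[ts1 ts2]; rewrite opprD addrACA (le_trans (ler_normD _ _))//.
by rewrite [leRHS]splitr lerD// ?h1// h2.
Qed.

Lemma eps_continuous_within (R : realType) (I : set R) (f : R -> R) : continuous f ->
  eps_continuous I f.
Proof.
move=> cf t It eps eps0.
have /cvgrPdist_le /(_ _ eps0) /nbhs_ballP[dl /= dl0 h] := cf t.
by exists dl => // s Is; exact: h.
Qed.

Lemma eps_continuous_uniform (R : realType) (V : normedModType R) (I : set R)
    (p : R -> V) (pk : nat -> R -> V) :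
  (forall eps, 0 < eps -> exists k, forall t, I t -> `|pk k t - p t| <= eps) ->
  (forall k, eps_continuous I (pk k)) -> eps_continuous I p.
Proof.
move=> pkp cpk t It eps eps0; have e3 : 0 < eps / 3 by rewrite divr_gt0.
have [k kP] := pkp _ e3; have [dl dl0 dlP] := cpk k t It _ e3; exists dl => // s Is ts.
have -> : p t - p s = (pk k t - pk k s) - (pk k t - p t) + (pk k s - p s).
  by symmetry; rewrite opprB [X in X + _]addrC !subrKA.
rewrite (le_trans (ler_normD _ _))// (le_trans (lerD (ler_normB _ _) (lexx _)))//.
by have := dlP s Is ts; have := kP t It; have := kP s Is; lra.
Qed.

Section basis_tail.
Context (R : realType) (V : normedModType R) (dot : V -> V -> R) (ip : inner_product dot).
Variables (e : V ^nat) (lam : R ^nat).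
Hypothesis onb : orthonormal_basis dot e.
Hypothesis lam0 : forall k, 0 <= lam k.
Hypothesis lam_ge : forall C, exists N, forall k, (N <= k)%N -> C <= lam k.
Let one := proj1 onb.

(** [|A^(1/2) u|^2 <= kappa], put through partial sums so that membership in the domain is not
    presupposed. *)
Definition energy_le kappa u :=
  forall n, \sum_(0 <= k < n) lam k * dot u (e k) ^+ 2 <= kappa.

(** [N] depends on [kappa] and [eps] alone: this uniformity is the compactness of the energy balls.
    The eigenvalues from [N] on exceed [kappa / eps^2]. *)
Lemma energy_tail kappa eps : 0 < eps -> exists N, forall u, energy_le kappa u ->
  `|u - orth_proj dot e u N| <= eps.
Proof.
move=> eps0; pose C := `|kappa| / eps ^+ 2 + 1.
have C0 : 0 < C by rewrite ltr_wpDl// divr_ge0// sqr_ge0.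
have [N NP] := lam_ge C; exists N => u uk.
have vk j : dot (u - orth_proj dot e u N) (e j) = if (j < N)%N then 0 else dot u (e j).
  by rewrite (ipBl ip) (ip_comb ip one); case: ifPn => _; rewrite ?subrr ?subr0.
rewrite -(@ler_pXn2r _ 2)// ?nnegrE// ?(ltW eps0)//.
apply: (le_trans (sqr_norm_head_tail (kappa := kappa) ip onb lam0 C0 NP _)) => [n|].
  apply: le_trans (uk n); apply: ler_sum => j _; rewrite ler_wpM2l// vk.
  by case: ifPn => // _; rewrite expr0n sqr_ge0.
rewrite big_nat_cond big1 ?add0r; last first.
  by move=> j /andP[/andP[_ jN] _]; rewrite vk jN expr0n.
rewrite ler_pdivrMr// /C mulrDr mulr1 mulrC divfK ?gt_eqF ?exprn_gt0//.
by rewrite (le_trans (ler_norm _))// lerDl sqr_ge0.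
Qed.

Lemma dist_head_tail u v N : `|u - v| <=
  `|u - orth_proj dot e u N| + `|v - orth_proj dot e v N| +
  \sum_(0 <= j < N) `|dot u (e j) - dot v (e j)|.
Proof.
set P := orth_proj dot e.
have -> : u - v = (u - P u N) - (v - P v N) + (P u N - P v N).
  by symmetry; rewrite opprB addrAC !subrKA.
rewrite (le_trans (ler_normD _ _))// lerD// ?ler_normB//.
rewrite /P /orth_proj -sumrB (le_trans (ler_norm_sum _ _ _))//.
by apply: ler_sum => j _; rewrite -scalerBl normrZ (norm_orthonormal ip one) mulr1.
Qed.

Lemma eps_continuous_coord (I : set R) (p : R -> V) :
  (forall j, eps_continuous I (fun t => dot (p t) (e j))) ->
  (forall eps, 0 < eps -> exists N, forall t, I t -> `|p t - orth_proj dot e (p t) N| <= eps) ->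
  eps_continuous I p.
Proof.
move=> cp tp t It eps eps0; have e3 : 0 < eps / 3 by rewrite divr_gt0.
have [N NP] := tp _ e3.
have [dl dl0 dlP] : exists2 dl, 0 < dl & forall s, I s -> `|t - s| < dl ->
    \sum_(0 <= j < N) `|dot (p t) (e j) - dot (p s) (e j)| <= eps / 3.
  elim: N {NP} (eps / 3) e3 => [|N ih] e' e'0.
    by exists 1 => // s _ _; rewrite big_geq// ltW.
  have e'2 : 0 < e' / 2 by rewrite divr_gt0.
  have [d1 d10 h1] := ih _ e'2; have [d2 d20 h2] := cp N t It _ e'2.
  exists (Num.min d1 d2) => [|s Is]; first by rewrite lt_min d10.
  rewrite lt_min => /andP[ts1 ts2]; rewrite big_nat_recr//= [leRHS]splitr.
  by rewrite lerD// ?h1// h2.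
exists dl => // s Is ts; rewrite (le_trans (dist_head_tail _ _ N))//.
by have := dlP s Is ts; have := NP t It; have := NP s Is; lra.
Qed.

End basis_tail.

Section L2time_patch.
Context d (T : measurableType d) (R : realType) (mu : {measure set T -> \bar R}).
Notation H := (L2 mu).
Notation leb := (@lebesgue_measure R).
Notation dot := (@L2dot d T R mu).
Variable e : H ^nat.
Hypothesis onb : orthonormal_basis dot e.
Let ip := L2dot_inner_product mu.

Lemma dot_patch (I : set R) (p : R -> H) w :
  (fun t => dot ((p \_ I) t) w) = (fun t => dot (p t) w) \_ I.
Proof.
apply/funext => t; rewrite !patchE; case: ifPn => // _; exact: ip0l ip _.
Qed.

Lemma L2time_patch (I : set R) (p : R -> H) : measurable I -> L2time I p ->
  L2time setT (p \_ I).
Proof.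
move=> mI pI; have [mp _] := pI; apply: (L2timeP onb) => // [j|].
  by rewrite dot_patch; apply/(measurable_restrictT _ _).1 => //; exact: measurable_coord.
have -> : (fun t => (`|(p \_ I) t| ^+ 2)%:E) = (fun t => (`|p t| ^+ 2)%:E) \_ I.
  by apply/funext => t; rewrite !patchE; case: ifPn => // _; rewrite normr0 expr0n.
apply: (integrable_mkcond _ _).1 => //; exact: integrable_sqr_L2time.
Qed.

Lemma L2time_bounded (I : set R) (p : R -> H) C : measurable I -> (leb I < +oo)%E ->
  (forall j, measurable_fun I (fun t => dot (p t) (e j))) ->
  (forall t, I t -> `|p t| <= C) -> L2time I p.
Proof.
move=> mI Ioo mp pC; apply: (L2timeP onb) => //.
apply: (@integrable_bounded _ _ _ _ _ _ (C ^+ 2)) => //.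
  exact: (measurable_sqr_norm_coord onb).
move=> t It; rewrite normrX normr_id lerXn2r ?nnegrE//; last exact: pC.
exact: le_trans (pC t It).
Qed.

Lemma L2time_history (r t : R) (p : R -> H) : L2time setT p -> L2time `]- r, 0[ (history p t).
Proof.
move=> pT; have [mp _] := pT.
have mt := measurable_shift t.
apply: (@L2timeS _ _ _ _ setT) => //; apply: (L2timeP onb) => // [j|].
  rewrite /history; under eq_fun do rewrite addrC.
  exact: (measurableT_comp (measurable_coord (e j) mp) mt).
apply/integrableP; split.
  apply/measurable_EFinP; rewrite /history; under eq_fun do rewrite addrC.
  exact: (measurableT_comp (measurable_funX 2 (measurable_normL2 mp)) mt).
under eq_integral => s _ do rewrite gee0_abs ?lee_fin ?sqr_ge0// /history addrC.
rewrite (@ge0_integral_shift R t (fun s => (`|p s| ^+ 2)%:E))//.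
- by have [] := pT.
- by apply/measurable_EFinP; exact: measurable_funX (measurable_normL2 mp).
Qed.

End L2time_patch.

(** * Mild solutions assembled from their coordinates *)

Section solution_map.
Context d (T : measurableType d) (R : realType) (mu : {measure set T -> \bar R}).
Notation H := (L2 mu).
Notation leb := (@lebesgue_measure R).
Notation dot := (@L2dot d T R mu).
Variables (e : H ^nat) (lam : R ^nat) (c dd r B M : R) (u0 : H) (phi : R -> H).
Hypothesis onb : orthonormal_basis dot e.
Hypothesis c0 : 0 < c.
Hypothesis lamc : forall k, c <= lam k.
Hypothesis lam_ge : forall C, exists N, forall k, (N <= k)%N -> C <= lam k.
Hypothesis dd0 : 0 < dd.
Hypothesis r0 : 0 < r.
Hypothesis B0 : 0 < B.
Hypothesis phi2 : L2time `]- r, 0[ phi.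
Let ip := L2dot_inner_product mu.
Let one := proj1 onb.
Let a k := lam k + dd.

Let lam0 k : 0 < lam k. Proof. exact: lt_le_trans (lamc k). Qed.
Let lamW k : 0 <= lam k. Proof. exact/ltW. Qed.
Let a0 k : 0 < a k. Proof. by rewrite addr_gt0. Qed.

(** Takes the place of a vector-valued integral; meaningful for square summable sequences, by
    [of_coordsE]. *)
Definition of_coords (x : R ^nat) : H := get [set u | forall k, dot u (e k) = x k].

Lemma of_coordsE (x : R ^nat) C : (forall n, \sum_(0 <= k < n) x k ^+ 2 <= C) ->
  forall k, dot (of_coords x) (e k) = x k.
Proof.
move=> xC; have [u ux] := riesz_fischer ip onb (@L2_complete _ _ _ mu) xC.
exact: (@getPex _ [set u | forall k, dot u (e k) = x k] (ex_intro _ u ux)).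
Qed.

Definition semi t := of_coords (fun k => expR (- (a k * t)) * dot u0 (e k)).

Let semi_sqr t k : 0 <= t -> (expR (- (a k * t)) * dot u0 (e k)) ^+ 2 <= dot u0 (e k) ^+ 2.
Proof.
move=> t0; rewrite exprMn ler_piMl ?sqr_ge0// expr_le1 ?expR_ge0//.
by rewrite -expR0 ler_expR oppr_le0 mulr_ge0// ltW.
Qed.

Lemma semi_coord t k : 0 <= t -> dot (semi t) (e k) = expR (- (a k * t)) * dot u0 (e k).
Proof.
move=> t0; apply: (of_coordsE (C := `|u0| ^+ 2)) => n.
apply: le_trans (bessel ip one u0 n); apply: ler_sum => j _; exact: semi_sqr.
Qed.

Lemma norm_semi t : 0 <= t -> `|semi t| <= `|u0|.
Proof.
move=> t0; rewrite -(@ler_pXn2r _ 2)// ?nnegrE//; apply: (sqr_norm_le ip onb) => n.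
apply: le_trans (bessel ip one u0 n); apply: ler_sum => j _.
by rewrite semi_coord//; exact: semi_sqr.
Qed.

Lemma eps_continuous_semi : eps_continuous `[0, B] semi.
Proof.
apply: (eps_continuous_coord ip onb) => [j t tI eps eps0|eps eps0].
  have ce : continuous (fun t => expR (- a j * t) * dot u0 (e j)).
    move=> x; apply: cvgM; last exact: cvg_cst.
    apply: (continuous_comp (f := fun t => - a j * t)); last exact: continuous_expR.
    exact: mulrl_continuous.
  have [dl dl0 dlP] := eps_continuous_within ce tI eps0; exists dl => // s sI ts.
  move: tI sI (dlP s sI ts); rewrite /= !in_itv/= => /andP[t0 _] /andP[s0 _].
  by rewrite !semi_coord// !mulNr.
have /cvgrPdist_le /(_ _ eps0) [N _ /(_ N (leqnn N)) uN] := proj2 onb u0.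
exists N => t; rewrite /= in_itv/= => /andP[t0 _]; apply: le_trans uN.
rewrite -(@ler_pXn2r _ 2)// ?nnegrE//; apply: (sqr_norm_le ip onb) => n.
apply: le_trans (bessel ip one _ n); apply: ler_sum => j _.
rewrite !(ipBl ip) !(ip_comb ip one); case: ifPn => _; rewrite ?subrr// !subr0.
by rewrite semi_coord//; exact: semi_sqr.
Qed.

(** Defined on all of R and 0 outside []- r, 0[] and [[0, B]], so that translations act on one
    global L2 function. Two glued functions differ by [w - w'] on [[0, B]] and nowhere else. *)
Definition glue (w : R -> H) : R -> H := fun t =>
  (phi \_ `]- r, 0[) t + ((fun t => semi t + w t) \_ `[0, B]) t.

Lemma glue_past w t : t \in `]- r, 0[ -> glue w t = phi t.
Proof.
move=> tI; rewrite /glue !patchE mem_set// memNset ?addr0//.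
by move: tI; rewrite /= !in_itv/= => /andP[_ t0] /andP[]; rewrite leNgt t0.
Qed.

Lemma glue_future w t : t \in `[0, B] -> glue w t = semi t + w t.
Proof.
move=> tI; rewrite /glue !patchE [t \in `[0, B]%classic]mem_set// memNset ?add0r//.
by move: tI; rewrite /= !in_itv/= => /andP[t0 _] /andP[_]; rewrite ltNge t0.
Qed.

Lemma glue_out w w' t : ~ t \in `[0, B] -> glue w t = glue w' t.
Proof. by move=> tI; rewrite /glue !patchE [t \in `[0, B]%classic]memNset. Qed.

Lemma L2time_glue w C : (forall j, measurable_fun `[0, B] (fun t => dot (w t) (e j))) ->
  (forall t, t \in `[0, B] -> `|w t| <= C) -> L2time setT (glue w).
Proof.
move=> mw wC; apply: (L2timeD onb measurableT); first exact: (L2time_patch onb).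
apply: (L2time_patch onb) => //.
apply: (L2time_bounded onb (C := `|u0| + C)) => //; first exact: lebesgue_itvcc_lty.
  move=> j; apply: (eq_measurable_fun (fun t => dot (semi t) (e j) + dot (w t) (e j))).
    by move=> t _; rewrite (ipDl ip).
  apply: measurable_funD => //.
  apply: (eq_measurable_fun (fun t => expR (- a j * t) * dot u0 (e j))).
    by move=> t; rewrite inE /= in_itv/= => /andP[t0 _]; rewrite semi_coord// mulNr.
  by apply: measurable_funM => //; exact: measurable_expRM.
move=> t tI; rewrite (le_trans (ler_normD _ _))// lerD//; last exact: wC.
by apply: norm_semi; move: tI; rewrite /= in_itv/= => /andP[].
Qed.

Section energy.
Variable g : R -> H.
Hypothesis mg : forall j, measurable_fun setT (fun t => dot (g t) (e j)).
Hypothesis gM : forall t, `|g t| <= M.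

Let gj j t := dot (g t) (e j).

Lemma norm_coord_le u j : `|dot u (e j)| <= `|u|.
Proof. by rewrite (le_trans (ip_CS ip _ _))// (norm_orthonormal ip one) mulr1. Qed.

Let gjM j t : `|gj j t| <= M. Proof. exact: le_trans (norm_coord_le _ _) (gM t). Qed.

(** [lam k <= 2 a k] and [duhamel_sqr] bound each term by the integral of [<g s, e k>^2]; Bessel's
    inequality under the integral makes the sum independent of [n]. *)
Lemma duhamel_energy t n : 0 <= t ->
  \sum_(0 <= k < n) lam k * duhamel (a k) (gj k) t ^+ 2 <= M ^+ 2 * t.
Proof.
move=> t0.
have gi k : leb.-integrable `[0, t] (fun s => (gj k s ^+ 2)%:E).
  apply: (@integrable_bounded _ _ _ _ _ _ (M ^+ 2)) => //.
  - exact: lebesgue_itvcc_lty.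
  - by apply: measurable_funTS; apply: measurable_funX; exact: mg.
  - by move=> s _; rewrite normrX lerXn2r ?nnegrE// (le_trans _ (gjM k s)).
have [si sE] := Rintegral_sum n gi (measurable_itv _).
apply: (@le_trans _ _ (\sum_(0 <= k < n) \int[leb]_(s in `[0, t]) gj k s ^+ 2)).
  apply: ler_sum => k _; apply: le_trans (duhamel_sqr (a0 k) (mg k) (gjM k) t0).
  rewrite ler_wpM2r ?sqr_ge0// mulr_natl mulr2n (@le_trans _ _ (a k))//.
    by rewrite lerDl ltW.
  by rewrite lerDl ltW.
rewrite -sE (le_trans (ler_norm _))//.
have /(_ (fun s => \sum_(0 <= k < n) gj k s ^+ 2) (M ^+ 2)) :=
  @Rintegral_le_cst _ _ _ leb `[0, t]%classic.
rewrite fine_lebesgue_itvcc// subr0; apply => //.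
- exact: lebesgue_itvcc_lty.
- by apply/measurable_EFinP; exact: measurable_int si.
- move=> s _; rewrite ger0_norm; last by apply: sumr_ge0 => k _; exact: sqr_ge0.
  rewrite (le_trans (bessel ip one _ _))// lerXn2r ?nnegrE//.
  exact: le_trans (gM s).
Qed.

End energy.

Definition forcing (g : R -> H) :=
  (forall j, measurable_fun setT (fun t => dot (g t) (e j))) /\ (forall t, `|g t| <= M).

Definition duh (g : R -> H) t := of_coords (fun k => duhamel (a k) (fun s => dot (g s) (e k)) t).

Lemma energy_bounded kappa (x : R ^nat) :
  (forall n, \sum_(0 <= k < n) lam k * x k ^+ 2 <= kappa) ->
  forall n, \sum_(0 <= k < n) x k ^+ 2 <= kappa / c.
Proof.
move=> xk n; rewrite ler_pdivlMr// mulrC mulr_sumr; apply: le_trans (xk n).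
by apply: ler_sum => k _; rewrite ler_wpM2r ?sqr_ge0.
Qed.

Lemma duh_coord g t k : forcing g -> 0 <= t ->
  dot (duh g t) (e k) = duhamel (a k) (fun s => dot (g s) (e k)) t.
Proof.
move=> [mg gM] t0; apply: (of_coordsE (C := M ^+ 2 * t / c)); apply: energy_bounded => n.
exact: duhamel_energy.
Qed.

Lemma duh_energy g t : forcing g -> 0 <= t <= B -> energy_le dot e lam (M ^+ 2 * B) (duh g t).
Proof.
move=> fg /andP[t0 tB] n; have [mg gM] := fg.
under eq_bigr do rewrite duh_coord//.
by rewrite (le_trans (duhamel_energy mg gM n t0))// ler_wpM2l ?sqr_ge0.
Qed.

(** The bound [x <= (x + 1)^2] for [x >= 0] avoids a square root. *)
Lemma energy_norm kappa u : energy_le dot e lam kappa u -> `|u| <= kappa / c + 1.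
Proof.
move=> uk; have u2 := sqr_norm_le ip onb (energy_bounded uk).
have k0 : 0 <= kappa / c by exact: le_trans (sqr_ge0 _) u2.
rewrite -(@ler_pXn2r _ 2)// ?nnegrE ?addr_ge0//; apply: (le_trans u2).
by have := sqr_ge0 (kappa / c); rewrite sqrrD1; lra.
Qed.

Definition duh_lip k := M + a k * (M * B).

Lemma duh_coord_lip g k s t : forcing g -> 0 <= s <= B -> 0 <= t <= B ->
  `|dot (duh g s) (e k) - dot (duh g t) (e k)| <= duh_lip k * `|s - t|.
Proof.
move=> fg; have [mg gM] := fg; wlog st : s t / s <= t => [hw sI tI|].
  have [st|ts] := leP s t; first exact: hw.
  by rewrite distrC [`|s - t|]distrC; apply: hw => //; exact: ltW.
move=> /andP[s0 sB] /andP[t0 tB]; rewrite !duh_coord// distrC [`|s - t|]distrC.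
rewrite (@ger0_norm _ (t - s)) ?subr_ge0//.
by apply: duhamel_lipschitz => // x; exact: le_trans (norm_coord_le _ _) (gM x).
Qed.

Lemma measurable_duh_coord g j : forcing g ->
  measurable_fun `[0, B] (fun t => dot (duh g t) (e j)).
Proof.
move=> fg; have [mg gM] := fg.
apply: (eq_measurable_fun (duhamel (a j) (fun s => dot (g s) (e j)))).
  by move=> t; rewrite inE /= in_itv/= => /andP[t0 _]; rewrite duh_coord.
by apply: (@measurable_duhamel _ _ _ _ M) => // [t|]; [exact: le_trans (norm_coord_le _ _) (gM t)|exact: ltW].
Qed.

Definition mild g := glue (duh g).

Lemma L2time_mild g : forcing g -> L2time setT (mild g).
Proof.
move=> fg; apply: (@L2time_glue _ (M ^+ 2 * B / c + 1)) => [j|t].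
  exact: measurable_duh_coord.
by rewrite /= in_itv/= => tI; apply: energy_norm; exact: duh_energy.
Qed.

Lemma eq_duh g h t : (forall s, 0 <= s <= t -> g s = h s) -> duh g t = duh h t.
Proof.
by move=> gh; congr of_coords; apply/funext => k; apply: eq_duhamel => s sI; rewrite gh.
Qed.

(** Causality: the forcing may be changed after time [t] without affecting the solution up to [t].
    The Euler scheme relies on it. *)
Lemma eq_mild g h t s : (forall s, 0 <= s <= t -> g s = h s) -> s <= t -> mild g s = mild h s.
Proof.
move=> gh st; rewrite /mild; have [sI|sI] := boolP (s \in `[0, B]).
  have gh' : duh g s = duh h s.
    by apply: eq_duh => x /andP[x0 xs]; apply: gh; rewrite x0 (le_trans xs).
  by have := glue_future (duh g) sI; rewrite gh' -(glue_future (duh h) sI).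
by apply: glue_out; exact/negP.
Qed.

Lemma eps_continuous_glue w : eps_continuous `[0, B] w -> eps_continuous `[0, B] (glue w).
Proof.
move=> cw t tI eps eps0.
have [dl dl0 dlP] := eps_continuousD eps_continuous_semi cw tI eps0.
by exists dl => // s sI ts; rewrite !glue_future//; exact: dlP.
Qed.

Lemma eps_continuous_duh g : forcing g -> eps_continuous `[0, B] (duh g).
Proof.
move=> fg; have [mg gM] := fg; have M0 : 0 <= M by exact: le_trans (gM 0).
apply: (eps_continuous_coord ip onb) => [j t tI eps eps0|eps eps0].
  have L0 : 0 < duh_lip j + 1.
    by rewrite ltr_wpDl// /duh_lip addr_ge0// !mulr_ge0 ?(ltW (a0 j)) ?(ltW B0).
  exists (eps / (duh_lip j + 1)) => [|s sI]; first by rewrite divr_gt0.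
  rewrite ltr_pdivlMr// => ts; move: tI sI; rewrite /= !in_itv/= => tI sI.
  rewrite (le_trans (duh_coord_lip j fg tI sI))// (le_trans _ (ltW ts))// mulrC.
  by rewrite ler_wpM2l// lerDl.
have [N NP] := energy_tail ip onb lamW lam_ge (M ^+ 2 * B) eps0.
by exists N => t; rewrite /= in_itv/= => tI; apply: NP; exact: duh_energy.
Qed.

End solution_map.

(** * Euler scheme and compactness *)

(** A cluster point exists by compactness, and a cluster point of an ultrafilter is a limit. *)
Lemma ultra_bounded_cvg (R : realType) (I : Type) (U : set_system I) (x : I -> R) C :
  UltraFilter U -> (forall k, `|x k| <= C) -> exists l : R, x k @[k --> U] --> l.
Proof.
move=> UU xC; have PU : ProperFilter U by exact: ultra_proper.
have xK : (x @ U) `[- C, C]%classic.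
  change (U (x @^-1` `[- C, C]%classic)); apply: filterE => k.
  by rewrite /= in_itv/= -ler_norml.
have [l [_ lc]] := segment_compact (fmap_proper_filter x PU) xK.
exists l => V Vl; have [//|nV] := in_ultra_setVsetC (x @^-1` V) UU.
by have [y [nVy Vy]] := lc (~` V) V nV Vl.
Qed.

Lemma dist_le_third (R : realFieldType) (p q y z eps : R) : `|p - q| <= eps / 3 ->
  `|y - z| <= eps / 3 -> `|z - q| <= eps / 3 -> `|p - y| <= eps.
Proof. by rewrite !ler_norml => /andP[? ?] /andP[? ?] /andP[? ?]; apply/andP; split; lra. Qed.

(** With [eta^2 = dl / (16 (1 + r))], the present value costs [(2 eta)^2] and the history
    [2 (dl / 8) + 2 eta^2 r]; each fits in half of [dl]. *)
Lemma half_budget (R : realFieldType) (dl r : R) : 0 < dl -> 0 < r ->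
  (dl / (16 * (1 + r))) *+ (2 ^ 2) <= dl / 2 /\
  forall x, x <= dl / (16 * (1 + r)) -> 2 * (dl / 8) + 2 * x * r <= dl / 2.
Proof.
move=> dl0 r0; have r1 : 0 < 16 * (1 + r) by lra.
split => [|x]; last by rewrite ler_pdivlMr//; nra.
by rewrite -mulr_natr mulrAC ler_pdivrMr//=; nra.
Qed.

Section mild_solution.
Context d (T : measurableType d) (R : realType) (mu : {measure set T -> \bar R}).
Notation H := (L2 mu).
Notation leb := (@lebesgue_measure R).
Notation dot := (@L2dot d T R mu).
Variables (e : H ^nat) (lam : R ^nat) (c dd r B M : R) (u0 : H) (phi : R -> H).
Hypothesis onb : orthonormal_basis dot e.
Hypothesis c0 : 0 < c.
Hypothesis lamc : forall k, c <= lam k.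
Hypothesis lam_ge : forall C, exists N, forall k, (N <= k)%N -> C <= lam k.
Hypothesis dd0 : 0 < dd.
Hypothesis r0 : 0 < r.
Hypothesis B0 : 0 < B.
Hypothesis M0 : 0 <= M.
Hypothesis phi2 : L2time `]- r, 0[ phi.
Let ip := L2dot_inner_product mu.
Let lam0 k : 0 <= lam k. Proof. exact: le_trans (ltW c0) (lamc k). Qed.

Notation forcing := (forcing e M).
Notation duh := (duh e lam dd).
Notation glue := (glue e lam dd r B u0 phi).
Notation mild := (mild e lam dd r B u0 phi).
Notation duh_lip := (duh_lip lam dd B M).
Let kappa := M ^+ 2 * B.
Let K := kappa / c + 1.

Lemma norm_duh g t : forcing g -> 0 <= t <= B -> `|duh g t| <= K.
Proof. by move=> fg tI; apply: (energy_norm onb c0 lamc); exact: (duh_energy onb c0 lamc dd0). Qed.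

Section compactness.
Variable gk : nat -> R -> H.
Hypothesis fgk : forall k, forcing (gk k).

Let x j t k := dot (duh (gk k) t) (e j).

Let xK j t k : 0 <= t <= B -> `|x j t k| <= K.
Proof.
by move=> tI; rewrite (le_trans (norm_coord_le onb _ _))//; exact: norm_duh.
Qed.

(* Limits along one ultrafilter make a diagonal extraction unnecessary. *)
Theorem duh_compact : exists D, (forall t, 0 <= t <= B -> energy_le dot e lam kappa (D t)) /\
  forall n, exists k, (n <= k)%N /\
    forall t, 0 <= t <= B -> `|duh (gk k) t - D t| <= n.+1%:R^-1.
Proof.
have [U [UU Uoo]] := @ultraFilterLemma nat \oo _.
have PU : ProperFilter U by exact: ultra_proper.
(* The limit of each coordinate at each time; 0 is a default outside [[0, B]]. *)
have /choice[y yP] : forall p : nat * R, exists l : R,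
    0 <= p.2 <= B -> x p.1 p.2 k @[k --> U] --> l.
  move=> [j t] /=; have [tI|] := boolP (0 <= t <= B); last by exists 0.
  by have [l lP] := ultra_bounded_cvg UU (fun k => xK j k tI); exists l.
pose D t := of_coords e (fun j => y (j, t)).
have ysum t n : 0 <= t <= B -> \sum_(0 <= j < n) lam j * y (j, t) ^+ 2 <= kappa.
  move=> tI.
  have : (\sum_(0 <= j < n) lam j * x j t k ^+ 2) @[k --> U] -->
      \sum_(0 <= j < n) lam j * y (j, t) ^+ 2.
    elim: n => [|n ih].
      by under eq_fun do rewrite big_geq//; rewrite big_geq//; exact: cvg_cst.
    under eq_fun do rewrite big_nat_recr//=; rewrite big_nat_recr//=.
    apply: cvgD ih _; apply: cvgM; first exact: cvg_cst.
    have h := yP (n, t) tI; exact: (cvgM h h).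
  move=> h; apply: (ler_cvg_to h (cvg_cst kappa)); apply: nearW => k.
  exact: (duh_energy onb c0 lamc dd0 (fgk k) tI).
have DE t j : 0 <= t <= B -> dot (D t) (e j) = y (j, t).
  move=> tI; apply: (of_coordsE onb (C := kappa / c)).
  by apply: (energy_bounded c0 lamc) => n; exact: ysum.
have De t : 0 <= t <= B -> energy_le dot e lam kappa (D t).
  by move=> tI n; under eq_bigr do rewrite DE//; exact: ysum.
exists D; split => // n.
have L0 j : 0 < duh_lip j + 1.
  rewrite ltr_wpDl// addr_ge0// !mulr_ge0 ?(ltW B0)// addr_ge0 ?(ltW dd0)//.
have ylip j s t : 0 <= s <= B -> 0 <= t <= B ->
    `|y (j, s) - y (j, t)| <= duh_lip j * `|s - t|.
  move=> sI tI.
  have h : `|x j s k - x j t k| @[k --> U] --> `|y (j, s) - y (j, t)|.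
    exact: cvg_norm (cvgB (yP (j, s) sI) (yP (j, t) tI)).
  apply: (ler_cvg_to h (cvg_cst (duh_lip j * `|s - t|))); apply: nearW => k.
  exact: (duh_coord_lip onb c0 lamc dd0).
(* Pointwise convergence along [U] becomes uniform in [t]: the coordinates and their limit share the
   Lipschitz constant [duh_lip j], and [[0, B]] is compact. *)
have unif j eps : 0 < eps -> \forall k \near U, forall t, `[0, B]%classic t ->
    `|x j t k - y (j, t)| <= eps.
  move=> eps0; have e3 : 0 < eps / 3 by rewrite divr_gt0.
  have cI : compact (`[0, B]%classic : set R) by exact: segment_compact.
  have /compact_near_coveringP/(_ nat U
    (fun k t => `[0, B]%classic t -> `|x j t k - y (j, t)| <= eps)) := cI.
  move=> near_cov; apply: filterS (near_cov _ _) => [k kP t tI|t tI]; first exact: kP.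
  pose dl := eps / 3 / (duh_lip j + 1).
  have dl0 : 0 < dl by rewrite divr_gt0.
  have cl : \forall k \near U, `|y (j, t) - x j t k| <= eps / 3.
    by move/cvgrPdist_le: (yP (j, t) tI) => /(_ _ e3).
  exists (ball t dl, [set k | `|y (j, t) - x j t k| <= eps / 3]) => /=.
    by split; [exact: nbhsx_ballx|exact: cl].
  move=> [s k] /= [ts xk]; rewrite in_itv/= => sI.
  have st : duh_lip j * `|s - t| <= eps / 3.
    move: ts; rewrite /ball/= /dl ltr_pdivlMr// distrC => /ltW; apply: le_trans.
    by rewrite mulrC ler_wpM2l// lerDl.
  have h1 := le_trans (duh_coord_lip onb c0 lamc dd0 j (fgk k) sI tI) st.
  have h2 := le_trans (ylip j s t sI tI) st.
  exact: (dist_le_third h1 h2 xk).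
have usum N eps : 0 < eps -> \forall k \near U, forall t, `[0, B]%classic t ->
    \sum_(0 <= j < N) `|x j t k - y (j, t)| <= eps.
  elim: N eps => [|N ih] eps eps0.
    by apply: nearW => k t _; rewrite big_geq// ltW.
  have e2 : 0 < eps / 2 by rewrite divr_gt0.
  apply: filterS2 (ih _ e2) (unif N _ e2) => k h1 h2 t tI.
  by rewrite big_nat_recr//= [leRHS]splitr lerD ?h1 ?h2.
pose eps : R := n.+1%:R^-1.
have eps0 : 0 < eps by rewrite invr_gt0.
have e4 : 0 < eps / 4 by rewrite divr_gt0.
have e2 : 0 < eps / 2 by rewrite divr_gt0.
(* The two tails take [eps / 4] each, and the head, a finite sum of coordinates, takes [eps / 2]. *)
have [N NP] := energy_tail ip onb lam0 lam_ge kappa e4.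
have Un : U [set k | (n <= k)%N] by apply: Uoo; exists n.
have [k [nk kP]] := filter_ex (filterI Un (usum N _ e2)).
exists k; split => // t tI; rewrite (le_trans (dist_head_tail ip onb _ _ N))//.
have tI' : `[0, B]%classic t by rewrite /= in_itv.
have := kP t tI'; under eq_bigr do rewrite /x -DE//.
have := NP _ (De t tI); have := NP _ (duh_energy onb c0 lamc dd0 (fgk k) tI).
rewrite -/eps => h1 h2 h3; rewrite [eps]splitr lerD//.
have -> : eps / 2 = eps / 4 + eps / 4 by field.
exact: lerD.
Qed.

End compactness.
Section history_distance.
Variables p q : R -> H.
Hypothesis p2 : L2time setT p.
Hypothesis q2 : L2time setT q.

(** Inserting [p] at time [tau] leaves a translation of [p] alone and a uniform error. Thus
    continuity of translations is needed for the fixed limit [p] and not for the approximations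
    [q]. *)
Lemma history_dist_le t tau X delta :
  (forall s, `|p s - q s| <= delta) ->
  (\int[leb]_s (`|p (s + (tau - t)) - p s| ^+ 2)%:E <= X%:E)%E ->
  \int[leb]_(s in `]- r, 0[) `|history p t s - history q tau s| ^+ 2 <=
  2 * X + 2 * delta ^+ 2 * r.
Proof.
move=> pq pX; have delta0 : 0 <= delta by exact: le_trans (pq 0).
have mI : measurable (`]- r, 0[%classic : set R) by exact: measurable_itv.
have hp := L2time_history onb r t p2; have hp' := L2time_history onb r tau p2.
have hq := L2time_history onb r tau q2.
have i1 := integrable_sqr_L2time (measurable_itv _) (L2timeB onb (measurable_itv _) hp' hp).
have i2 := integrable_sqr_L2time (measurable_itv _) (L2timeB onb (measurable_itv _) hp hq).
have ic : leb.-integrable `]- r, 0[ (fun=> (2 * delta ^+ 2)%:E).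
  apply: (@integrable_bounded _ _ _ _ _ (fun=> 2 * delta ^+ 2) `|2 * delta ^+ 2|) => //.
  exact: lebesgue_itvoo_lty.
have pw s : `|history p t s - history q tau s| ^+ 2 <=
    2 * `|history p tau s - history p t s| ^+ 2 + 2 * delta ^+ 2.
  have -> : history p t s - history q tau s =
      - (history p tau s - history p t s) + (history p tau s - history q tau s).
    by rewrite opprB subrKA.
  rewrite (le_trans (ip_sqr_le2 ip _ _))// normrN lerD2l ler_wpM2l//.
  by rewrite lerXn2r ?nnegrE//; exact: pq.
apply: (@le_trans _ _ (\int[leb]_(s in `]- r, 0[)
    (2 * `|history p tau s - history p t s| ^+ 2 + 2 * delta ^+ 2))).
  by apply: le_Rintegral => //; apply: integrable_addR => //; exact: integrable_scaleR.
rewrite RintegralD//; last exact: integrable_scaleR.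
rewrite RintegralZl// Rintegral_cst// lerD//.
  rewrite ler_wpM2l// -lee_fin /Rintegral fineK; last exact: integrable_fin_num i1.
  apply: le_trans pX.
  have mpp : measurable_fun setT (fun s : R => (`|p (s + (tau - t)) - p s| ^+ 2)%:E).
    apply/measurable_EFinP; apply: measurable_funX; apply: measurable_normL2.
    apply: (pettis onb) => // j.
    have mj := measurable_coord (e j) p2.1.
    under eq_fun do rewrite (ipBl ip).
    by apply: measurable_funB => //; exact: (measurableT_comp mj (measurable_shift _)).
  rewrite -(@ge0_integral_shift R t (fun s : R => (`|p (s + (tau - t)) - p s| ^+ 2)%:E))//.
  apply: (@le_trans _ _ (\int[leb]_(s in `](- r)%R, 0%R[)
      (`|p (s + t + (tau - t)) - p (s + t)| ^+ 2)%:E)%E).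
    rewrite le_eqVlt; apply/orP; left; apply/eqP; apply: eq_integral => s _.
    rewrite /history; have -> : (s : R) + t + (tau - t) = tau + s by ring.
    by rewrite [_ + t]addrC.
  apply: ge0_subset_integral => //.
  exact: (measurableT_comp mpp (measurable_shift t)).
rewrite ler_wpM2l ?mulr_ge0 ?sqr_ge0//.
have lE : fine (leb `]- r, 0[) = r.
  by rewrite lebesgue_measure_itv/= lte_fin oppr_lt0 r0 -EFinB /= sub0r opprK.
by rewrite le_eqVlt; apply/orP; left; apply/eqP.
Qed.

End history_distance.
Variable F : H -> (R -> H) -> H.
Hypothesis FM : forall w psi, L2time `]- r, 0[ psi -> `|F w psi| <= M.
Hypothesis F_ext : forall w psi1 psi2, L2time `]- r, 0[ psi1 -> L2time `]- r, 0[ psi2 ->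
  (forall s, s \in `]- r, 0[ -> psi1 s = psi2 s) -> F w psi1 = F w psi2.
Hypothesis F_cont : forall w psi eps, L2time `]- r, 0[ psi -> 0 < eps ->
  exists2 dl, 0 < dl & forall w' psi', L2time `]- r, 0[ psi' ->
  history_sqnorm r (w - w') (fun s => psi s - psi' s) <= dl ->
  `|F w psi - F w' psi'| <= eps.

Let feedback g t := F (mild g t) (history (mild g) t).

Let sol2 g : forcing g -> L2time setT (mild g).
Proof. exact: (L2time_mild u0 onb c0 lamc dd0 B0 phi2). Qed.

Lemma eq_feedback g h t : forcing g -> forcing h ->
  (forall s, 0 <= s <= t -> g s = h s) -> feedback g t = feedback h t.
Proof.
move=> fg fh gh; rewrite /feedback (@eq_mild _ _ _ _ _ _ _ _ _ _ _ g h t t gh (lexx t)).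
apply: F_ext => [||s].
- exact: (L2time_history onb r t (sol2 fg)).
- exact: (L2time_history onb r t (sol2 fh)).
rewrite in_itv/= => /andP[_ s0]; apply: (@eq_mild _ _ _ _ _ _ _ _ _ _ _ g h t _ gh).
by rewrite gerDl ltW.
Qed.

(* On each interval ]i h, (i + 1) h] the feedback is frozen at time i h. *)
Lemma euler_scheme h i : 0 < h -> exists g, [/\ forcing g, forall t, t <= 0 -> g t = 0 &
  forall t, 0 < t <= i%:R * h ->
  exists tau, [/\ 0 <= tau <= t, t - tau <= h & g t = feedback g tau]].
Proof.
move=> h0; elim: i => [|i [g [fg g0 gP]]].
  exists (fun=> 0); split => // [|t]; last by rewrite mul0r => /andP[/lt_le_trans/[apply]]; rewrite ltxx.
  by split => [j|t]; [exact: measurable_cst|rewrite normr0].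
pose t0 := i%:R * h; have t00 : 0 <= t0 by rewrite mulr_ge0// ltW.
(* The new forcing stays constant on all of []t0, +oo[]; the next step overwrites what lies beyond
   its own node. By causality the earlier relations are not disturbed. *)
pose g' t := if t <= t0 then g t else feedback g t0.
have gg' s : s <= t0 -> g s = g' s by rewrite /g' => ->.
have fg' : forcing g'.
  have [mg gM] := fg; split => [j|t]; last first.
    rewrite /g'; case: ifPn => // _; apply: FM.
    exact: (L2time_history onb r t0 (sol2 fg)).
  rewrite (_ : (fun t => _) = (fun t => if t <= t0 then dot (g t) (e j) else dot (feedback g t0) (e j))).
    apply: measurable_fun_ifT => //; first exact: measurable_fun_ler.
  by apply/funext => t; rewrite /g'; case: ifPn.
have fb s : s <= t0 -> feedback g s = feedback g' s.
  by move=> st; apply: eq_feedback => // x /andP[_ xs]; apply: gg'; exact: le_trans st.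
exists g'; split => // [t tle0|t /andP[tgt0 tle]]; first by rewrite -gg' ?g0// (le_trans tle0).
have [tt0|tt0] := leP t t0.
  have [|tau [/andP[tau0 taut] htau gtau]] := gP t; first by rewrite tgt0.
  exists tau; split; [by rewrite tau0|exact: htau|].
  rewrite -(gg' _ tt0) gtau.
 exact: (fb _ (le_trans taut tt0)).
exists t0; split; first by rewrite t00 ltW.
  by move: tle; rewrite -natr1 mulrDl mul1r -/t0 lerBlDl.
by rewrite -(fb _ (lexx _)) /g' leNgt tt0.
Qed.

Theorem mild_solution : exists g, forcing g /\
  forall t, 0 < t <= B -> g t = F (mild g t) (history (mild g) t).
Proof.
have /choice[gk gkP] : forall k : nat, exists g, [/\ forcing g, forall t, t <= 0 -> g t = 0 &
    forall t, 0 < t <= B -> exists tau, [/\ 0 <= tau <= t, t - tau <= k.+1%:R^-1 &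
      g t = feedback g tau]].
  move=> k; have h0 : 0 < k.+1%:R^-1 :> R by rewrite invr_gt0.
  (* [i + 1 > B (k + 1)], so that [i + 1] steps of length [1 / (k + 1)] cover [[0, B]]. *)
  pose i := Num.truncn (B * k.+1%:R); have [g [fg g0 gP]] := euler_scheme i.+1 h0.
  exists g; split => // t /andP[t0 tB]; apply: gP; rewrite t0/= (le_trans tB)//.
  by rewrite ler_pdivlMr// ltW// truncnS_gt.
have fgk k : forcing (gk k) by have [] := gkP k.
have [D [De Ds]] := duh_compact fgk.
have {Ds}/choice[s sP] := Ds.
pose u := glue D.
have glueE w t : t \in `[0, B] -> glue w t = semi e lam dd u0 t + w t.
  exact: glue_future.
have mildE h t : t \in `[0, B] -> mild h t = semi e lam dd u0 t + duh h t by exact: glueE.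
have Dcvg t : 0 <= t <= B -> forall j,
    dot (duh (gk (s n)) t) (e j) @[n --> \oo] --> dot (D t) (e j).
  move=> tI j; apply: (ip_cvg ip (w := e j)); apply/cvgrPdist_le => eps eps0.
  near=> n; rewrite distrC (le_trans ((sP n).2 t tI))// ltW//.
  by near: n; exact: (near_infty_natSinv_lt (PosNum eps0)).
have D_dist n t : 0 <= t <= B -> `|duh (gk (s n)) t - D t| <= n.+1%:R^-1.
  exact: (sP n).2.
have mD j : measurable_fun `[0, B] (fun t => dot (D t) (e j)).
  apply: (measurable_fun_cvg (h := fun n t => dot (duh (gk (s n)) t) (e j))) => [n|t].
    exact: (measurable_duh_coord onb c0 lamc dd0 B0).
  by rewrite /= in_itv/= => tI; exact: Dcvg.
have u2 : L2time setT u.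
  apply: (L2time_glue u0 onb c0 lamc dd0 phi2 (C := K)) => // t; rewrite in_itv/= => tI.
  exact: (energy_norm onb c0 lamc (De t tI)).
have u_dist n t : `|u t - mild (gk (s n)) t| <= n.+1%:R^-1.
  have [tI|tI] := boolP (t \in `[0, B]).
    rewrite /u (glueE D _ tI) (mildE _ _ tI).
    rewrite opprD addrACA subrr add0r distrC; apply: D_dist.
    by move: tI; rewrite in_itv.
  have -> : mild (gk (s n)) t = u t by apply: glue_out; apply/negP.
  by rewrite subrr normr0.
have inv_small (eps : R) : 0 < eps -> \forall n \near \oo, n.+1%:R^-1 < eps.
  by move=> eps0; exact: (near_infty_natSinv_lt (PosNum eps0)).
have cu : eps_continuous `[0, B] u.
  apply: (eps_continuous_glue _ _ _ onb c0 lamc dd0).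
  apply: (@eps_continuous_uniform _ _ _ _ (fun n => duh (gk (s n)))) => [eps eps0|n].
    have [n _ /(_ n (leqnn n)) nP] := inv_small _ eps0.
    exists n => t; rewrite /= in_itv/= => tI.
    by rewrite (le_trans (D_dist n t tI))// ltW.
  exact: (eps_continuous_duh onb c0 lamc lam_ge dd0 B0).
(* [gk (s n) t] is [F] at the [n]-th approximation and the delayed time [tau n]. Continuity of [F]
   at the history of the limit [u] applies because both the value and the history there are close to
   those of [u] at time [t]. *)
have conv t eps : 0 < t <= B -> 0 < eps -> \forall n \near \oo,
    `|F (u t) (history u t) - gk (s n) t| <= eps.
  move=> tI eps0; have tI' : `[0, B]%classic t.
    by move/andP : tI => [t0 tB]; rewrite /= in_itv/= ltW.
  have /choice[tau tauP] : forall n, exists tau,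
      [/\ 0 <= tau <= t, t - tau <= (s n).+1%:R^-1 & gk (s n) t = feedback (gk (s n)) tau].
    by move=> n; have [_ _] := gkP (s n); exact.
  pose hk n := tau n - t.
  have hkn n : `|hk n| <= n.+1%:R^-1.
    have [/andP[_ tt] tn _] := tauP n; rewrite /hk distrC ger0_norm ?subr_ge0//.
    by rewrite (le_trans tn)// lef_pV2 ?posrE// ler_nat ltnS; have [] := sP n.
  have hk1 n : `|hk n| <= 1.
    by rewrite (le_trans (hkn n))// invf_le1// ler1n.
  have hk0 : hk @ \oo --> (0 : R).
    apply/cvgrPdist_le => x x0; near=> n; rewrite sub0r normrN (le_trans (hkn n))// ltW//.
    by near: n; exact: inv_small.
  have tr := L2time_translation hk1 hk0 onb u2.
  have hut := L2time_history onb r t u2.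
  have [dl dl0 dlP] := F_cont (u t) hut eps0.
  pose q := dl / (16 * (1 + r)).
  have q0 : 0 < q by rewrite divr_gt0// mulr_gt0// addr_gt0.
  pose eta := Num.sqrt q; have eta0 : 0 < eta by rewrite sqrtr_gt0.
  have eta2 : eta ^+ 2 = q by rewrite sqr_sqrtr// ltW.
  have [du du0 duP] := cu t tI' eta eta0.
  have d8 : 0 < dl / 8 by rewrite divr_gt0.
  near=> n.
  have [/andP[tau0 taut] _ ->] := tauP n; rewrite /feedback.
  have tauI : `[0, B]%classic (tau n).
    by move/andP : tI => [_ tB]; rewrite /= in_itv/= tau0 (le_trans taut).
  have n_eta : n.+1%:R^-1 <= eta by rewrite ltW//; near: n; exact: inv_small.
  have n_du : n.+1%:R^-1 < du by near: n; exact: inv_small.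
  apply: dlP; first exact: (L2time_history onb r _ (sol2 (fgk _))).
  have w_le : `|u t - mild (gk (s n)) (tau n)| ^+ 2 <= dl / 2.
    have : `|u t - mild (gk (s n)) (tau n)| <= eta + eta.
      rewrite -(subrK (u (tau n)) (u t)) -addrA (le_trans (ler_normD _ _))// lerD//.
        by apply: duP => //; rewrite distrC (le_lt_trans (hkn n)).
      by rewrite (le_trans (u_dist n _)).
    rewrite -(@ler_pXn2r _ 2) ?nnegrE ?addr_ge0 ?(ltW eta0)// => /le_trans; apply.
    by rewrite -mulr2n exprMn_n eta2; exact: (half_budget dl0 r0).1.
  have tX : (\int[leb]_s (`|u (s + (tau n - t)) - u s| ^+ 2)%:E <= (dl / 8)%:E)%E.
    by near: n; exact: tr.
  have := history_dist_le u2 (sol2 (fgk (s n))) (u_dist n) tX.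
  rewrite /history_sqnorm => psi_le; rewrite [leRHS]splitr; apply: lerD.
    exact: w_le.
  apply: (le_trans psi_le); apply: (half_budget dl0 r0).2.
  by rewrite -/q -eta2 lerXn2r ?nnegrE ?(ltW eta0)// invr_ge0.
(* At time 0 all Euler forcings vanish, so the value 0 there makes the convergence hold on the
   closed interval. *)
pose g t := if 0 < t <= B then F (u t) (history u t) else 0.
pose gj j (n : nat) (t : R) : R := if 0 < t <= B then dot (gk (s n) t) (e j) else 0.
have gcvg j t : gj j n t @[n --> \oo] --> dot (g t) (e j).
  rewrite /g /gj; case: ifPn => [tI|_]; last by rewrite (ip0l ip); exact: cvg_cst.
  apply: (ip_cvg ip (w := e j)); apply/cvgrPdist_le => eps eps0; exact: conv.
have fg : forcing g.
  split => [j|t].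
    apply: (measurable_fun_cvg (h := gj j)) => [n|t _].
      have [mg _] := fgk (s n).
      apply: measurable_fun_ifT => //.
      by apply: measurable_and; [exact: measurable_fun_ltr|exact: measurable_fun_ler].
    exact: gcvg.
  rewrite /g; case: ifPn => _; last by rewrite normr0.
  by apply: FM; exact: (L2time_history onb r t u2).
(* The coordinates of [D] are limits of scalar Duhamel integrals, and [duhamel_cvg] identifies these
   limits. *)
have DE t : 0 <= t <= B -> D t = duh g t.
  move=> tI; have /andP[t0 tB] := tI; apply: (coord_inj ip onb) => j.
  rewrite (duh_coord onb c0 lamc dd0 j fg t0).
  apply: (cvg_unique (@norm_hausdorff _ _) (Dcvg t tI j)).
  rewrite (_ : (fun n => _) = fun n => duhamel (lam j + dd) (fun x => dot (gk (s n) x) (e j)) t); last first.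
    by apply/funext => n; exact: (duh_coord onb c0 lamc dd0).
  have aj : 0 < lam j + dd by rewrite ltr_wpDl.
  apply: (@duhamel_cvg _ _ aj _ _ M) => [n||n x|x /andP[x0 xt]].
  - exact: (fgk (s n)).1.
  - exact: fg.1.
  - by rewrite (le_trans (norm_coord_le onb _ _))//; exact: (fgk (s n)).2.
  - have := gcvg j x; rewrite /gj (le_trans xt tB) andbT.
    move: x0; rewrite le_eqVlt => /predU1P[x0 _|-> //].
    rewrite /g -x0 ltxx (ip0l ip) (_ : (fun n => _) = cst 0); first exact: cvg_cst.
    apply/funext => n; have [_ gk0 _] := gkP (s n).
    by rewrite gk0// (ip0l ip).
have uE : u = mild g.
  apply/funext => t; have [tI|tI] := boolP (t \in `[0, B]); last by apply: glue_out; apply/negP.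
  have DEt : D t = duh g t by apply: DE; move: tI; rewrite in_itv.
  by rewrite /u (glueE D _ tI) (mildE _ _ tI) DEt.
by exists g; split => // t tI; rewrite -uE /g tI.
Unshelve. all: by end_near. Qed.

End mild_solution.

(** * Weak formulation *)

Section itv_oo_cc.
Context (R : realType).
Notation leb := (@lebesgue_measure R).
Variables (a b : R) (f : R -> R).
Hypothesis fi : leb.-integrable `]a, b[ (fun x => (f x)%:E).

Let mf : measurable_fun `[a, b] f.
Proof. by apply: measurable_fun_itv_cc; apply/measurable_EFinP; exact: measurable_int fi. Qed.

Let integral_oo_cc (g : R -> \bar R) : measurable_fun `[a, b] g ->
  (\int[leb]_(x in `]a, b[) g x = \int[leb]_(x in `[a, b]) g x)%E.
Proof.
move=> mg; rewrite integral_itv_obnd_cbnd; last first.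
  by apply: measurable_funS mg => //; apply: subset_itv_oo_cc.
rewrite integral_itv_bndo_bndc//.
by apply: measurable_funS mg => //; apply: subset_itv; rewrite bnd_simp.
Qed.

Lemma integrable_itv_oo_cc : leb.-integrable `[a, b] (fun x => (f x)%:E).
Proof.
have /integrableP[_ foo] := fi; apply/integrableP; split; first exact/measurable_EFinP.
rewrite -integral_oo_cc//; apply/measurable_EFinP; exact: measurableT_comp.
Qed.

Lemma Rintegral_itv_oo_cc : \int[leb]_(x in `]a, b[) f x = \int[leb]_(x in `[a, b]) f x.
Proof. by congr fine; apply: integral_oo_cc; exact/measurable_EFinP. Qed.

End itv_oo_cc.

Lemma ae_eq_Rintegral d (T : measurableType d) (R : realType) (nu : {measure set T -> \bar R})
    (D : set T) (f g : T -> R) : measurable D -> measurable_fun D f -> measurable_fun D g ->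
  (\forall x \ae nu, D x -> f x = g x) -> \int[nu]_(x in D) f x = \int[nu]_(x in D) g x.
Proof.
move=> mD mf mg fg; congr fine; apply: ae_eq_integral => //; try exact/measurable_EFinP.
by apply: filterS fg => x h /h ->.
Qed.

Lemma cvg_opp_add_unique (R : realType) (x y z w : R ^nat) (X Y Z W : R) :
  x @ \oo --> X -> y @ \oo --> Y -> z @ \oo --> Z -> w @ \oo --> W ->
  (forall n, - x n + y n + z n = w n) -> - X + Y + Z = W.
Proof.
move=> xX yY zZ wW xyzw; rewrite -(cvg_lim (@norm_hausdorff _ _) wW).
apply/esym/(cvg_lim (@norm_hausdorff _ _)).
by rewrite -(funext xyzw); apply: cvgD => //; apply: cvgD => //; exact: cvgN.
Qed.

Section weak_form.
Context d (T : measurableType d) (R : realType) (mu : {measure set T -> \bar R}).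
Notation H := (L2 mu).
Notation leb := (@lebesgue_measure R).
Notation dot := (@L2dot d T R mu).
Variables (A : unbounded_operator H) (e : H ^nat) (lam : R ^nat).
Variables (dd r B M : R) (u0 : H) (phi : R -> H).
Hypothesis A_sa : selfadjoint_op A.
Hypothesis eb : eigenbasis A e lam.
Hypothesis dd0 : 0 < dd.
Hypothesis r0 : 0 < r.
Hypothesis B0 : 0 < B.
Hypothesis phi2 : L2time `]- r, 0[ phi.
Let ip := L2dot_inner_product mu.
Let onb := eigenbasis_onb eb.
Let one := proj1 onb.
Let a k := lam k + dd.
Let lam0 k : 0 <= lam k := eigenvalue_ge0 eb k.
Let a0 k : 0 < a k. Proof. by rewrite ltr_wpDl. Qed.

Variable g : R -> H.
Hypothesis fg : forcing e M g.
Let u := mild e lam dd r B u0 phi g.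
Let gj j s := dot (g s) (e j).
Let y j := mode (a j) (gj j) (dot u0 (e j)).

Let mI : measurable (`]0, B[%classic : set R). Proof. exact: measurable_itv. Qed.

Let inI t : t \in `]0, B[ -> t \in `[0, B].
Proof. by rewrite !in_itv/= => /andP[/ltW-> /ltW->]. Qed.

Lemma mild_coord t j : t \in `[0, B] -> dot (u t) (e j) = y j t.
Proof.
move=> tI; have [c c0 lamc] := eigenvalue_lbound eb.
have uE : u t = semi e lam dd u0 t + duh e lam dd g t by exact: glue_future.
have t0 : 0 <= t by move: tI; rewrite in_itv/= => /andP[].
by rewrite uE (ipDl ip) (semi_coord u0 onb c0 lamc dd0)// (duh_coord onb c0 lamc dd0 j fg).
Qed.

Lemma L2time_mild_setT : L2time setT u.
Proof.
have [c c0 lamc] := eigenvalue_lbound eb.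
exact: (L2time_mild u0 onb c0 lamc dd0 B0 phi2 fg).
Qed.

Lemma mild_bounded : exists C, forall t, t \in `[0, B] -> `|u t| <= C.
Proof.
have [c c0 lamc] := eigenvalue_lbound eb.
exists (`|u0| + (M ^+ 2 * B / c + 1)) => t tI.
have uE : u t = semi e lam dd u0 t + duh e lam dd g t by exact: glue_future.
have /andP[t0 tB] : 0 <= t <= B by move: tI; rewrite in_itv.
rewrite uE (le_trans (ler_normD _ _))// lerD//.
  exact: (norm_semi u0 onb c0 lamc dd0).
by apply: (energy_norm onb c0 lamc); apply: (duh_energy onb c0 lamc dd0 fg); rewrite t0.
Qed.

Lemma eps_continuous_mild : eps_continuous `[0, B] u.
Proof.
have [c c0 lamc] := eigenvalue_lbound eb.
apply: (eps_continuous_glue _ _ _ onb c0 lamc dd0).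
exact: (eps_continuous_duh onb c0 lamc (eigenvalue_ge eb) dd0 B0 fg).
Qed.

(* lam exp(-2 a t) <= a exp(- a t) <= 1 / t *)
Let lam_exp t k : 0 < t -> lam k * expR (- (a k * t)) ^+ 2 <= t^-1.
Proof.
move=> t0; have at0 : 0 < a k * t by rewrite mulr_gt0.
have E0 := expR_gt0 (- (a k * t)).
have E1 : expR (- (a k * t)) <= 1 by rewrite -expR0 ler_expR oppr_le0 ltW.
have E2 : a k * t * expR (- (a k * t)) <= 1.
  rewrite expRN ler_pdivrMr ?expR_gt0// mul1r.
  by rewrite (le_trans _ (expR_ge1Dx _))// lerDr.
have h1 : lam k * expR (- (a k * t)) ^+ 2 <= a k * expR (- (a k * t)).
  rewrite expr2 mulrA ler_pM ?mulr_ge0 ?(ltW E0)//.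
  by rewrite (le_trans (ler_piMr _ E1))// lerDl ltW.
rewrite (le_trans h1)// -[leRHS]mul1r ler_pdivlMr//.
by rewrite mulrAC.
Qed.

Let kappa := M ^+ 2 * B.

Let y_sqr j t : y j t ^+ 2 <=
  2 * (expR (- (a j * t)) ^+ 2 * dot u0 (e j) ^+ 2) + 2 * duhamel (a j) (gj j) t ^+ 2.
Proof.
rewrite /y /mode -exprMn; set p := expR _ * _; set q := duhamel _ _ _.
by have := sqr_ge0 (p - q); rewrite sqrrB sqrrD; lra.
Qed.

Let duh_en t n : t \in `[0, B] ->
  \sum_(0 <= k < n) lam k * duhamel (a k) (gj k) t ^+ 2 <= kappa.
Proof.
rewrite in_itv/= => /andP[t0 tB]; have [c c0 lamc] := eigenvalue_lbound eb; have [mg gM] := fg.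
rewrite (le_trans (duhamel_energy onb c0 lamc dd0 mg gM n t0))//.
by rewrite ler_wpM2l ?sqr_ge0.
Qed.

(** Smoothing at a fixed positive time. The bound [1 / t] is not integrable at 0, so
    [L2time_pow_mild] argues differently. *)
Lemma mild_dom t : t \in `]0, B[ -> op_dom (op_pow A 2^-1) (u t).
Proof.
move=> tI; have t0 : 0 < t by move: tI; rewrite in_itv/= => /andP[].
suff h n : \sum_(0 <= k < n) lam k * dot (u t) (e k) ^+ 2 <=
    2 * (t^-1 * `|u0| ^+ 2) + 2 * kappa by exact: (op_dom_half A_sa eb h).
apply: (@le_trans _ _ (\sum_(0 <= k < n) (2 * (t^-1 * dot u0 (e k) ^+ 2) +
   2 * (lam k * duhamel (a k) (gj k) t ^+ 2)))).
  apply: ler_sum => k _; rewrite mild_coord ?inI//.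
  apply: (le_trans (ler_wpM2l (lam0 k) (y_sqr k t))).
  rewrite mulrDr lerD//; last by rewrite mulrCA.
  by rewrite mulrCA ler_wpM2l// mulrA ler_wpM2r ?sqr_ge0// lam_exp.
rewrite big_split/= -!mulr_sumr lerD// ler_wpM2l//.
  by rewrite ler_wpM2l ?invr_ge0 ?(ltW t0)//; exact: (bessel ip one).
by apply: duh_en; exact: inI.
Qed.

Lemma mild_half_coord t j : t \in `]0, B[ ->
  dot (op_pow A 2^-1 (u t)) (e j) = lam j `^ 2^-1 * y j t.
Proof. by move=> tI; rewrite (op_pow_coord A_sa eb (mild_dom tI)) mild_coord// inI. Qed.

Let gjM j t : `|gj j t| <= M.
Proof. by rewrite (le_trans (norm_coord_le onb _ _))//; exact: fg.2. Qed.

Let my j : measurable_fun `]0, B[ (y j).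
Proof.
have /measurable_int/measurable_EFinP := integrable_mode (a0 j) (fg.1 j) (gjM j) (dot u0 (e j)) (ltW B0).
by apply: measurable_funS => //; exact: subset_itv_oo_cc.
Qed.

Let energy_exp k t : 2 * (lam k * expR (- (a k * t)) ^+ 2) <=
  - (- (2 * a k) * expR (- (2 * a k) * t)).
Proof.
have -> : expR (- (2 * a k) * t) = expR (- (a k * t)) ^+ 2.
  by rewrite expr2 -expRD; congr expR; ring.
rewrite mulNr opprK mulrA ler_wpM2r ?sqr_ge0// ler_wpM2l//.
by rewrite lerDl ltW.
Qed.

(** For the semigroup part [2 lam exp (- 2 a t)] is at most [2 a exp (- 2 a t)], minus the
    derivative of [exp (- 2 a t)], with integral at most 1; Bessel's inequality sums the modes to
    [|u0|^2]. The Duhamel part is bounded at every time. *)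
Lemma L2time_pow_mild : L2time_pow A 2^-1 `]0, B[ u.
Proof.
split; first by apply: aeW => t; exact: mild_dom.
have mc j : measurable_fun `]0, B[ (fun t => dot (op_pow A 2^-1 (u t)) (e j)).
  apply: (eq_measurable_fun (fun t => lam j `^ 2^-1 * y j t)).
    by move=> t; rewrite inE /= => tI; rewrite mild_half_coord.
  exact: (measurable_funM (measurable_cst _) (my j)).
have mp := pettis onb mI mc; split => //.
rewrite (integral_sqr_norm_coord onb mI mp).
apply: (@le_lt_trans _ _ (`|u0| ^+ 2 + 2 * kappa * B)%:E); last exact: ltry.
apply: lime_le; first by apply: is_cvg_nneseries => j _ _; apply: integral_ge0 => t _; rewrite lee_fin sqr_ge0.
apply: nearW => n.
have mc2 j : measurable_fun `]0, B[ (fun t => (dot (op_pow A 2^-1 (u t)) (e j) ^+ 2)%:E).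
  by apply/measurable_EFinP; exact: measurable_funX (mc j).
rewrite -ge0_integral_sum//; last by move=> j t _; rewrite lee_fin sqr_ge0.
(* The summands of [bnd] are written as derivatives of exponentials so that [Rintegral_expR]
   evaluates them. *)
pose c k := - (2 * a k); pose w k := dot u0 (e k) ^+ 2.
pose bnd t := \sum_(0 <= k < n) - w k * (c k * expR (c k * t)) + 2 * kappa.
have iexp k : leb.-integrable `[0, B] (fun t => (- w k * (c k * expR (c k * t)))%:E).
  apply: integrable_within_continuous; apply: continuous_subspaceT => t.
  apply: cvgM; first exact: cvg_cst; apply: cvgM; first exact: cvg_cst.
  apply: (continuous_comp (f := fun t => c k * t)); last exact: continuous_expR.
  exact: mulrl_continuous.
have [isum sumE] := Rintegral_sum n iexp (measurable_itv _).
have ick : leb.-integrable `[0, B] (fun=> (2 * kappa)%:E).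
  apply: (@integrable_bounded _ _ _ _ _ (fun=> 2 * kappa) `|2 * kappa|) => //.
  exact: lebesgue_itvcc_lty.
have ibnd : leb.-integrable `[0, B] (fun t => (bnd t)%:E) by exact: integrable_itvD.
have kappa0 : 0 <= kappa by rewrite mulr_ge0 ?sqr_ge0 ?(ltW B0).
have bnd0 t : 0 <= bnd t.
  apply: addr_ge0; last by rewrite mulr_ge0.
  apply: sumr_ge0 => k _.
  rewrite mulNr -mulrN mulr_ge0 ?sqr_ge0//; apply: le_trans (energy_exp k t).
  by rewrite mulr_ge0// mulr_ge0// sqr_ge0.
apply: (@le_trans _ _ (\int[leb]_(t in `]0%R, B[) (bnd t)%:E)%E).
  apply: ge0_le_integral => //.
  - by move=> t _; apply: sume_ge0 => k _; rewrite lee_fin sqr_ge0.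
  - by apply: emeasurable_sum => k; exact: mc2.
  - apply: measurable_funS (measurable_int _ ibnd) => //; exact: subset_itv_oo_cc.
  - move=> t tI; rewrite sumEFin lee_fin /bnd.
    apply: (@le_trans _ _ (\sum_(0 <= k < n) (- w k * (c k * expR (c k * t)) +
      2 * (lam k * duhamel (a k) (gj k) t ^+ 2)))).
      apply: ler_sum => k _; rewrite mild_half_coord// exprMn powR_half_sqr//.
      apply: (le_trans (ler_wpM2l (lam0 k) (y_sqr k t))); rewrite mulrDr lerD//; last by rewrite mulrCA.
      rewrite mulNr -mulrN; apply: le_trans (ler_wpM2l (sqr_ge0 _) (energy_exp k t)).
      by rewrite mulrCA -/(w k) [leRHS]mulrC !mulrA.
    rewrite big_split/= lerD2l -mulr_sumr ler_wpM2l//.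
    by apply: duh_en; exact: inI.
apply: (@le_trans _ _ (\int[leb]_(t in `[0%R, B]) (bnd t)%:E)%E).
  apply: ge0_subset_integral => //.
    exact: measurable_int ibnd.
  by move=> t _; rewrite lee_fin.
have bfin : (\int[leb]_(t in `[0%R, B]) (bnd t)%:E)%E \is a fin_num.
  by apply: integrable_fin_num.
suff : \int[leb]_(t in `[0, B]) bnd t <= `|u0| ^+ 2 + 2 * kappa * B.
  by rewrite -lee_fin /Rintegral fineK.
rewrite RintegralD// sumE lerD//.
  apply: le_trans (bessel ip one u0 n); apply: ler_sum => k _.
  rewrite RintegralZl//; last first.
    apply: integrable_within_continuous; apply: continuous_subspaceT => t.
    apply: cvgM; first exact: cvg_cst.
    apply: (continuous_comp (f := fun t => c k * t)); last exact: continuous_expR.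
    exact: mulrl_continuous.
  rewrite Rintegral_expR ?(ltW B0)// mulr0 expR0 mulNr -mulrN opprB.
  by rewrite ler_piMr ?sqr_ge0// lerBlDr lerDl expR_ge0.
by rewrite Rintegral_cst// fine_lebesgue_itvcc ?subr0// ltW.
Qed.

Section test_function.
Variables v dv : R -> H.
Hypothesis v_half : L2time_pow A 2^-1 `]0, B[ v.
Hypothesis dv2 : L2time `]0, B[ dv.
Hypothesis v_der : has_time_derivative A B v dv.
Hypothesis vB : v B = 0.

(** The [j]-th coordinate of [v']: as [dv] stands for [A^(-1/2) v'], the factor [lam j ^ (1/2)]
    restores it. *)
Let p j t := lam j `^ 2^-1 * dot (dv t) (e j).
Let vj j t := dot (v t) (e j).

Let idv j : leb.-integrable `]0, B[ (fun t => (dot (dv t) (e j))%:E).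
Proof.
have [mdv _] := dv2.
have i1 : leb.-integrable `]0, B[ (fun=> (1 : R)%:E).
  apply: (@integrable_bounded _ _ _ _ _ (fun=> 1) 1) => //; first exact: lebesgue_itvoo_lty.
  by move=> t _; rewrite normr1.
apply: (le_integrableR (integrable_addR i1 (integrable_sqr_L2time mI dv2) mI)) => //.
  exact: measurable_coord.
move=> t _; rewrite (le_trans (norm_coord_le onb _ _))//.
by have := sqr_ge0 (`|dv t| - 1); have := normr_ge0 (dv t); rewrite sqrrB1; lra.
Qed.

Let ip_int j : leb.-integrable `[0, B] (fun t => (p j t)%:E).
Proof. by apply: integrable_itvZl; exact: integrable_itv_oo_cc. Qed.

Let half_gt0 j : 0 < lam j `^ 2^-1.
Proof. exact: powR_gt0 (eigenvalue_gt0 eb j). Qed.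

Let vjE j t : t \in `[0, B] -> vj j t = vj j 0 + \int[leb]_(s in `[0, t]) p j s.
Proof.
move=> tI; have := v_der tI (e j).
rewrite !(op_pow_coord A_sa eb (op_dom_neg_half A_sa eb _)) powRN => /(congr1 ( *%R (lam j `^ 2^-1))).
rewrite mulrDr !mulrA divff ?gt_eqF// !mul1r => E; rewrite /vj E; congr (_ + _).
rewrite /p RintegralZl//; move: tI; rewrite in_itv/= => /andP[t0 tB].
exact: integrable_itvS (integrable_itv_oo_cc (idv j)).
Qed.

Let mvj_cc j : measurable_fun `[0, B] (vj j).
Proof.
pose h (t : R) : R := vj j 0 + \int[leb]_(s in `[0, t]) p j s.
apply: (eq_measurable_fun h).
  by move=> t; rewrite inE /= => tI; rewrite vjE.
by apply: measurable_funD => //; apply: measurable_primitive (ip_int j); exact: ltW.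
Qed.

Let mvj j : measurable_fun `]0, B[ (vj j).
Proof. by apply: measurable_funS (mvj_cc j) => //; exact: subset_itv_oo_cc. Qed.

Let vj_bound j t : t \in `[0, B] -> `|vj j t| <= `|vj j 0| + \int[leb]_(s in `[0, B]) `|p j s|.
Proof.
by move=> tI; rewrite vjE// (le_trans (ler_normD _ _))// lerD2l; exact: normr_primitive_le.
Qed.

(** The spectral gap gives [c |v t|^2 <= |A^(1/2) v t|^2] for almost every [t]. *)
Let v2 : L2time `]0, B[ v.
Proof.
have mv := pettis onb mI mvj; split => //.
have [vdom [mhv hv]] := v_half; have [c c0 lamc] := eigenvalue_lbound eb.
apply: (@le_lt_trans _ _ (\int[leb]_(t in `]0%R, B[) (c^-1%:E * (`|op_pow A 2^-1 (v t)| ^+ 2)%:E))%E).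
  apply: ae_ge0_le_integral => //.
  - by apply/measurable_EFinP; apply: measurable_funX; exact: measurable_normL2.
  - by move=> t _; rewrite -EFinM lee_fin mulr_ge0 ?invr_ge0 ?(ltW c0)// sqr_ge0.
  - by apply: measurable_funeM; apply/measurable_EFinP; apply: measurable_funX; exact: measurable_normL2.
  - have [N [mN N0 NP]] := vdom; exists N; split => // t /= nt; apply: NP => vdt; apply: nt => tI.
    rewrite -EFinM lee_fin ler_pdivlMl//.
    rewrite -ler_pdivlMl//; apply: (sqr_norm_le ip onb) => n.
    rewrite ler_pdivlMl//; apply: le_trans (bessel ip one _ n).
    rewrite mulr_sumr; apply: ler_sum => k _.
    rewrite (op_pow_coord A_sa eb (vdt tI)) exprMn powR_half_sqr//.
    by rewrite ler_wpM2r ?sqr_ge0.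
rewrite ge0_integralZl//; last 2 first.
- by apply/measurable_EFinP; apply: measurable_funX; exact: measurable_normL2.
- by rewrite lee_fin invr_ge0 ltW.
by rewrite lte_mul_pinfty// lee_fin invr_ge0 ltW.
Qed.

Let g2 : L2time `]0, B[ g.
Proof.
apply: (L2time_bounded onb (C := M)) => //; first exact: lebesgue_itvoo_lty.
  by move=> j; apply: measurable_funTS; exact: fg.1.
by move=> t _; exact: fg.2.
Qed.

Let u2 : L2time `]0, B[ u.
Proof. exact: L2timeS L2time_mild_setT. Qed.

(** Integration by parts for [y' = g - (lam + d) y] against the coordinate of [v]. The half powers
    of [lam] combine: with [dv] they give [v'], and their product with each other is [lam]. As [v t]
    lies in D(A^(1/2)) only for almost every [t], the last two integrals are compared almost
    everywhere. *)
Let mode_identity j :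
  - (\int[leb]_(t in `]0, B[) (dot (op_pow A 2^-1 (u t)) (e j) * dot (dv t) (e j)))
  + \int[leb]_(t in `]0, B[)
      (dot (op_pow A 2^-1 (u t)) (e j) * dot (op_pow A 2^-1 (v t)) (e j))
  + \int[leb]_(t in `]0, B[) (dot (dd *: u t - g t) (e j) * dot (v t) (e j))
  = dot u0 (e j) * dot (v 0) (e j).
Proof.
have hu := L2time_pow_mild.2; have hv := v_half.2.
have du2 := L2timeB onb mI (L2timeZ onb dd mI u2) g2.
have iX := integrable_coord_mul onb j mI hu dv2.
have iY := integrable_coord_mul onb j mI hu hv.
have iZ := integrable_coord_mul onb j mI du2 v2.
have kint : leb.-integrable `[0, B] (fun t => (gj j t - a j * y j t)%:E).
  apply: integrable_itvB; first exact: (integrable_source (fg.1 j) (gjM j)).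
  apply: integrable_itvZl.
  exact: (integrable_mode (a0 j) (fg.1 j) (gjM j) (dot u0 (e j)) (ltW B0)).
have yE t : t \in `[0, B] -> y j t = dot u0 (e j) + \int[leb]_(s in `[0, t]) (gj j s - a j * y j s).
  rewrite in_itv/= => /andP[t0 _].
  exact: (mode_ode (a0 j) (fg.1 j) (gjM j) (dot u0 (e j)) t0).
have v0 : vj j B = 0 by rewrite /vj vB (ip0l ip).
have by_parts := Rintegral_by_parts (ltW B0) (ip_int j) kint yE (vjE j) v0.
have X_E : \int[leb]_(t in `]0, B[) (dot (op_pow A 2^-1 (u t)) (e j) * dot (dv t) (e j)) =
    \int[leb]_(t in `[0, B]) (y j t * p j t).
  have XE t : t \in `]0, B[%classic ->
      dot (op_pow A 2^-1 (u t)) (e j) * dot (dv t) (e j) = y j t * p j t.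
    by rewrite inE /= => tI; rewrite mild_half_coord// /p; ring.
  have -> : \int[leb]_(t in `]0, B[) (dot (op_pow A 2^-1 (u t)) (e j) * dot (dv t) (e j)) =
      \int[leb]_(t in `]0, B[) (y j t * p j t) by apply: eq_Rintegral.
  apply: Rintegral_itv_oo_cc.
  by apply: eq_integrable iX => // t tI; rewrite XE.
have kv_int : leb.-integrable `[0, B] (fun t => ((gj j t - a j * y j t) * vj j t)%:E).
  exact: (integrable_mul_bounded _ kint (mvj_cc j) (fun t tI => vj_bound j tI)).
have kv_oo : leb.-integrable `]0, B[ (fun t => (- ((gj j t - a j * y j t) * vj j t))%:E).
  have : leb.-integrable `]0, B[ (fun t => ((gj j t - a j * y j t) * vj j t)%:E).
    by apply: integrableS kv_int => //; exact: subset_itv_oo_cc.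
  move=> h; have := integrable_scaleR (-1) h mI.
  by apply: eq_integrable => // t _; rewrite mulN1r.
have YZ_E : \int[leb]_(t in `]0, B[)
      (dot (op_pow A 2^-1 (u t)) (e j) * dot (op_pow A 2^-1 (v t)) (e j))
    + \int[leb]_(t in `]0, B[) (dot (dd *: u t - g t) (e j) * dot (v t) (e j))
    = - \int[leb]_(t in `[0, B]) ((gj j t - a j * y j t) * vj j t).
  rewrite -RintegralD//.
  transitivity (\int[leb]_(t in `]0, B[) (- ((gj j t - a j * y j t) * vj j t))).
    apply: ae_eq_Rintegral => //.
    - by apply/measurable_EFinP; exact: measurable_int (integrable_addR iY iZ mI).
    - by apply/measurable_EFinP; exact: measurable_int kv_oo.
    have [N [mN N0 NP]] := v_half.1; exists N; split => // t /= nt; apply: NP => vdt.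
    apply: nt => tI; rewrite mild_half_coord// (op_pow_coord A_sa eb (vdt tI)).
    rewrite (ipBl ip) (ipZl ip) mild_coord ?inI// mulrACA powR_half_mul//.
    by rewrite /a /vj /gj; ring.
  rewrite (Rintegral_itv_oo_cc kv_oo) -[RHS]mulN1r -RintegralZl//.
  by apply: eq_Rintegral => t _; rewrite mulN1r.
by rewrite -addrA YZ_E X_E by_parts addrK.
Qed.

Theorem weak_identity :
  - (\int[leb]_(t in `]0, B[) dual_pairing A (u t) (dv t))
  + \int[leb]_(t in `]0, B[) dot (op_pow A 2^-1 (u t)) (op_pow A 2^-1 (v t))
  + \int[leb]_(t in `]0, B[) dot (dd *: u t - g t) (v t) = dot u0 (v 0).
Proof.
have hu := L2time_pow_mild.2; have hv := v_half.2.
have du2 := L2timeB onb mI (L2timeZ onb dd mI u2) g2.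
have cX := parseval_integral onb mI hu dv2.
have cY := parseval_integral onb mI hu hv.
have cZ := parseval_integral onb mI du2 v2.
have cR := parseval ip onb (u := u0) (v := v 0).
apply: (cvg_opp_add_unique cX cY cZ cR) => n.
by rewrite -sumrN -!big_split/=; apply: eq_bigr => k _; rewrite mode_identity.
Qed.

End test_function.
End weak_form.

Theorem theorem1 (R : realType) (n0 : nat) (hn0 : (0 < n0)%N)
  (Omega : smooth_bounded_domain R n0)
  (A : unbounded_operator (L2dom Omega))
  (hA_lin : linear_op A) (hA_dense : dense (op_dom A))
  (hA_sa : selfadjoint_op A) (hA_pos : positive_op A)
  (hA_res : compact_resolvent A)
  (d r : R) (hd : 0 < d) (hr : 0 < r) (n : nat)
  (b : R -> R) (f : 'rV[R]_n0 -> R)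
  (xi : nat -> R -> L2dom Omega -> (R -> L2dom Omega) -> R)
  (hb_lip : forall w : R, exists2 U, nbhs w U & [lipschitz b y | y in U])
  (hb_bounded : exists Cb : R, forall w : R, `|b w| <= Cb)
  (hf_meas : measurable_fun (difference_set Omega) f)
  (hf_bounded : exists Cf : R,
    forall z, difference_set Omega z -> `|f z| <= Cf)
  (hxi_ext : history_extensional r (xi n))
  (hxi_lip : forall M : R, 0 < M -> exists L : R,
    forall (v1 v2 : L2dom Omega) (psi1 psi2 : R -> L2dom Omega),
      L2time `]- r, 0[ psi1 -> L2time `]- r, 0[ psi2 ->
      history_sqnorm r v1 psi1 <= M ^+ 2 ->
      history_sqnorm r v2 psi2 <= M ^+ 2 ->
      \int[lebesgue_measure]_(theta in `]- r, 0[)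
        `|xi n theta v1 psi1 - xi n theta v2 psi2|
      <= L * Num.sqrt (history_sqnorm r (v1 - v2)
                         (fun s => psi1 s - psi2 s)))
  (hxi_L1 : exists2 C : R, 0 < C &
    forall (v : L2dom Omega) (psi : R -> L2dom Omega),
      L2time `]- r, 0[ psi ->
      lebesgue_measure.-integrable `]- r, 0[
        (fun theta => (xi n theta v psi)%:E) /\
      \int[lebesgue_measure]_(theta in `]- r, 0[) `|xi n theta v psi| <= C) :
  forall (u0 : L2dom Omega) (phi : R -> L2dom Omega),
    L2time `]- r, 0[ phi ->
    forall Tmax : R, 0 < Tmax ->
    exists u : R -> L2dom Omega,
      weak_solution A d r b f (xi n) u0 phi Tmax u /\
      {within `[0, Tmax], continuous u}.
Proof.
move=> u0 phi phi2 B B0.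
have [e [lam eb]] := exists_eigenbasis hA_sa hA_lin hA_dense hA_pos hA_res
  (@L2dom_infinite_dim R n0 Omega hn0).
have onb := eigenbasis_onb eb.
have [c c0 lamc] := eigenvalue_lbound eb.
have cb : continuous b.
  by move=> w; have [U wU bU] := hb_lip w; exact: lipschitz_nbhs_continuous wU bU.
have [Cb bC] := hb_bounded; have [Cf fC] := hf_bounded; have [Cxi _ xiC] := hxi_L1.
have [M FM] := delay_term_bounded cb bC hf_meas fC xiC onb.
(* [|M|] because the bound on the forcing has to be nonnegative. *)
have [g [fg gE]] : exists g : R -> L2dom Omega, forcing e `|M| g /\
    forall t, 0 < t <= B -> g t =
      delay_term r b f (xi n) (mild e lam d r B u0 phi g t)
        (history (mild e lam d r B u0 phi g) t).
  apply: (mild_solution u0 onb c0 lamc (eigenvalue_ge eb) hd hr B0 (normr_ge0 M) phi2).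
  - by move=> w psi psi2; rewrite (le_trans (FM _ _ psi2))// ler_norm.
  - by move=> w psi1 psi2; have h := @delay_term_ext R n0 Omega r b f (xi n) cb hf_meas hxi_ext w psi1 psi2; exact: h.
  - by move=> w psi eps; have h := @delay_term_continuous R n0 Omega r b f Cb Cf Cxi (xi n) cb bC hf_meas fC hxi_lip xiC e onb w psi eps; exact: h.
have mI : measurable (`]0, B[%classic : set R) by exact: measurable_itv.
have uT := L2time_mild_setT u0 eb hd B0 phi2 fg.
exists (mild e lam d r B u0 phi g); split; last first.
  exact: eps_continuousW (eps_continuous_mild r u0 phi eb hd B0 fg).
split.
- split; first by apply: measurable_funTS; exact: uT.1.
  have [C uC] := mild_bounded r B u0 phi eb hd fg.
  by exists C; apply: aeW => t /subset_itv_oo_cc; exact: uC.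
- exact: L2timeS uT.
- exact: (L2time_pow_mild r u0 phi hA_sa eb hd B0 fg).
- by move=> theta; exact: glue_past.
move=> v dv v_half dv2 v_der vB.
rewrite -(weak_identity u0 hA_sa eb hd B0 phi2 fg v_half dv2 v_der vB).
(* The forcing equals the delay term on []0, B]], which contains the domain of integration. *)
congr (_ + _); apply: eq_Rintegral => t; rewrite inE /= in_itv /= => /andP[t0 tB].
by rewrite /delay_at -gE// t0 ltW.
Qed.
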